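(* Let $n\ge 1$, let $\lambda$ be a partition of $n$ and let $\Lambda$ be a standard tableau of shape $\lambda$. Then the restriction of the $H_n$-valued rational function $F_\Lambda(z_1,\dots,z_n)$ to the subspace $\mathcal{H}_\Lambda\subset\mathbb{C}(q)^n$ is regular at $z_1=z_2=\dots=z_n\neq 0$, and its value there is the element $F_\Lambda\in H_n$, i.e. the same element as the value at $z_1=\dots=z_n\ne0$ of the restriction of $F_\Lambda(z_1,\dots,z_n)$ to the subspace $\mathcal{R}_\Lambda$. The left ideal $H_nF_\Lambda$ is an irreducible $H_n$-module (under left multiplication), and the $H_n$-modules obtained in this way from standard tableaux whose shapes are different partitions of $n$ are pairwise non-equivalent.
   Context: $H_n$ is the Hecke algebra over the field $\mathbb{C}(q)$ of rational functions in $q$, with generators $T_1,\dots,T_{n-1}$ and relations $(T_i-q)(T_i+q^{-1})=0$; $T_iT_{i+1}T_i=T_{i+1}T_iT_{i+1}$; $T_iT_j=T_jT_i$ for $j\ne i,i\pm1$. The Young diagram of a partition $\lambda=(\lambda_1\ge\lambda_2\ge\cdots)$ of $n$ is the set of boxes $(i,j)$ with $1\le j\le\lambda_i$ ($i$ is the row index, increasing downwards; $j$ is the column index, increasing to the right). A standard tableau $\Lambda$ of shape $\lambda$ is a filling of the boxes of $\lambda$ with the numbers $1,\dots,n$, each occurring once, increasing along rows and down columns. If the box $(i,j)$ contains $a$, the content of $a$ is $c_a(\Lambda)=j-i$. The $i$-th principal hook of $\lambda$ is the set of boxes $\{(i,j')\in\lambda: j'\ge i\}\cup\{(i',i)\in\lambda: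 i'\ge i\}$; the principal hooks partition the diagram. For $i=1,\dots,n-1$ put $$F_i(a,b)=T_i+\frac{q-q^{-1}}{a^{-1}b-1},$$ an $H_n$-valued rational function of two variables $a\neq0$, $a\ne b$. For a standard tableau $\Lambda$ put $$F_\Lambda(z_1,\dots,z_n)=\prod_{(i,j)}^{\rightarrow}F_{j-i}\bigl(q^{2c_i(\Lambda)}z_i,\;q^{2c_j(\Lambda)}z_j\bigr),$$ an $H_n$-valued rational function of $z_1,\dots,z_n\in\mathbb{C}(q)$, where the product is over all pairs $1\le i<j\le n$, multiplied from left to right in the order in which $(i,j)$ precedes $(i',j')$ if $j<j'$, or if $j=j'$ and $i<i'$. $\mathcal{H}_\Lambda\subset\mathbb{C}(q)^n$ is the subspace of all tuples $(z_1,\dots,z_n)$ with $z_i=z_j$ whenever $i$ and $j$ appear in the same principal hook of $\Lambda$. $\mathcal{R}_\Lambda\subset\mathbb{C}(q)^n$ is the subspace of all tuples with $z_i=z_j$ whenever $i$ and $j$ appear in the same row of $\Lambda$. It is a previously known result that the restriction of $F_\Lambda(z_1,\dots,z_n)$ to $\mathcal{R}_\Lambda$ is regular at $z_1=\dots=z_n\neq0$; its value there (independent of the common nonzero value of the $z_i$) is the element denoted $F_\Lambda\in H_n$. *)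

(* Defs.v *)
From HB Require Import structures.
From mathcomp Require Import all_boot all_order all_algebra.
From mathcomp Require Import boolp classical_sets reals complex.
From mathcomp Require mpoly.

Set Implicit Arguments.
Unset Strict Implicit.
Unset Printing Implicit Defensive.

Import GRing.Theory.
Local Open Scope ring_scope.
Local Open Scope quotient_scope.

(* R[i] is the field of complex numbers, for R a model of the reals. *)
Definition Cq (R : realType) : fieldType := {fraction {poly R[i]}}.
Definition qvar (R : realType) : Cq R := tofrac ('X : {poly R[i]}).

(* The K-algebra presented by the generators and relations of H_n: formal
   noncommutative expressions modulo the least congruence containing the
   axioms of unital associative K-algebras and the Hecke relations.
   [HGen i], with i = 0, ..., n-2, stands for T_(i+1). *)
Section HeckeAlgebra.
Variables (K : fieldType) (q : K) (n : nat).

Inductive hterm : Type :=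
  | HGen of 'I_n.-1
  | HScal of K
  | HAdd of hterm & hterm
  | HMul of hterm & hterm.

Inductive heq : hterm -> hterm -> Prop :=
  | heq_refl x : heq x x
  | heq_sym x y : heq x y -> heq y x
  | heq_trans x y z : heq x y -> heq y z -> heq x z
  | heq_add x x' y y' : heq x x' -> heq y y' -> heq (HAdd x y) (HAdd x' y')
  | heq_mul x x' y y' : heq x x' -> heq y y' -> heq (HMul x y) (HMul x' y')
  | heq_addA x y z : heq (HAdd x (HAdd y z)) (HAdd (HAdd x y) z)
  | heq_addC x y : heq (HAdd x y) (HAdd y x)
  | heq_add0 x : heq (HAdd (HScal 0) x) x
  | heq_addN x : heq (HAdd (HMul (HScal (-1)) x) x) (HScal 0)
  | heq_mulA x y z : heq (HMul x (HMul y z)) (HMul (HMul x y) z)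
  | heq_mul1 x : heq (HMul (HScal 1) x) x
  | heq_mulDl x y z : heq (HMul (HAdd x y) z) (HAdd (HMul x z) (HMul y z))
  | heq_mulDr x y z : heq (HMul x (HAdd y z)) (HAdd (HMul x y) (HMul x z))
  | heq_scalD a b : heq (HScal (a + b)) (HAdd (HScal a) (HScal b))
  | heq_scalM a b : heq (HScal (a * b)) (HMul (HScal a) (HScal b))
  | heq_scalC a x : heq (HMul (HScal a) x) (HMul x (HScal a))
  | heq_quad i :
      heq (HMul (HAdd (HGen i) (HScal (- q))) (HAdd (HGen i) (HScal q^-1)))
          (HScal 0)
  | heq_braid (i j : 'I_n.-1) : j = i.+1 :> nat ->
      heq (HMul (HMul (HGen i) (HGen j)) (HGen i))
          (HMul (HMul (HGen j) (HGen i)) (HGen j))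
  | heq_comm (i j : 'I_n.-1) :
      j <> i :> nat -> j <> i.+1 :> nat -> i <> j.+1 :> nat ->
      heq (HMul (HGen i) (HGen j)) (HMul (HGen j) (HGen i)).

HB.instance Definition _ := gen_eqMixin hterm.
HB.instance Definition _ := gen_choiceMixin hterm.

Definition heqb : rel hterm := fun x y => `[< heq x y >].

Fact heqb_equiv : equiv_class_of heqb.
Proof.
split=> [x|x y|y x z].
- by apply/asboolP; exact: heq_refl.
- by apply/asboolP/asboolP => /heq_sym.
- by move=> /asboolP xy /asboolP yz; apply/asboolP; exact: heq_trans xy yz.
Qed.

Canonical heqb_equiv_rel := EquivRelPack heqb_equiv.

Definition hecke := {eq_quot heqb}.

HB.instance Definition _ := Choice.on hecke.
HB.instance Definition _ := EqQuotient.on hecke.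

Definition hcl (x : hterm) : hecke := \pi_hecke x.

Lemma hclP x y : hcl x = hcl y <-> heq x y.
Proof.
split=> [/eqmodP /asboolP //|xy].
by apply/eqmodP/asboolP.
Qed.

Lemma hreprK (x : hecke) : hcl (repr x) = x.
Proof. exact: reprK. Qed.

Lemma heq_repr x : heq (repr (hcl x)) x.
Proof. by apply/hclP; rewrite hreprK. Qed.

Lemma hcl_ind (P : hecke -> Prop) : (forall x, P (hcl x)) -> forall x, P x.
Proof. by move=> h x; rewrite -(hreprK x). Qed.

Definition hadd (x y : hecke) := hcl (HAdd (repr x) (repr y)).
Definition hmul (x y : hecke) := hcl (HMul (repr x) (repr y)).
Definition hscale (a : K) (x : hecke) := hcl (HMul (HScal a) (repr x)).
Definition hopp (x : hecke) := hscale (-1) x.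

Lemma haddE x y : hadd (hcl x) (hcl y) = hcl (HAdd x y).
Proof. by apply/hclP; apply: heq_add; exact: heq_repr. Qed.

Lemma hmulE x y : hmul (hcl x) (hcl y) = hcl (HMul x y).
Proof. by apply/hclP; apply: heq_mul; exact: heq_repr. Qed.

Lemma hscaleE a x : hscale a (hcl x) = hcl (HMul (HScal a) x).
Proof. by apply/hclP; apply: heq_mul; [exact: heq_refl|exact: heq_repr]. Qed.

Fact haddA : associative hadd.
Proof.
elim/hcl_ind=> x; elim/hcl_ind=> y; elim/hcl_ind=> z.
by rewrite !haddE; apply/hclP; exact: heq_addA.
Qed.

Fact haddC : commutative hadd.
Proof.
elim/hcl_ind=> x; elim/hcl_ind=> y.
by rewrite !haddE; apply/hclP; exact: heq_addC.
Qed.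

Fact hadd0 : left_id (hcl (HScal 0)) hadd.
Proof. by elim/hcl_ind=> x; rewrite haddE; apply/hclP; exact: heq_add0. Qed.

Fact haddN : left_inverse (hcl (HScal 0)) hopp hadd.
Proof.
by elim/hcl_ind=> x; rewrite /hopp hscaleE haddE; apply/hclP; exact: heq_addN.
Qed.

Fact hmulA : associative hmul.
Proof.
elim/hcl_ind=> x; elim/hcl_ind=> y; elim/hcl_ind=> z.
by rewrite !hmulE; apply/hclP; exact: heq_mulA.
Qed.

Fact hmul1 : left_id (hcl (HScal 1)) hmul.
Proof. by elim/hcl_ind=> x; rewrite hmulE; apply/hclP; exact: heq_mul1. Qed.

Fact hmulr1 : right_id (hcl (HScal 1)) hmul.
Proof.
elim/hcl_ind=> x; rewrite hmulE; apply/hclP.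
exact: heq_trans (heq_sym (heq_scalC _ _)) (heq_mul1 _).
Qed.

Fact hmulDl : left_distributive hmul hadd.
Proof.
elim/hcl_ind=> x; elim/hcl_ind=> y; elim/hcl_ind=> z.
by rewrite !(hmulE, haddE); apply/hclP; exact: heq_mulDl.
Qed.

Fact hmulDr : right_distributive hmul hadd.
Proof.
elim/hcl_ind=> x; elim/hcl_ind=> y; elim/hcl_ind=> z.
by rewrite !(hmulE, haddE); apply/hclP; exact: heq_mulDr.
Qed.

Section Evaluation.
Variables (A : algType K) (t : 'I_n.-1 -> A).

Fixpoint heval (x : hterm) : A :=
  match x with
  | HGen i => t i
  | HScal a => a%:A
  | HAdd x y => heval x + heval y
  | HMul x y => heval x * heval y
  end.

Definition hecke_relations : Prop :=
  [/\ forall i, (t i - q%:A) * (t i + q^-1%:A) = 0,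
      forall i j : 'I_n.-1, j = i.+1 :> nat ->
        t i * t j * t i = t j * t i * t j
    & forall i j : 'I_n.-1,
        j <> i :> nat -> j <> i.+1 :> nat -> i <> j.+1 :> nat ->
        t i * t j = t j * t i].

Lemma heval_heq x y : hecke_relations -> heq x y -> heval x = heval y.
Proof.
case=> hq hb hc; elim=> //= {x y}.
- by move=> x y z _ -> _ ->.
- by move=> x x' y y' _ -> _ ->.
- by move=> x x' y y' _ -> _ ->.
- by move=> *; rewrite addrA.
- by move=> *; rewrite addrC.
- by move=> *; rewrite scale0r add0r.
- by move=> x; rewrite scale0r scaleN1r mulNr mul1r addNr.
- by move=> *; rewrite mulrA.
- by move=> *; rewrite scale1r mul1r.
- by move=> *; rewrite mulrDl.
- by move=> *; rewrite mulrDr.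
- by move=> *; rewrite scalerDl.
- by move=> *; rewrite -scalerAl mul1r scalerA.
- by move=> *; rewrite mulr_algl mulr_algr.
- by move=> i; rewrite scaleNr scale0r.
Qed.

End Evaluation.

Fact hecke_nonzero : hcl (HScal 1) != hcl (HScal 0).
Proof.
apply/eqP=> /hclP.
have rel : hecke_relations (fun=> q : K^o).
  split=> [i|i j _ //|i j _ _ _ //].
  by rewrite [q%:A]mulr1 subrr mul0r.
move=> /(heval_heq rel) /=.
rewrite scale0r scale1r => /eqP; apply/negP; exact: oner_neq0.
Qed.

HB.instance Definition _ := GRing.isZmodule.Build hecke haddA haddC hadd0 haddN.
HB.instance Definition _ := GRing.Zmodule_isNzRing.Build hecke
  hmulA hmul1 hmulr1 hmulDl hmulDr hecke_nonzero.

Fact hscaleA a b x : hscale a (hscale b x) = hscale (a * b) x.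
Proof.
elim/hcl_ind: x => x; rewrite !hscaleE; apply/hclP.
apply: heq_trans (heq_mulA _ _ _) _.
by apply: heq_mul; [exact/heq_sym/heq_scalM|exact: heq_refl].
Qed.

Fact hscale1 : left_id 1 hscale.
Proof. by elim/hcl_ind=> x; rewrite hscaleE; apply/hclP; exact: heq_mul1. Qed.

Fact hscaleDr : right_distributive hscale +%R.
Proof.
move=> a; elim/hcl_ind=> x; elim/hcl_ind=> y.
rewrite /+%R /= haddE !hscaleE haddE; apply/hclP; exact: heq_mulDr.
Qed.

Fact hscaleDl x : {morph hscale^~ x : a b / a + b}.
Proof.
move=> a b; elim/hcl_ind: x => x; rewrite !hscaleE [RHS]haddE; apply/hclP.
apply: heq_trans (heq_mulDl _ _ _).
by apply: heq_mul; [exact: heq_scalD|exact: heq_refl].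
Qed.

HB.instance Definition _ := GRing.Zmodule_isLmodule.Build K hecke
  hscaleA hscale1 hscaleDr hscaleDl.

Lemma hclE1 : hcl (HScal 1) = 1.
Proof. by []. Qed.

Lemma hclD x y : hcl x + hcl y = hcl (HAdd x y).
Proof. exact: haddE. Qed.

Lemma hclM x y : hcl x * hcl y = hcl (HMul x y).
Proof. exact: hmulE. Qed.

Lemma hclZ a x : a *: hcl x = hcl (HMul (HScal a) x).
Proof. exact: hscaleE. Qed.

Fact hscaleAl (a : K) (x y : hecke) : a *: (x * y) = (a *: x) * y.
Proof.
elim/hcl_ind: x => x; elim/hcl_ind: y => y.
rewrite [hcl x * hcl y]hclM [a *: hcl x]hclZ hclZ hclM; apply/hclP.
exact: heq_mulA.
Qed.

HB.instance Definition _ := GRing.Lmodule_isLalgebra.Build K hecke hscaleAl.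

Fact hscaleAr (a : K) (x y : hecke) : a *: (x * y) = x * (a *: y).
Proof.
elim/hcl_ind: x => x; elim/hcl_ind: y => y.
rewrite [hcl x * hcl y]hclM [a *: hcl y]hclZ hclZ hclM; apply/hclP.
apply: heq_trans (heq_mulA _ _ _) _; apply: heq_trans (heq_sym (heq_mulA _ _ _)).
by apply: heq_mul; [exact: heq_scalC|exact: heq_refl].
Qed.

HB.instance Definition _ := GRing.Lalgebra_isAlgebra.Build K hecke hscaleAr.

Definition hgen (i : 'I_n.-1) : hecke := hcl (HGen i).

Lemma heval_hgen x : heval hgen x = hcl x.
Proof.
elim: x => [//|a|x IHx y IHy|x IHx y IHy] /=.
- rewrite -hclE1 hclZ; apply/hclP.
  exact: heq_trans (heq_scalC _ _) (heq_mul1 _).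
- by rewrite IHx IHy hclD.
- by rewrite IHx IHy hclM.
Qed.

Lemma hecke_gen_relations : hecke_relations hgen.
Proof.
split=> [i|i j ij|i j ij1 ij2 ij3].
- have -> : (hgen i - q%:A) * (hgen i + q^-1%:A) =
      heval hgen (HMul (HAdd (HGen i) (HScal (- q))) (HAdd (HGen i) (HScal q^-1))).
    by rewrite /= scaleNr.
  have -> : (0 : hecke) = heval hgen (HScal 0) by rewrite /= scale0r.
  by rewrite !heval_hgen; apply/hclP; exact: heq_quad.
- by rewrite ![hgen _ * hgen _]hclM !hclM; apply/hclP; exact: heq_braid.
- by rewrite !hclM; apply/hclP; exact: heq_comm.
Qed.

Lemma hecke_universal (A : algType K) (t : 'I_n.-1 -> A) :
  hecke_relations t ->
  exists f : {lrmorphism hecke -> A},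
    (forall i, f (hgen i) = t i) /\
    forall g : {lrmorphism hecke -> A}, (forall i, g (hgen i) = t i) -> g =1 f.
Proof.
move=> rel; pose f (x : hecke) := heval t (repr x).
have fE x : f (hcl x) = heval t x by apply: heval_heq rel _; exact: heq_repr.
have fZ : linear f.
  move=> a; elim/hcl_ind=> x; elim/hcl_ind=> y.
  by rewrite [a *: hcl x]hclZ hclD !fE /= mulr_algl.
have fM : monoid_morphism f.
  split; first by rewrite -hclE1 fE /= scale1r.
  by elim/hcl_ind=> x; elim/hcl_ind=> y; rewrite hclM !fE.
pose fl := GRing.isLinear.Build K hecke A _ f fZ.
pose fm := GRing.isMonoidMorphism.Build hecke A f fM.
pose F : {lrmorphism hecke -> A} := HB.pack f fl fm.
exists F; split=> [i|g gt]; first exact: fE.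
elim/hcl_ind=> x; rewrite [RHS]fE -heval_hgen.
elim: x => [i|a|x IHx y IHy|x IHx y IHy] /=.
- exact: gt.
- by rewrite rmorph_alg.
- by rewrite raddfD /= IHx IHy.
- by rewrite rmorphM /= IHx IHy.
Qed.

(* T_k for 1 <= k <= n-1; junk value 0 for the other k. *)
Definition heckeT (k : nat) : hecke :=
  if k is k'.+1 then oapp hgen 0 (insub k') else 0.

End HeckeAlgebra.

(* Rows, columns and the entries of tableaux are numbered from 0, so that
   a : 'I_n is the entry a+1; contents and principal hooks do not depend on
   this shift. A partition has no zero parts, hence is determined by its
   diagram. *)
Definition is_partition (n : nat) (lam : seq nat) : bool :=
  [&& sorted geq lam, 0%N \notin lam & sumn lam == n].

Definition diagram (lam : seq nat) : pred (nat * nat) :=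
  fun b => (b.2 < nth 0%N lam b.1)%N.

Definition principal_hook (lam : seq nat) (i : nat) : pred (nat * nat) :=
  fun b => diagram lam b &&
    ((b.1 == i) && (i <= b.2)%N || (b.2 == i) && (i <= b.1)%N).

(* A standard tableau is given by the box containing each entry. *)
Record std_tableau (n : nat) (lam : seq nat) := StdTableau {
  box :> 'I_n -> nat * nat;
  box_inj : injective box;
  box_diagram : forall b, diagram lam b <-> exists a, box a = b;
  box_row : forall a b, (box a).1 = (box b).1 ->
    ((box a).2 < (box b).2)%N -> (a < b)%N;
  box_col : forall a b, (box a).2 = (box b).2 ->
    ((box a).1 < (box b).1)%N -> (a < b)%N
}.

Definition content n lam (L : std_tableau n lam) (a : 'I_n) : int :=
  (L a).2%:Z - (L a).1%:Z.

Section RationalFunctions.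
Variables (K : fieldType) (n : nat) (W : lmodType K).

Definition vmeval (z : 'I_n -> K) (P : seq (mpoly.mpoly n K * W)) : W :=
  \sum_(t <- P) mpoly.meval z t.1 *: t.2.

(* f is a W-valued rational function on K^n, defined on the complement D of the
   zeros of finitely many polynomials, and V is a linear subspace of K^n. As K
   is infinite, f restricts to a rational function on V when D meets V (then
   D is Zariski dense in V); the restriction is regular at p with value v when
   it can be written as P / Q with P, Q polynomial, Q(p) != 0 and
   P(p) / Q(p) = v. *)
Definition regular_value (D : set ('I_n -> K)) (f : ('I_n -> K) -> W)
    (V : set ('I_n -> K)) (p : 'I_n -> K) (v : W) : Prop :=
  (exists z, V z /\ D z) /\
  exists (P : seq (mpoly.mpoly n K * W)) (Q : mpoly.mpoly n K),
    [/\ mpoly.meval p Q != 0,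
        forall z, V z -> D z -> mpoly.meval z Q *: f z = vmeval z P
      & v = (mpoly.meval p Q)^-1 *: vmeval p P].

End RationalFunctions.

Section Fusion.
Variables (K : fieldType) (q : K) (n : nat).
Local Notation H := (hecke q n).

Definition fusionF (k : nat) (a b : K) : H :=
  heckeT q n k + ((q - q^-1) / (a^-1 * b - 1))%:A.

Variables (lam : seq nat) (L : std_tableau n lam).

Definition fusion_arg (z : 'I_n -> K) (a : 'I_n) : K :=
  q ^ (2 * content L a) * z a.

Definition fusion_dom : set ('I_n -> K) := fun z =>
  forall i j : 'I_n, (i < j)%N ->
    fusion_arg z i != 0 /\ fusion_arg z i != fusion_arg z j.

Definition fusion_fun (z : 'I_n -> K) : H :=
  \prod_(j < n) \prod_(i < n | (i < j)%N)
    fusionF (j - i) (fusion_arg z i) (fusion_arg z j).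

Definition hook_space : set ('I_n -> K) := fun z =>
  forall i j : 'I_n,
    (exists k, principal_hook lam k (L i) /\ principal_hook lam k (L j)) ->
    z i = z j.

Definition row_space : set ('I_n -> K) := fun z =>
  forall i j : 'I_n, (L i).1 = (L j).1 -> z i = z j.

(* The value at z_1 = ... = z_n != 0 of the restriction to row_space. *)
Definition fusion_elt : H :=
  xget 0 (fun v => forall c : K, c != 0 ->
    regular_value fusion_dom fusion_fun row_space (fun=> c) v).

End Fusion.

Section LeftIdeal.
Variables (A : nzRingType) (x : A).

Definition in_lideal : {pred A^o} := fun y => `[< exists a : A, y = a * x >].

Fact in_lideal_submod : submod_closed in_lideal.
Proof.
split=> [|a _ _ /asboolP[b ->] /asboolP[c ->]]; apply/asboolP.
  by exists 0; rewrite mul0r.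
by exists (a * b + c); rewrite mulrDl -mulrA.
Qed.

HB.instance Definition _ := GRing.isSubmodClosed.Build A A^o in_lideal
  in_lideal_submod.

Definition lideal := {y : A^o | y \in in_lideal}.

HB.instance Definition _ := SubChoice.on lideal.
HB.instance Definition _ := [SubChoice_isSubLmodule of lideal by <:].

End LeftIdeal.

Definition irreducible_module (A : nzRingType) (M : lmodType A) : Prop :=
  (exists x : M, x != 0) /\
  forall S : {pred M}, submod_closed S -> S =i pred1 0 \/ S =i predT.

Definition equivalent_modules (A : nzRingType) (M N : lmodType A) : Prop :=
  exists f : {linear M -> N}, bijective f.

(* Main.v *)
From HB Require Import structures.
Require Import Defs.
From mathcomp Require Import all_boot all_order all_algebra.
From mathcomp Require Import zify ring.
From mathcomp Require Import boolp classical_sets reals complex.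
From mathcomp Require mpoly.
Import -(notations) mpoly.

Set Implicit Arguments.
Unset Strict Implicit.
Unset Printing Implicit Defensive.

Import GRing.Theory.
Local Open Scope ring_scope.

(** Why the theorem holds.

    Give every box b a parameter a(b) = q^(2c(b)) z(b).  The factors F_k(x, y)
    satisfy the Yang-Baxter equation ([yang_baxter]) and F_k(x, y) F_k(y, x) is
    a scalar ([factor_unitarity]); the fusion product is the intertwiner that
    they attach to the longest permutation.  Hence it is divisible, on the left
    and on the right, by the factor of any two consecutive entries
    ([fusion_divl], [fusion_divr]), and an interchange of two consecutive
    entries only multiplies it by one factor on the left and the inverse of one
    on the right ([fusion_swap]).  For consecutive boxes of a standard tableau
    that are not neighbours these two factors are regular and invertible at the
    limit point.

    Regularity is proved by induction on n.  A new box b contributes the factors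
    F(a(d), a(b)), d running over the earlier boxes, and such a factor is
    singular when d lies on the diagonal of b.  Let next(d) be the right or the
    lower neighbour of d.  If z(d) = z(next(d)), then the factor of the pair
    (d, next(d)) is a constant P with P^2 a multiple of P; if moreover next(d)
    comes immediately after d, then P divides the product of the earlier entries
    and can be moved next to the two factors of d and next(d) with b, where it
    cancels the pole ([eigen_fused], [append_regular]).  By interchanges every
    standard tableau can be sorted so that next(d) follows d for all d on the
    diagonal of b at once ([sorted_paired], [regular_step]).

    Rows, columns and principal hooks correspond to three choices of next
    ([labelling_row], [labelling_col], [labelling_hook]).  In all three cases the
    value for n boxes is the limit, as the parameter of the last box alone tends
    to its final value, of the value for n - 1 boxes times the factors of the
    last box.  This limit does not mention next, so by induction the values
    coincide ([common_value_exists]).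

    On the subspace with equal parameters in rows (columns) the factor of two
    neighbours in a row (column) is constant, which turns the common value v of
    a tableau into an eigenvector: T_k v = q v if k and k+1 are neighbours in a
    row, T_k v = - q^-1 v in a column ([fusion_value_right],
    [fusion_value_below]).  Together with the interchange relation
    ([fusion_value_swap]) this makes the left ideal of v the span of vectors
    indexed by the standard tableaux of the shape, on which the Jucys-Murphy
    elements act by the contents ([comb_span], [jucys_murphy_vec]).  Contents
    separate standard tableaux ([weight_sep]), whence irreducibility and
    inequivalence for different shapes.  Finally v is not 0: a linear form that
    picks out the coefficient of the longest permutation takes the value 1 on
    every fusion product ([act_fusion]). *)

(** * Factors and fusion products *)

Section Factors.
Variables (K : fieldType) (q : K).
Implicit Types (x y u v w : K) (r : seq K) (k l : nat).

Definition beta (x y : K) : K := (q - q^-1) / (x^-1 * y - 1).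

Lemma betaE x y : x != 0 -> beta x y = (q - q^-1) * x / (y - x).
Proof.
move=> x0.
rewrite /beta -[(q - q^-1) * x / _]mulrA; congr (_ * _).
have -> : x^-1 * y - 1 = (y - x) / x by field.
by rewrite invf_div.
Qed.

(** The scalar identity behind the Yang-Baxter equation: with s = y/x, t = u/y it
    reads 1/(s-1) 1/(t-1) = 1/(st-1) (1/(s-1) + 1/(t-1) + 1). *)
Lemma beta_triangle x y u : x != 0 -> y != 0 -> x != y -> y != u -> x != u ->
  beta x y * beta y u = beta x u * (beta x y + beta y u + (q - q^-1)).
Proof.
move=> x0 y0 xy yu xu; rewrite !betaE //; move: (q - q^-1) => d.
by field; rewrite !subr_eq0 [u == x]eq_sym [y == x]eq_sym [u == y]eq_sym xy yu.
Qed.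

Lemma beta_opp x y : x != 0 -> y != 0 -> x != y ->
  beta x y + beta y x = - (q - q^-1).
Proof.
move=> x0 y0 xy; rewrite !betaE //; move: (q - q^-1) => d.
by field; rewrite !subr_eq0 xy eq_sym xy.
Qed.

Variables (A : algType K) (T : nat -> A) (N : nat).

(** Only the indices 0 < k < N are constrained, so that one family serves all
    tableaux with at most N boxes. *)
Definition hecke_family : Prop :=
  [/\ forall k, (0 < k < N)%N -> (T k - q%:A) * (T k + q^-1%:A) = 0,
      forall k, (0 < k)%N -> (k.+1 < N)%N ->
        T k * T k.+1 * T k = T k.+1 * T k * T k.+1
    & forall k l, (0 < k)%N -> (k.+1 < l < N)%N -> T k * T l = T l * T k].

Definition factor k x y : A := T k + (beta x y)%:A.

(** Sequences of parameters are listed in reverse, the latest entry first: a new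
    entry is then a cons, and the indices k, k+1, ... grow towards the past. *)
Fixpoint append_prod k (r : seq K) u : A :=
  if r is x :: r' then append_prod k.+1 r' u * factor k x u else 1.

Fixpoint fusion_prod (r : seq K) : A :=
  if r is u :: r' then fusion_prod r' * append_prod 1 r' u else 1.

(** Equal to (s - q^2)(s - q^-2) / (s - 1)^2 for s = y/x. *)
Definition unitarity x y : K := 1 + beta x y * beta y x.

Hypothesis (HT : hecke_family) (q0 : q != 0).

Lemma T_quad k : (0 < k < N)%N -> T k * T k = (q - q^-1) *: T k + 1.
Proof.
case: HT => hq _ _ /hq; rewrite mulrDr !mulrBl !mulr_algl !mulr_algr.
rewrite scalerA divff // scale1r addrACA -opprD => /eqP.
rewrite subr_eq0 => /eqP e.
by rewrite scalerBl addrAC -e addrK.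
Qed.

(** Expansion sorted so that the braid relation and the quadratic relation can be
    applied to the terms of degree 3 and to the term s u. *)
Lemma prod3E (s t u : A) (a b c : K) :
  (s + a%:A) * (t + b%:A) * (u + c%:A) =
  s * t * u + b *: (s * u) + (a *: (t * u) + c *: (s * t))
  + ((b * c) *: s + (a * c) *: t + (a * b) *: u + (a * b * c)%:A).
Proof.
rewrite [_ * (u + _)]mulrDr mulr_algr !(mulrDl, mulrDr) !(mulr_algl, mulr_algr).
rewrite !scalerDr -?scalerAl ?scalerA.
rewrite mul1r [c * b]mulrC [c * a]mulrC [a * c * b]mulrAC.
by rewrite (AC ((2*2)*(2*2)) (1*2*(3*5)*(6*7*4*8))).
Qed.

(** After expansion both sides agree up to the coefficients of T_k and T_(k+1),
    which agree by [beta_triangle]. *)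
Lemma yang_baxter k x y u : (0 < k)%N -> (k.+1 < N)%N ->
    x != 0 -> y != 0 -> x != y -> y != u -> x != u ->
  factor k x y * factor k.+1 x u * factor k y u = factor k.+1 y u * factor k x u * factor k.+1 x y.
Proof.
move=> k0 kN x0 y0 xy yu xu; rewrite /factor.
have := beta_triangle x0 y0 xy yu xu.
move: (beta x y) (beta x u) (beta y u) => a b c tri.
case: HT => _ hb _; rewrite !prod3E hb // !T_quad ?k0 // ?(ltnW kN) //.
set s := T k.+1; set t := T k; set d := q - q^-1.
(* The part of either side that is linear in T_k and T_(k+1): it is symmetric in
   the two. *)
have coll (v w : A) : b *: (d *: v + 1) + ((b * c) *: v + (a * c) *: w
    + (a * b) *: v + (a * b * c)%:A)
    = (a * c) *: (v + w) + (b + a * b * c)%:A.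
  rewrite scalerDr scalerA (AC (2*4) (1*3*5*4*(2*6))) /=.
  by rewrite -!scalerDl scalerDr; congr (_ *: _ + _ + _); rewrite tri /d; ring.
rewrite [b * a]mulrC [c * a]mulrC [c * b]mulrC.
rewrite [b * c * a]mulrC [a * (b * c)]mulrA.
rewrite [LHS](AC (2*2*4) (1*(3*4)*(2*(5*6*7*8)))) /=.
rewrite [RHS](AC (2*2*4) (1*(4*3)*(2*(7*6*5*8)))) /=.
by rewrite !coll [t + s]addrC.
Qed.

Lemma factor_comm k l x y u v : (0 < k)%N -> (k.+1 < l < N)%N ->
  factor k x y * factor l u v = factor l u v * factor k x y.
Proof.
case: HT => _ _ hc k0 kl; rewrite /factor !(mulrDl, mulrDr) hc //.
rewrite !(mulr_algl, mulr_algr) !scalerA [beta u v * _]mulrC.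
by rewrite (AC (2*2) (1*3*(2*4))).
Qed.

Lemma factor_unitarity k x y : (0 < k < N)%N -> x != 0 -> y != 0 -> x != y ->
  factor k x y * factor k y x = (unitarity x y)%:A.
Proof.
move=> kN x0 y0 xy; rewrite /factor /unitarity !(mulrDl, mulrDr) T_quad //.
rewrite !(mulr_algl, mulr_algr) scalerA [_ + 1]addrC.
rewrite (AC (2*2) (1*(2*3)*4)) /= -scalerDl [beta y x + _]addrC.
by rewrite beta_opp // scaleNr addrK scalerDl scale1r.
Qed.

Lemma append_cat k r1 r2 u :
  append_prod k (r1 ++ r2) u = append_prod (k + size r1) r2 u * append_prod k r1 u.
Proof.
elim: r1 k => [|x r1 IH] k /=; first by rewrite addn0 mulr1.
by rewrite IH mulrA addnS.
Qed.

Lemma factor_append_below k l r x y u : (0 < l)%N -> (l.+1 < k)%N -> (k + size r <= N)%N ->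
  factor l x y * append_prod k r u = append_prod k r u * factor l x y.
Proof.
elim: r k => [|w r IH] k l0 lk /= kN; first by rewrite mulr1 mul1r.
rewrite mulrA IH //; [|lia|lia].
by rewrite -!mulrA factor_comm //; lia.
Qed.

Lemma factor_append_above k l r x y u : (0 < k)%N -> (k + size r < l)%N -> (l < N)%N ->
  factor l x y * append_prod k r u = append_prod k r u * factor l x y.
Proof.
elim: r k => [|w r IH] k k0 /= kl lN; first by rewrite mulr1 mul1r.
rewrite mulrA IH //; [|lia].
by rewrite -!mulrA [in RHS]factor_comm //; lia.
Qed.

Lemma factor_fusion_comm l r x y : (size r < l < N)%N ->
  factor l x y * fusion_prod r = fusion_prod r * factor l x y.
Proof.
elim: r => [|u r IH] /= rl; first by rewrite mulr1 mul1r.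
rewrite mulrA IH; [|lia].
by rewrite -!mulrA factor_append_above //; lia.
Qed.

(** Passing a factor through the factors of a later entry u: Yang-Baxter at the
    two entries x, y, commutation at the others. *)
Lemma append_swap k r1 x y r2 u : (0 < k)%N -> (k + size r1 + size r2 + 2 <= N)%N ->
    x != 0 -> y != 0 -> x != y -> y != u -> x != u ->
  factor (k + size r1) x y * append_prod k (r1 ++ y :: x :: r2) u =
  append_prod k (r1 ++ x :: y :: r2) u * factor (k + size r1).+1 x y.
Proof.
move=> k0 kN x0 y0 xy yu xu; rewrite !append_cat /=.
have above : factor (k + size r1).+1 x y * append_prod k r1 u
    = append_prod k r1 u * factor (k + size r1).+1 x y by apply: factor_append_above; lia.
have below : factor (k + size r1) x y * append_prod (k + size r1).+2 r2 u
    = append_prod (k + size r1).+2 r2 u * factor (k + size r1) x y by apply: factor_append_below; lia.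
rewrite -[RHS]mulrA -above !mulrA below; congr (_ * _).
by rewrite -!mulrA; congr (_ * _); rewrite !mulrA yang_baxter //; lia.
Qed.

(** The same passage seen from the other side: the factor of the two last entries
    moves through their factors with all earlier entries. *)
Lemma append_append_swap k r x y : (0 < k)%N -> (k + size r < N)%N ->
    x \notin r -> y \notin r -> 0 \notin r -> y != 0 -> x != y ->
  factor (k + size r) y x * append_prod k r x * append_prod k.+1 r y =
  append_prod k r y * append_prod k.+1 r x * factor k y x.
Proof.
elim: r k => [|w r IH] k k0 /=; first by rewrite addn0 !mulr1 !mul1r.
move=> kN; rewrite !inE !negb_or => /andP[xw xr] /andP[yw yr] /andP[w0 r0] y0 xy.
rewrite -!mulrA ![factor k _ _ * (append_prod _ _ _ * _)]mulrA !factor_append_below //; [|lia..].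
rewrite !mulrA -(addSnnS k) IH //; [|lia].
rewrite -!mulrA; congr (_ * (_ * _)); rewrite !mulrA.
by rewrite -yang_baxter // 1?eq_sym //; lia.
Qed.

(** Both sides multiply out to s_k w = w s_(n-k), where w is the longest permutation:
    the factor of x and y travels from one end of the product to the other. *)
Lemma fusion_swap r1 x y r2 :
    (size r1 + size r2 + 2 <= N)%N ->
    uniq (r1 ++ y :: x :: r2) -> 0 \notin r1 ++ y :: x :: r2 ->
  factor (size r2).+1 y x * fusion_prod (r1 ++ y :: x :: r2) =
  fusion_prod (r1 ++ x :: y :: r2) * factor (size r1).+1 x y.
Proof.
elim: r1 => [|w r1 IH] /= rN.
  rewrite !inE !negb_or => /and3P[/andP[yx yr] xr _] /and3P[y0 x0 r0].
  have c : factor (size r2).+1 y x * fusion_prod r2 = fusion_prod r2 * factor (size r2).+1 y x.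
    by apply: factor_fusion_comm; lia.
  have xy : x != y by rewrite eq_sym.
  have y0' : y != 0 by rewrite eq_sym.
  have := @append_append_swap 1 r2 x y isT; rewrite add1n => /(_ _ xr yr r0 y0' xy) d.
  by rewrite !mulrA c -!mulrA; congr (_ * _); rewrite !mulrA d //; lia.
move=> /andP[wr ru]; rewrite inE negb_or => /andP[w0 r0].
rewrite mulrA IH //; last lia.
rewrite -!mulrA; congr (_ * _).
move: ru wr r0; rewrite cat_uniq mem_cat mem_cat /= !inE !negb_or.
move=> /and5P[_ _ /andP[yx _] _ _] /and4P[_ wy wx _] /and4P[_ y0 x0 _].
have := @append_swap 1 r1 x y r2 w isT; by rewrite add1n; apply=> //; rewrite eq_sym.
Qed.

(** Used where the factor of (x, y) is a multiple of an idempotent, in which case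
    [fusion_swap] gives no information. *)
Lemma fusion_divr r1 x y r2 :
    (size r1 + size r2 + 2 <= N)%N ->
    uniq (r1 ++ y :: x :: r2) -> 0 \notin r1 ++ y :: x :: r2 ->
  exists G, fusion_prod (r1 ++ y :: x :: r2) = G * factor (size r1).+1 x y.
Proof.
elim: r1 => [|w r1 IH] /= rN.
  by exists (fusion_prod r2 * append_prod 1 r2 x * append_prod 2 r2 y); rewrite !mulrA.
move=> /andP[wr ru]; rewrite inE negb_or => /andP[w0 r0].
have [|G ->] := IH _ ru r0; first lia.
exists (G * append_prod 1 (r1 ++ x :: y :: r2) w); rewrite -!mulrA; congr (_ * _).
move: ru wr r0; rewrite cat_uniq mem_cat mem_cat /= !inE !negb_or.
move=> /and5P[_ _ /andP[yx _] _ _] /and4P[_ wy wx _] /and4P[_ y0 x0 _].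
have := @append_swap 1 r1 x y r2 w isT; by rewrite add1n; apply=> //; rewrite eq_sym.
Qed.

Lemma fusion_divl r1 x y r2 :
    (size r1 + size r2 + 2 <= N)%N ->
    uniq (r1 ++ y :: x :: r2) -> 0 \notin r1 ++ y :: x :: r2 ->
  exists G, fusion_prod (r1 ++ y :: x :: r2) = factor (size r2).+1 x y * G.
Proof.
elim: r1 => [|w r1 IH] /= rN.
  rewrite !inE !negb_or => /and3P[/andP[yx yr] xr _] /and3P[y0 x0 r0].
  have c : factor (size r2).+1 x y * fusion_prod r2 = fusion_prod r2 * factor (size r2).+1 x y.
    by apply: factor_fusion_comm; lia.
  have x0' : x != 0 by rewrite eq_sym.
  have := @append_append_swap 1 r2 y x isT; rewrite add1n => /(_ _ yr xr r0 x0' yx) d.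
  exists (fusion_prod r2 * (append_prod 1 r2 y * append_prod 2 r2 x)).
  by rewrite [RHS]mulrA c -!mulrA; congr (_ * _); rewrite !mulrA d //; lia.
move=> /andP[wr ru]; rewrite inE negb_or => /andP[w0 r0].
have [|G ->] := IH _ ru r0; first lia.
by exists (G * append_prod 1 (r1 ++ y :: x :: r2) w); rewrite mulrA.
Qed.

End Factors.

(** A common treatment of neighbours in a row (th = q) and in a column
    (th = - q^-1): the relations of T_k are symmetric under q <-> - q^-1, and the
    parameter of the neighbour is th^2 times that of the box. *)
Section AdjacentEntries.
Variables (K : fieldType) (q : K) (A : algType K) (T : nat -> A) (N : nat).
Implicit Types (x y u v w : K) (r : seq K) (k l : nat).
Hypothesis (HT : hecke_family q T N) (q0 : q != 0).
Variable th : K.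
Hypotheses (th0 : th != 0) (thq : th - th^-1 = q - q^-1) (th1 : th ^+ 2 != 1).

Lemma beta_adjacent x : x != 0 -> beta q x (th ^+ 2 * x) = th^-1.
Proof.
move=> x0; have d : th ^+ 2 - 1 != 0 by rewrite subr_eq0.
rewrite betaE // -thq; have -> : th ^+ 2 * x - x = (th ^+ 2 - 1) * x by ring.
by field; rewrite x0 th0 d.
Qed.

Lemma factor_adjacent k x : x != 0 -> factor q T k x (th ^+ 2 * x) = T k + th^-1%:A.
Proof. by move=> x0; rewrite /factor beta_adjacent. Qed.

Lemma T_eigenl k : (0 < k < N)%N -> T k * (T k + th^-1%:A) = th *: (T k + th^-1%:A).
Proof.
move=> kN; rewrite mulrDr (T_quad HT q0 kN) mulr_algr scalerDr scalerA divff //.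
by rewrite scale1r -thq addrAC -scalerDl subrK.
Qed.

Lemma T_eigenr k : (0 < k < N)%N -> (T k + th^-1%:A) * T k = th *: (T k + th^-1%:A).
Proof.
move=> kN; rewrite mulrDl (T_quad HT q0 kN) mulr_algl scalerDr scalerA divff //.
by rewrite scale1r -thq addrAC -scalerDl subrK.
Qed.

Lemma eigen_sq k : (0 < k < N)%N ->
  (T k + th^-1%:A) * (T k + th^-1%:A) = (th + th^-1) *: (T k + th^-1%:A).
Proof.
by move=> kN; rewrite {2}[T k + _]lock mulrDl -lock T_eigenl // mulr_algl scalerDl.
Qed.

(** The pole of F_(k+1)(x, u) at u = x is multiplied by P (T_k + beta(th^2 x, u)) =
    (th + beta(th^2 x, u)) P, and this scalar vanishes at u = x. *)
Lemma eigen_fused k x u : (0 < k < N)%N -> x != 0 -> u != x -> u != th ^+ 2 * x ->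
  (T k + th^-1%:A) * (factor q T k.+1 x u * factor q T k (th ^+ 2 * x) u) =
  (T k + th^-1%:A) * T k.+1 * factor q T k (th ^+ 2 * x) u
  + ((th - th^-1) * th * x / (u - th ^+ 2 * x)) *: (T k + th^-1%:A).
Proof.
move=> kN x0 ux uy; have y0 : th ^+ 2 * x != 0 by rewrite mulf_neq0 ?expf_neq0.
set P := T k + _; set G := factor q T k _ u.
rewrite {1}/factor mulrA [P * _]mulrDr mulr_algr [LHS]mulrDl; congr (_ + _).
rewrite -scalerAl /G /factor mulrDr T_eigenr // mulr_algr -scalerDl scalerA.
congr (_ *: _); rewrite !betaE // -thq; field.
by rewrite !subr_eq0 ux uy th0.
Qed.

End AdjacentEntries.

(** * Regular functions and their values *)

Section RegularFunctions.
Variable K : fieldType.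

(** Division is allowed only by functions that do not vanish at the base point p.
    As inverses are total, such an expression is also defined, with an arbitrary
    value, where a denominator vanishes. *)
Inductive ratfun (I : Type) (p : I -> K) : ((I -> K) -> K) -> Prop :=
  | rat_const c : ratfun p (fun=> c)
  | rat_coord i : ratfun p (fun z => z i)
  | rat_add f g : ratfun p f -> ratfun p g -> ratfun p (fun z => f z + g z)
  | rat_mul f g : ratfun p f -> ratfun p g -> ratfun p (fun z => f z * g z)
  | rat_inv f : ratfun p f -> f p != 0 -> ratfun p (fun z => (f z)^-1).

Inductive hreg (A : algType K) (I : Type) (p : I -> K) : ((I -> K) -> A) -> Prop :=
  | hreg_const a : hreg p (fun=> a)
  | hreg_add f g : hreg p f -> hreg p g -> hreg p (fun z => f z + g z)
  | hreg_mul f g : hreg p f -> hreg p g -> hreg p (fun z => f z * g z)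
  | hreg_scale f g : ratfun p f -> hreg p g -> hreg p (fun z => f z *: g z).

(** The condition on e restricts the equality to a Zariski neighbourhood of p in V,
    where the denominators hidden in f and g do not vanish. *)
Definition regular (A : algType K) (I : Type) (V : (I -> K) -> Prop) (p : I -> K)
    (f : (I -> K) -> A) (v : A) : Prop :=
  exists g e, [/\ hreg p g, ratfun p e, e p != 0,
    forall z, V z -> e z != 0 -> f z = g z & v = g p].

Lemma ratfun_comp I J (p : I -> K) (p' : J -> K) (c : I -> (J -> K) -> K) f :
    (forall i, ratfun p' (c i)) -> (forall i, c i p' = p i) -> ratfun p f ->
  ratfun p' (fun z => f (c^~ z)).
Proof.
move=> hc cp; have cp' : c^~ p' = p by apply: funext.
elim=> [a|i|g h _ ? _ ?|g h _ ? _ ?|g _ hg g0] /=.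
- exact: rat_const.
- exact: hc.
- exact: rat_add.
- exact: rat_mul.
- by apply: rat_inv => //; rewrite cp'.
Qed.

Lemma hreg_comp (A : algType K) I J (p : I -> K) (p' : J -> K)
    (c : I -> (J -> K) -> K) (f : (I -> K) -> A) :
    (forall i, ratfun p' (c i)) -> (forall i, c i p' = p i) -> hreg p f ->
  hreg p' (fun z => f (c^~ z)).
Proof.
move=> hc cp; elim=> [a|g h _ ? _ ?|g h _ ? _ ?|g h hg _ ?] /=.
- exact: hreg_const.
- exact: hreg_add.
- exact: hreg_mul.
- by apply: hreg_scale => //; exact: ratfun_comp hg.
Qed.

Lemma regular_comp (A : algType K) I J (p : I -> K) (p' : J -> K)
    (c : I -> (J -> K) -> K) (V : (I -> K) -> Prop) (V' : (J -> K) -> Prop)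
    (f : (I -> K) -> A) v :
    (forall i, ratfun p' (c i)) -> (forall i, c i p' = p i) ->
    (forall z, V' z -> V (c^~ z)) ->
  regular V p f v -> regular V' p' (fun z => f (c^~ z)) v.
Proof.
move=> hc cp hV [g [e [hg he e0 fg ->]]].
have cp' : c^~ p' = p by apply: funext.
exists (fun z => g (c^~ z)), (fun z => e (c^~ z)); split.
- exact: hreg_comp hg.
- exact: ratfun_comp he.
- by rewrite cp'.
- by move=> z /hV Vz ez; exact: fg.
- by rewrite cp'.
Qed.

Lemma regular_near (A : algType K) I (V : (I -> K) -> Prop) p (f f' : (I -> K) -> A) v e :
    ratfun p e -> e p != 0 -> (forall z, V z -> e z != 0 -> f' z = f z) ->
  regular V p f v -> regular V p f' v.
Proof.
move=> he e0 ff [g [e' [hg he' e'0 fg vE]]].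
exists g, (fun z => e z * e' z); split => //.
- exact: rat_mul.
- exact: mulf_neq0.
- by move=> z Vz; rewrite mulf_eq0 negb_or => /andP[ez e'z]; rewrite ff // fg.
Qed.

Lemma regular_open (I : Type) (A : algType K) (W : (I -> K) -> Prop) p (f : (I -> K) -> A) v e :
  ratfun p e -> e p != 0 -> regular (fun z => W z /\ e z != 0) p f v -> regular W p f v.
Proof.
move=> he e0 [g [e' [hg he' e'0 fg vE]]]; exists g, (fun z => e z * e' z); split=> //.
- exact: rat_mul.
- exact: mulf_neq0.
- by move=> z Wz; rewrite mulf_eq0 negb_or => /andP[ez e'z]; apply: fg.
Qed.

Lemma regular_hreg (A : algType K) I (V : (I -> K) -> Prop) p (f : (I -> K) -> A) :
  hreg p f -> regular V p f (f p).
Proof.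
by move=> hf; exists f, (fun=> 1); split => //; [exact: rat_const|exact: oner_neq0].
Qed.

Lemma regular_mul (A : algType K) I (V : (I -> K) -> Prop) p (f g : (I -> K) -> A) v w :
  regular V p f v -> regular V p g w -> regular V p (fun z => f z * g z) (v * w).
Proof.
move=> [f' [e [hf he e0 ff ->]]] [g' [e' [hg he' e'0 gg ->]]].
exists (fun z => f' z * g' z), (fun z => e z * e' z); split => //.
- exact: hreg_mul.
- exact: rat_mul.
- exact: mulf_neq0.
- by move=> z Vz; rewrite mulf_eq0 negb_or => /andP[ez e'z]; rewrite ff // gg.
Qed.

Lemma regular_sub (A : algType K) I (V W : (I -> K) -> Prop) p (f : (I -> K) -> A) v :
  (forall z, W z -> V z) -> regular V p f v -> regular W p f v.
Proof.
by move=> WV [g [e [hg he e0 fg vE]]]; exists g, e; split => // z /WV; exact: fg.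
Qed.

(** Expressions are turned into fractions over any ring of polynomials B with
    evaluation maps ev: univariate ones for restrictions to a line, multivariate
    ones for the definition of regular values. *)
Section Fractions.
Variables (B : comNzRingType) (X : Type) (ev : X -> B -> K) (J : Type)
  (c : X -> J -> K) (x0 : X).
Hypotheses (evD : forall x a b, ev x (a + b) = ev x a + ev x b)
  (evM : forall x a b, ev x (a * b) = ev x a * ev x b)
  (evC : forall k, exists b, forall x, ev x b = k)
  (evX : forall j, exists b, forall x, ev x b = c x j).

Lemma ratfun_frac f : ratfun (c x0) f -> exists P Q, ev x0 Q != 0 /\
  forall x, ev x Q != 0 -> f (c x) = ev x P / ev x Q.
Proof.
have [o eo] := evC 1.
elim=> [a|j|g h _ [P [Q [Q0 gE]]] _ [P' [Q' [Q'0 hE]]]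
  |g h _ [P [Q [Q0 gE]]] _ [P' [Q' [Q'0 hE]]]|g _ [P [Q [Q0 gE]]] g0].
- have [a' ea] := evC a; exists a', o; split; first by rewrite eo oner_neq0.
  by move=> x _; rewrite ea eo divr1.
- have [a' ea] := evX j; exists a', o; split; first by rewrite eo oner_neq0.
  by move=> x _; rewrite ea eo divr1.
- exists (P * Q' + P' * Q), (Q * Q'); split; first by rewrite evM mulf_neq0.
  move=> x; rewrite evM mulf_eq0 negb_or => /andP[q0 q'0]; rewrite gE // hE //.
  by rewrite evD !evM; field; rewrite q0 q'0.
- exists (P * P'), (Q * Q'); split; first by rewrite evM mulf_neq0.
  move=> x; rewrite evM mulf_eq0 negb_or => /andP[q0 q'0]; rewrite gE // hE //.
  by rewrite !evM; field; rewrite q0 q'0.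
- exists (Q * Q), (P * Q); split.
    rewrite evM mulf_neq0 //; apply: contraNneq g0 => P0.
    by rewrite gE // P0 mul0r.
  move=> x; rewrite !evM mulf_eq0 negb_or => /andP[p0 q0]; rewrite gE //.
  by field; rewrite q0 p0.
Qed.

Lemma hreg_frac (A : algType K) (g : (J -> K) -> A) : hreg (c x0) g ->
  exists (P : seq (B * A)) Q, ev x0 Q != 0 /\
  forall x, ev x Q != 0 -> ev x Q *: g (c x) = \sum_(t <- P) ev x t.1 *: t.2.
Proof.
have [o eo] := evC 1.
elim=> [a|f h _ [P [Q [Q0 gE]]] _ [P' [Q' [Q'0 hE]]]
  |f h _ [P [Q [Q0 gE]]] _ [P' [Q' [Q'0 hE]]]|f h hf _ [P' [Q' [Q'0 hE]]]].
- exists [:: (o, a)], o; split; first by rewrite eo oner_neq0.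
  by move=> x _; rewrite big_seq1 /= eo.
- exists ([seq (t.1 * Q', t.2) | t <- P] ++ [seq (t.1 * Q, t.2) | t <- P']), (Q * Q').
  split; first by rewrite evM mulf_neq0.
  move=> x; rewrite evM mulf_eq0 negb_or => /andP[q0 q'0].
  rewrite big_cat !big_map /= scalerDr {1}mulrC -!scalerA gE // hE // !scaler_sumr.
  by congr (_ + _); apply: eq_bigr => t _; rewrite evM mulrC scalerA.
- exists [seq (s.1 * t.1, s.2 * t.2) | s <- P, t <- P'], (Q * Q').
  split; first by rewrite evM mulf_neq0.
  move=> x; rewrite evM mulf_eq0 negb_or => /andP[q0 q'0].
  rewrite -scalerA scalerAr hE // scalerAl gE // big_allpairs_dep /= mulr_suml.
  apply: eq_bigr => s _; rewrite mulr_sumr; apply: eq_bigr => t _.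
  by rewrite evM -scalerAl -scalerAr scalerA.
- have [P [Q [Q0 fE]]] := ratfun_frac hf.
  exists [seq (P * t.1, t.2) | t <- P'], (Q * Q').
  split; first by rewrite evM mulf_neq0.
  move=> x; rewrite evM mulf_eq0 negb_or => /andP[q0 q'0].
  rewrite big_map /= scalerA fE // [_ * (_ / _)]mulrC mulrA divfK //.
  rewrite -scalerA hE // scaler_sumr.
  by apply: eq_bigr => t _; rewrite evM scalerA.
Qed.

End Fractions.


End RegularFunctions.

Section Uniqueness.
Variable K : fieldType.

(** The coefficients of a relation with polynomial coefficients of bounded degree
    cannot be compared in a basis of V; instead the common root a of the relation is
    divided out of every coefficient, as in p(X) = (X - a) p_1(X) + p(a). *)
Lemma poly_vanish (V : lmodType K) (I : Type) (ts : seq K) (r : seq I)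
    (p : I -> {poly K}) (w : I -> V) t0 :
    uniq ts -> (forall i, (size (p i) <= size ts)%N) ->
    (forall t, t \in ts -> \sum_(i <- r) (p i).[t] *: w i = 0) ->
  \sum_(i <- r) (p i).[t0] *: w i = 0.
Proof.
elim: ts p => [|a ts IH] p /=.
  move=> _ p0 _; apply: big1 => i _.
  by move: (p0 i); rewrite leqn0 size_poly_eq0 => /eqP ->; rewrite horner0 scale0r.
move=> /andP[ats uts] ps pa.
pose p' i := p i %/ ('X - a%:P).
have pE i t : (p i).[t] = (t - a) * (p' i).[t] + (p i).[a].
  rewrite {1}(divp_eq (p i) ('X - a%:P)) modp_XsubC !hornerE /p'; ring.
have sE t : \sum_(i <- r) (p i).[t] *: w i = (t - a) *: \sum_(i <- r) (p' i).[t] *: w i.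
  rewrite -[RHS]addr0 -[X in _ + X](pa a (mem_head _ _)) scaler_sumr -big_split /=.
  by apply: eq_bigr => i _; rewrite pE scalerDl scalerA.
rewrite sE IH ?scaler0 // => [i|t tts].
  by rewrite size_divp ?polyXsubC_eq0 // size_XsubC subn1; have := ps i; case: (size _).
have := pa t; rewrite inE tts orbT => /(_ isT); rewrite sE => /eqP.
rewrite scaler_eq0 subr_eq0 => /orP[/eqP ta|/eqP //].
by move: tts; rewrite ta (negPf ats).
Qed.

Variable s : nat -> K.
Hypothesis s_inj : injective s.

Lemma many_nonroots (E : {poly K}) d : E != 0 ->
  exists ts : seq K, [/\ uniq ts, (d <= size ts)%N & forall t, t \in ts -> E.[t] != 0].
Proof.
move=> E0; pose l := map s (iota 0 (d + size E)).
have ul : uniq l by rewrite map_inj_uniq // iota_uniq.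
exists [seq t <- l | E.[t] != 0]; split; first exact: filter_uniq.
  have small : (size (filter (root E) l) < size E)%N.
    by apply: max_poly_roots => //; [exact: filter_all|exact: filter_uniq].
  have := count_predC (root E) l; rewrite -!size_filter.
  have -> : [seq t <- l | predC (root E) t] = [seq t <- l | E.[t] != 0] by [].
  rewrite size_map size_iota => e; rewrite -(leq_add2l (size (filter (root E) l))).
  by rewrite e addnC leq_add2l ltnW.
by move=> t; rewrite mem_filter => /andP[].
Qed.

(** A curve through p that stays in V up to finitely many points.  It replaces
    Zariski density of V in all arguments about limits. *)
Definition polyline (I : Type) (l : K -> I -> K) (p : I -> K) (t0 : K)
    (V : (I -> K) -> Prop) : Prop :=
  [/\ forall i, exists b : {poly K}, forall t, b.[t] = l t i, l t0 = p
    & exists2 E : {poly K}, E != 0 & forall t, E.[t] != 0 -> V (l t)].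

(** Linear conditions pass to the limit: along the curve the identity F(f) = c is
    a polynomial relation with infinitely many solutions. *)
Lemma regular_limit (A : algType K) (W : lmodType K) (F : {linear A -> W})
    (I : Type) (V : (I -> K) -> Prop) p (f : (I -> K) -> A) v l t0 c :
  polyline l p t0 V -> (forall z, V z -> F (f z) = c) -> regular V p f v -> F v = c.
Proof.
move=> [lp lt0 [E E0 EV]] fc [g [e [hg he e0 fg vE]]].
pose ev (t : K) (b : {poly K}) := b.[t].
have evD x a b : ev x (a + b) = ev x a + ev x b by rewrite /ev hornerD.
have evM x a b : ev x (a * b) = ev x a * ev x b by rewrite /ev hornerM.
have evC (k : K) : exists b, forall x, ev x b = k.
  by exists k%:P => x; rewrite /ev hornerC.
rewrite -lt0 in hg he e0 vE.
have [Pe [Qe [Qe0 eE]]] := ratfun_frac evD evM evC lp he.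
have [P [Q [Q0 gE]]] := hreg_frac evD evM evC lp hg.
have Pe0 : Pe.[t0] != 0.
  by apply: contraNneq e0 => P0; rewrite eE // /ev P0 mul0r.
have n0 (b : {poly K}) : b.[t0] != 0 -> b != 0.
  by apply: contraNneq => ->; rewrite horner0.
(* On the nonroots of G all fractions are defined and the curve is in V. *)
pose G := E * Pe * Qe * Q.
have G0 : G != 0 by rewrite !mulf_neq0 // n0.
pose P' : seq ({poly K} * W) := (- Q, c) :: [seq (t.1, F t.2) | t <- P].
have PE x : Q.[x] != 0 -> \sum_(t <- P') t.1.[x] *: t.2 = Q.[x] *: (F (g (l x)) - c).
  move=> Qx; rewrite big_cons big_map hornerN scaleNr scalerBr addrC; congr (_ - _).
  rewrite -[RHS]linearZZ -[Q.[x]]/(ev x Q) gE // linear_sum.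
  by apply: eq_bigr => t _; rewrite linearZZ.
pose d := \max_(t <- P') size t.1.
have [ts [uts dts tsG]] := many_nonroots d G0.
pose p' (t : {poly K} * W) := if (size t.1 <= size ts)%N then t.1 else 0.
have pE t : t \in P' -> p' t = t.1.
  move=> tP; rewrite /p' (leq_trans _ dts) //.
  exact: (@leq_bigmax_seq _ P' xpredT (fun t => size t.1)).
have sE x : \sum_(t <- P') t.1.[x] *: t.2 = \sum_(t <- P') (p' t).[x] *: t.2.
  by apply: eq_big_seq => t /pE ->.
have : \sum_(t <- P') t.1.[t0] *: t.2 = 0.
  rewrite sE; apply: (poly_vanish (ts := ts)) => // [t|x xts].
    by rewrite /p'; case: ifP => // _; rewrite size_poly0.
  move: (tsG _ xts); rewrite !hornerM !mulf_eq0 !negb_or.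
  move=> /andP[/andP[/andP[Ex Pex] Qex] Qx].
  rewrite -sE PE // -fg ?fc ?subrr ?scaler0 //; try exact: EV.
  by rewrite eE // mulf_neq0 ?invr_eq0.
rewrite PE // -vE => /eqP; rewrite scaler_eq0 (negPf Q0) subr_eq0.
by move/eqP.
Qed.

Lemma regular_zero (A : algType K) (I : Type) (V : (I -> K) -> Prop) p
    (f : (I -> K) -> A) v l t0 :
  polyline l p t0 V -> (forall z, V z -> f z = 0) -> regular V p f v -> v = 0.
Proof. exact: (regular_limit (F := idfun)). Qed.

Lemma regular_lincomb (A : algType K) (I : Type) (V : (I -> K) -> Prop) p
    (f f' : (I -> K) -> A) v v' c :
  regular V p f v -> regular V p f' v' ->
  regular V p (fun z => f z + c *: f' z) (v + c *: v').
Proof.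
move=> [g [e [hg he e0 fg ->]]] [g' [e' [hg' he' e'0 fg' ->]]].
exists (fun z => g z + c *: g' z), (fun z => e z * e' z); split => //.
- by apply: hreg_add => //; apply: hreg_scale => //; exact: rat_const.
- exact: rat_mul.
- exact: mulf_neq0.
- by move=> z Vz; rewrite mulf_eq0 negb_or => /andP[ez e'z]; rewrite fg // fg'.
Qed.

Lemma regular_unique (A : algType K) (I : Type) (V : (I -> K) -> Prop) p
    (f : (I -> K) -> A) v v' l t0 :
  polyline l p t0 V -> regular V p f v -> regular V p f v' -> v = v'.
Proof.
move=> hl fv fv'; apply/eqP; rewrite -subr_eq0 -scaleN1r; apply/eqP.
apply: (regular_zero hl) (regular_lincomb (-1) fv fv') => z _.
by rewrite scaleN1r subrr.
Qed.

End Uniqueness.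

(** * Standard orderings of boxes *)

Notation cell := (nat * nat)%type.
Definition cell_content (b : cell) : int := (b.2%:Z - b.1%:Z)%R.
Definition right_of (b : cell) : cell := (b.1, b.2.+1).
Definition below (b : cell) : cell := (b.1.+1, b.2).

Definition addable (b : cell) (r : seq cell) : bool :=
  [&& b \notin r, (0 < b.1)%N ==> ((b.1.-1, b.2) \in r)
    & (0 < b.2)%N ==> ((b.1, b.2.-1) \in r)].

(** A standard tableau, encoded as the list of its boxes from the last entry to the
    first: every box is an addable corner of the boxes after it in the list. *)
Fixpoint std (r : seq cell) : bool :=
  if r is b :: r' then addable b r' && std r' else true.

Definition le_cell (b c : cell) : bool := (b.1 <= c.1)%N && (b.2 <= c.2)%N.

(** Equivalently, the boxes are incomparable for [le_cell], see [apartE]. *)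
Definition apart (x y : cell) : bool :=
  (x.1 < y.1)%N && (y.2 < x.2)%N || (y.1 < x.1)%N && (x.2 < y.2)%N.

Lemma apart_sym x y : apart x y = apart y x.
Proof. by rewrite /apart orbC; congr (_ || _); rewrite andbC. Qed.

Lemma apartE x y : apart x y = ~~ le_cell x y && ~~ le_cell y x.
Proof. by case: x y => [a b] [c d]; rewrite /apart /le_cell /=; lia. Qed.

Lemma apart_irr x : apart x x = false.
Proof. by rewrite /apart !ltnn. Qed.

Lemma apart_content x y : apart x y -> cell_content x <> cell_content y.
Proof. by case: x y => [a b] [c d]; rewrite /apart /cell_content /=; lia. Qed.

(** The factor of two boxes whose contents differ by 1 is not invertible at the point
    where all z are 1. *)
Lemma apart_content1 x y : apart x y -> (cell_content x <> cell_content y + 1)%R /\ (cell_content x <> cell_content y - 1)%R.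
Proof. by case: x y => [a b] [c d]; rewrite /apart /cell_content /=; lia. Qed.

Lemma std_uniq r : std r -> uniq r.
Proof. by elim: r => //= b r IH /andP[/and3P[-> _ _] /IH ->]. Qed.

Lemma std_catr r1 r2 : std (r1 ++ r2) -> std r2.
Proof. by elim: r1 => //= b r IH /andP[_ /IH]. Qed.

Lemma eq_addable b r r' : r =i r' -> addable b r = addable b r'.
Proof. by move=> e; rewrite /addable !e. Qed.

Lemma addable_closed b c r : std r -> addable b r -> le_cell c b -> c != b -> c \in r.
Proof.
have cl r' : std r' -> forall b, b \in r' -> forall c, le_cell c b -> c \in r'.
  elim: r' => //= a r' IH /andP[ha /IH{}IH] b0; rewrite inE.
  have dn b1 : b1 \in r' -> forall c, le_cell c b1 -> c \in a :: r'.
    by move=> h c0 /IH; rewrite inE => -> //; rewrite orbT.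
  move=> /orP[/eqP ->|/dn//] c0 ca.
  have [->|ne] := eqVneq c0 a; first exact: mem_head.
  case/and3P: ha => _ h1 h2.
  have [lt1|ge1] := ltnP c0.1 a.1.
    apply: (dn (a.1.-1, a.2)); first by apply: (implyP h1); lia.
    by move: ca; rewrite /le_cell /=; lia.
  have lt2 : (c0.2 < a.2)%N.
    by move: ne ca ge1; case: (c0) (a) => [? ?] [? ?]; rewrite xpair_eqE /le_cell /=; lia.
  apply: (dn (a.1, a.2.-1)); first by apply: (implyP h2); lia.
  by move: ca; rewrite /le_cell /=; lia.
move=> sr ba cb ne.
have := cl (b :: r); rewrite /= ba sr => /(_ isT b (mem_head _ _) c cb).
by rewrite inE (negPf ne).
Qed.

Lemma std_closed b c r : std r -> b \in r -> le_cell c b -> c \in r.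
Proof.
elim: r => //= a r IH /andP[ha sr]; rewrite !inE => /orP[/eqP -> ca|br cb].
  by case: eqVneq => //= ne; apply: addable_closed ha ca ne.
by rewrite IH ?orbT.
Qed.

Lemma addable_apart x y r : std r -> addable x r -> addable y r -> x != y -> apart x y.
Proof.
move=> sr ax ay xy; rewrite apartE; apply/andP; split; apply/negP => le.
  have := addable_closed sr ay le xy; apply/negP; by case/and3P: ax.
have := addable_closed sr ax le; rewrite eq_sym xy => /(_ isT); apply/negP.
by case/and3P: ay.
Qed.

(** If y is not a neighbour of x, then the boxes that y needs are already there
    before x. *)
Lemma std_step x y r : std (y :: x :: r) ->
  [|| y == right_of x, y == below x | addable y r].
Proof.
rewrite [std _]/= /addable !inE negb_or => /and3P[/and3P[/andP[yx ->] h1 h2] _ _].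
have [->//|nr] := eqVneq y (right_of x); have [->//|nb] := eqVneq y (below x).
move: nr nb h1 h2 yx; case: x y => [a b] [c d]; rewrite /right_of /below /= !xpair_eqE /=.
move=> nr nb h1 h2 yx; apply/andP; split; apply/implyP => p.
  by move: (implyP h1 p); case/orP => // /andP[/eqP e1 /eqP e2]; exfalso; move: nb; lia.
by move: (implyP h2 p); case/orP => // /andP[/eqP e1 /eqP e2]; exfalso; move: nr; lia.
Qed.

Lemma std_apart x y r : std (y :: x :: r) -> y != right_of x -> y != below x -> apart x y.
Proof.
move=> s nr nb; have := std_step s; rewrite (negPf nr) (negPf nb) /= => ay.
move: s => /= /and3P[/and3P[yx _ _] ax sr].
by apply: (addable_apart sr) => //; move: yx; rewrite inE negb_or eq_sym => /andP[].
Qed.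

Lemma mem_swap (r1 r2 : seq cell) x y : r1 ++ y :: x :: r2 =i r1 ++ x :: y :: r2.
Proof. by move=> z; rewrite !mem_cat !inE; congr (_ || _); rewrite orbCA. Qed.

Lemma perm_swap (r1 r2 : seq cell) x y :
  perm_eq (r1 ++ y :: x :: r2) (r1 ++ x :: y :: r2).
Proof.
by rewrite perm_cat2l -[y :: _]/([:: y] ++ [:: x] ++ r2) perm_catCA.
Qed.

Lemma std_swap r1 x y r2 : std (r1 ++ y :: x :: r2) -> apart x y ->
  std (r1 ++ x :: y :: r2).
Proof.
elim: r1 => [|b r1 IH] /=; last first.
  by move=> /andP[ab s] f; rewrite IH // andbT (eq_addable _ (mem_swap r1 r2 y x)).
move=> s f; have /= := std_step s.
have nr : (y == right_of x) = false.
  by apply/eqP => e; move: f; rewrite e /apart /right_of /= ltnn; lia.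
have nb : (y == below x) = false.
  by apply/eqP => e; move: f; rewrite e /apart /below /=; lia.
rewrite nr nb /= => ay; move: s => /and3P[_ ax sr].
rewrite ay sr !andbT; case/and3P: ax => xr h1 h2.
rewrite /addable !inE negb_or xr.
have -> : x != y by apply: contraTneq f => ->; rewrite /apart ltnn; lia.
by rewrite /=; apply/andP; split; apply/implyP => p;
  rewrite ?(implyP h1 p) ?(implyP h2 p) orbT.
Qed.

Lemma std_pairwise r : std r -> pairwise (fun u y => ~~ le_cell u y) r.
Proof.
elim: r => //= b r IH /andP[ab sr]; rewrite IH // andbT.
apply/allP => y yr; apply/negP => le; have := std_closed sr yr le.
by apply/negP; case/and3P: ab.
Qed.

Section Sorting.
Variable key : cell -> nat.

Fixpoint disorder (r : seq cell) : nat :=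
  if r is y :: r' then (count (fun x => key y < key x)%N r' + disorder r')%N else 0%N.

Lemma disorder_swap r1 x y r2 : (key y < key x)%N ->
  (disorder (r1 ++ x :: y :: r2) < disorder (r1 ++ y :: x :: r2))%N.
Proof.
move=> k; elim: r1 => [|b r1 IH] /=.
  rewrite k [(key x < key y)%N]ltnNge (ltnW k) /=; lia.
by rewrite (permP (perm_swap r1 r2 y x)) ltn_add2l.
Qed.

Lemma sorted_or_descent (r : seq cell) :
  sorted (fun y x => key x <= key y)%N r \/
  exists r1 x y r2, r = r1 ++ y :: x :: r2 /\ (key y < key x)%N.
Proof.
elim: r => [|b r IH]; first by left.
case: IH => [|[r1 [x [y [r2 [-> k]]]]]]; last by right; exists (b :: r1), x, y, r2.
case: r => [|c r] /=; first by left.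
have [k s|k _] := leqP (key c) (key b); first by left; apply/andP.
by right; exists [::], c, b, r.
Qed.

(** Bubble sort.  If the key does not decrease along rows and columns, then two consecutive
    boxes with decreasing keys are not neighbours, hence [apart], and may be
    interchanged. *)
Lemma std_sort_ind (Q : seq cell -> Prop) (r0 : seq cell) :
    (forall x, x \in r0 -> right_of x \in r0 -> key x <= key (right_of x))%N ->
    (forall x, x \in r0 -> below x \in r0 -> key x <= key (below x))%N ->
    (forall r, std r -> perm_eq r r0 ->
       sorted (fun y x => key x <= key y)%N r -> Q r) ->
    (forall r1 x y r2, std (r1 ++ y :: x :: r2) -> perm_eq (r1 ++ y :: x :: r2) r0 ->
       apart x y -> std (r1 ++ x :: y :: r2) -> Q (r1 ++ x :: y :: r2) ->
       Q (r1 ++ y :: x :: r2)) ->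
  forall r, std r -> perm_eq r r0 -> Q r.
Proof.
move=> kr kb base step r; have [m] := ubnP (disorder r).
elim: m r => // m IH r rm sr pr.
have [so|[r1 [x [y [r2 [e k]]]]]] := sorted_or_descent r; first exact: base.
have xin : x \in r0 by rewrite -(perm_mem pr) e mem_cat !inE eqxx !orbT.
have yin : y \in r0 by rewrite -(perm_mem pr) e mem_cat !inE eqxx !orbT.
rewrite e in sr pr rm *.
have f : apart x y.
  apply: (std_apart (std_catr sr)); apply: contraTneq k => e'; rewrite -leqNgt e'.
    by apply: kr => //; rewrite -e'.
  by apply: kb => //; rewrite -e'.
have s' := std_swap sr f.
apply: step => //; apply: IH => //.
- by rewrite -ltnS; apply: leq_trans rm; rewrite ltnS disorder_swap.
- by apply: perm_trans pr; exact: perm_swap.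
Qed.

End Sorting.

(** * Orderings adapted to a diagonal *)

(** The boxes d on the diagonal of b are to be followed immediately by next(d).
    The key puts d last among the boxes with the same i+j and moves next(d) from
    the beginning of the following group to the place just after d. *)
Section ReadingOrder.
Variables (dir : cell -> bool) (b : cell).

Definition next (d : cell) : cell := if dir d then right_of d else below d.

(** The candidates d1 and d2 for w = next(d) are the left and the upper neighbour
    of w. *)
Definition onto_next (w : cell) : bool :=
  let d1 := (w.1, w.2.-1) in let d2 := (w.1.-1, w.2) in
  [&& (0 < w.2)%N, cell_content d1 == cell_content b & next d1 == w]
  || [&& (0 < w.1)%N, cell_content d2 == cell_content b & next d2 == w].

Definition key (w : cell) : nat :=
  let rk := (w.1 + w.2)%N in
  if cell_content w == cell_content b then (3 * rk).+1
  else if onto_next w then (3 * rk).-1 else (3 * rk)%N.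

Lemma content_next d : cell_content (next d) != cell_content d.
Proof. by case: d => i j; rewrite /next; case: (dir _); rewrite /cell_content /=; lia. Qed.

Lemma onto_nextP w : onto_next w -> exists2 d, cell_content d = cell_content b & w = next d.
Proof.
by case/orP => /and3P[_ /eqP cd /eqP e]; [exists (w.1, w.2.-1)|exists (w.1.-1, w.2)].
Qed.

Lemma onto_next_next d : cell_content d = cell_content b -> onto_next (next d).
Proof.
case: d => i j cd; rewrite /onto_next; case di: (dir (i, j)).
  have e : next (i, j) = (i, j.+1) by rewrite /next di.
  by rewrite e /= cd e !eqxx.
have e : next (i, j) = (i.+1, j) by rewrite /next di.
by rewrite e /= cd e !eqxx orbT.
Qed.

Lemma rank_next d : ((next d).1 + (next d).2 = (d.1 + d.2).+1)%N.
Proof. by rewrite /next; case: (dir d) => /=; lia. Qed.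

Lemma key_diag d : cell_content d = cell_content b -> key d = (3 * (d.1 + d.2)).+1.
Proof. by move=> cd; rewrite /key cd eqxx. Qed.

Lemma key_next d : cell_content d = cell_content b -> key (next d) = (key d).+1.
Proof.
move=> cd; rewrite (key_diag cd) /key onto_next_next // -cd (negPf (content_next d)).
by rewrite rank_next; lia.
Qed.

Lemma content_rank_inj (d d' : cell) : cell_content d = cell_content d' -> (d.1 + d.2 = d'.1 + d'.2)%N -> d = d'.
Proof. by case: d d' => [i j] [k l]; rewrite /cell_content /= => *; congr pair; lia. Qed.

Lemma key_eq_diag d w : cell_content d = cell_content b -> key w = key d -> w = d.
Proof.
move=> cd; rewrite (key_diag cd) /key; case: eqP => [cw e|_].
  by apply: content_rank_inj; [rewrite cw|lia].
case: ifP => [/onto_nextP[d' _ ->]|_]; last by lia.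
by rewrite rank_next; lia.
Qed.

Lemma key_eq_next d w : cell_content d = cell_content b -> key w = (key d).+1 -> w = next d.
Proof.
move=> cd; rewrite (key_diag cd) /key; case: eqP => [cw|_]; first by lia.
case: ifP => [/onto_nextP[d' cd' ->]|_]; last by lia.
by rewrite rank_next => e; congr next; apply: content_rank_inj; [rewrite cd'|lia].
Qed.

Lemma key_bound w : ((3 * (w.1 + w.2)).-1 <= key w <= (3 * (w.1 + w.2)).+1)%N.
Proof. by rewrite /key; case: ifP => _; [|case: ifP => _]; lia. Qed.

Lemma key_right x : (key x <= key (right_of x))%N.
Proof.
have := key_bound x; have := key_bound (right_of x); rewrite /right_of /=; lia.
Qed.

Lemma key_below x : (key x <= key (below x))%N.
Proof.
have := key_bound x; have := key_bound (below x); rewrite /below /=; lia.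
Qed.

Lemma next_inj d d' : cell_content d = cell_content d' -> next d = next d' -> d = d'.
Proof.
case: d d' => [i j] [k l]; rewrite /next.
by case: (dir _); case: (dir _); rewrite /cell_content /right_of /below /= => e [] *; congr pair; lia.
Qed.

(** Here next(d) stands before d because lists are reversed. *)
Inductive paired : seq cell -> Prop :=
  | paired_nil : paired [::]
  | paired_cons w r : cell_content w != cell_content b -> paired r -> paired (w :: r)
  | paired_pair d r : cell_content d = cell_content b -> paired r -> paired (next d :: d :: r).

Lemma sorted_paired r : uniq r -> sorted (fun y x => key x <= key y)%N r ->
  (forall d, d \in r -> cell_content d = cell_content b -> next d \in r) -> paired r.
Proof.
have tr : transitive (fun y x => key x <= key y)%N.
  by move=> y x z xy yz; apply: leq_trans yz xy.
have [n] := ubnP (size r); elim: n r => // n IH [|e r] /= sn; first by constructor.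
case/andP=> er ur so cl.
have le w : w \in r -> (key w <= key e)%N.
  by move: w; apply/allP; exact: (order_path_min tr so).
have [ce|ce] := eqVneq (cell_content e) (cell_content b).
  have := cl e (mem_head _ _) ce; rewrite inE => /orP[/eqP ne|/le].
    by have := content_next e; rewrite ne eqxx.
  by rewrite key_next // ltnn.
(* If e is next(d) for no d on the diagonal, then e can be dropped. *)
have gen : (forall d, d \in r -> cell_content d = cell_content b -> next d != e) -> paired (e :: r).
  move=> ne; apply: paired_cons => //; apply: IH => //; first exact: path_sorted so.
  by move=> d dr cd; have := cl d; rewrite !inE dr orbT (negPf (ne d dr cd)); apply.
case: r => [|d r] in er ur so cl le gen sn *; first exact: gen.
have [cd|cd] := eqVneq (cell_content d) (cell_content b); last first.
  (* Otherwise e = next(d'), the key of d lies between those of d' and e, and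
     no third box has such a key. *)
  apply: gen => d' d'r cd'; apply: contraTneq ur => ne /=; apply/negP => /andP[dr ur].
  have le1 : (key d' <= key d)%N.
    move: d'r; rewrite inE => /orP[/eqP -> //|].
    by move: so => /= /andP[_ so]; have /allP := order_path_min tr so; apply.
  have := le d (mem_head _ _); rewrite -ne key_next // leq_eqVlt ltnS => /orP[/eqP e2|ge1].
    by move: er; rewrite -ne (key_eq_next cd' e2) mem_head.
  have e3 : key d = key d' by lia.
  by rewrite (key_eq_diag cd' e3) cd' eqxx in cd.
have ne : next d = e.
  have := cl d; rewrite !inE eqxx orbT => /(_ isT cd) /or3P[/eqP //|/eqP e1|dr].
    by have := content_next d; rewrite e1 eqxx.
  move: so => /= /andP[_ so]; have /allP/(_ _ dr) := order_path_min tr so.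
  by rewrite key_next // ltnn.
rewrite -ne; apply: paired_pair => //; move: ur => /= /andP[dr ur]; apply: IH => //.
- by move: sn => /=; lia.
- by move: so => /= /andP[_ /path_sorted].
move=> d' d'r cd'; have := cl d'; rewrite !inE d'r !orbT => /(_ isT cd') /or3P[/eqP e1|/eqP e1|//].
  by move: dr; rewrite -(next_inj (d := d') (d' := d)) ?d'r ?cd' ?cd // e1 ne.
by have := content_next d'; rewrite e1 cd cd' eqxx.
Qed.

(** A box on the diagonal of b other than b lies strictly above and to the left of
    b, so both its neighbours lie weakly above and to the left of b. *)
Lemma next_std r d : std (b :: r) -> d \in r -> cell_content d = cell_content b -> next d \in r.
Proof.
move=> /= /andP[ab sr] dr cd.
have lt : (d.1 < b.1)%N && (d.2 < b.2)%N.
  have nle : ~~ le_cell b d.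
    by apply/negP => le; case/and3P: ab; rewrite (std_closed sr dr le).
  by move: nle cd; case: (d) (b) => [i j] [k l]; rewrite /le_cell /cell_content /=; lia.
have := addable_closed (c := next d) sr ab; apply.
- by move: lt; rewrite /next; case: (dir d); rewrite /le_cell /=; lia.
- by apply: contraTneq isT => e; have := content_next d; rewrite e cd eqxx.
Qed.

End ReadingOrder.

(** Equal labels mean equal parameters.  The second condition leaves boxes of one
    diagonal with different labels, so that generic parameters of this kind avoid
    all poles. *)
Definition labelling (lab : cell -> nat) (dir : cell -> bool) : Prop :=
  (forall d, lab (next dir d) = lab d) /\
  (forall x y, lab x = lab y -> cell_content x = cell_content y -> x = y).

Lemma labelling_row : labelling (fun b => b.1) (fun=> true).
Proof.
split=> [d|[i j] [k l]] //=; rewrite /cell_content /= => -> e; congr pair; lia.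
Qed.

Lemma labelling_col : labelling (fun b => b.2) (fun=> false).
Proof.
split=> [d|[i j] [k l]] //=; rewrite /cell_content /= => -> e; congr pair; lia.
Qed.

(** The box (i, j) lies in the principal hook number min(i, j). *)
Lemma labelling_hook : labelling (fun b => minn b.1 b.2) (fun b => (b.1 <= b.2)%N).
Proof.
split=> [[i j]|[i j] [k l]] /=; rewrite /next /cell_content /=; first by case: ifP => /=; lia.
by move=> e1 e2; congr pair; lia.
Qed.

(** * Regularity of the fusion product *)

Section HregFactors.
Variables (K : fieldType) (q : K) (A : algType K) (T : nat -> A).
Variables (I : Type) (p : I -> K).

Lemma ratfun_beta (f g : (I -> K) -> K) : ratfun p f -> ratfun p g ->
  f p != 0 -> f p != g p -> ratfun p (fun z => beta q (f z) (g z)).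
Proof.
move=> hf hg f0 fg; apply: rat_mul; first exact: rat_const.
apply: rat_inv.
  apply: rat_add; last exact: rat_const.
  by apply: rat_mul => //; exact: rat_inv.
rewrite subr_eq0; apply: contraNneq fg => e.
by apply/eqP; rewrite -[LHS]mulr1 -e mulrA divff // mul1r.
Qed.

Lemma hreg_factor k (f g : (I -> K) -> K) : ratfun p f -> ratfun p g ->
  f p != 0 -> f p != g p -> hreg p (fun z => factor q T k (f z) (g z)).
Proof.
move=> hf hg f0 fg; apply: hreg_add; first exact: hreg_const.
by apply: hreg_scale; [exact: ratfun_beta|exact: hreg_const].
Qed.

Lemma ratfun_unitarity (f g : (I -> K) -> K) : ratfun p f -> ratfun p g ->
    f p != 0 -> g p != 0 -> f p != g p ->
  ratfun p (fun z => unitarity q (f z) (g z)).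
Proof.
move=> hf hg f0 g0 fg; apply: rat_add; first exact: rat_const.
by apply: rat_mul; apply: ratfun_beta => //; rewrite eq_sym.
Qed.
End HregFactors.

Section Fusion.
Variables (K : fieldType) (q : K) (A : algType K) (T : nat -> A) (N : nat).
Hypotheses (HT : hecke_family q T N) (q0 : q != 0)
  (qn : forall m, (0 < m)%N -> q ^+ m != 1).

Lemma qexp_inj : injective (fun m : nat => q ^+ m).
Proof.
have le m n : (m <= n)%N -> q ^+ m = q ^+ n -> m = n.
  move=> mn e; apply/eqP; rewrite eqn_leq mn leqNgt -subn_gt0 /=.
  apply/negP => /qn; apply/negP; rewrite negbK.
  have := subnKC mn => mnE; move: e; rewrite -{1}mnE exprD => e.
  have qm : q ^+ m != 0 by rewrite expf_neq0.
  by apply/eqP/(mulfI qm); rewrite mulr1.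
move=> m n /= e; have [|/ltnW] := leqP m n; first by move/le; apply.
by move/le => h; rewrite h.
Qed.

Lemma qexpz_inj (i j : int) : q ^ i = q ^ j -> i = j.
Proof.
have h (m : int) : q ^ m = 1 -> m = 0.
  case: m => [[//|m]|m]; first by move/eqP; rewrite (negPf (qn _)).
  by rewrite NegzE -exprnN => /eqP; rewrite invr_eq1 (negPf (qn _)).
move=> e; apply/eqP; rewrite -subr_eq0; apply/eqP/h.
by rewrite expfzDr // e -expfzDr // subrr.
Qed.

Definition arg (z : cell -> K) (b : cell) : K := q ^ (2 * cell_content b) * z b.

Definition args (z : cell -> K) (r : seq cell) : seq K := map (arg z) r.

Definition all_one : cell -> K := fun=> 1.

Lemma arg1E b : arg all_one b = q ^ (2 * cell_content b).
Proof. by rewrite /arg mulr1. Qed.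

Lemma arg1_neq0 b : arg all_one b != 0.
Proof. by rewrite arg1E expfz_neq0. Qed.

Lemma arg1_eq x y : (arg all_one x == arg all_one y) = (cell_content x == cell_content y).
Proof.
apply/eqP/eqP => [|e]; last by rewrite !arg1E e.
by rewrite !arg1E => /qexpz_inj; lia.
Qed.

Lemma ratfun_arg b p : ratfun p (fun z => arg z b).
Proof. by apply: rat_mul; [exact: rat_const|exact: rat_coord]. Qed.

Definition theta (dir : cell -> bool) (d : cell) : K := if dir d then q else - q^-1.

Section Theta.
Variables (dir : cell -> bool) (d : cell).
Let th := theta dir d.

Lemma theta_neq0 : th != 0.
Proof. by rewrite /th /theta; case: ifP; rewrite ?oppr_eq0 ?invr_eq0. Qed.

Lemma thetaB : th - th^-1 = q - q^-1.
Proof. by rewrite /th /theta; case: ifP => // _; rewrite invrN invrK opprK addrC. Qed.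

Lemma theta_sq : th ^+ 2 != 1.
Proof. by rewrite /th /theta; case: ifP => _; rewrite ?sqrrN ?exprVn ?invr_eq1 qn. Qed.

Lemma thetaD_neq0 : th + th^-1 != 0.
Proof.
have t0 := theta_neq0; have : th ^+ 2 + 1 != 0.
  rewrite addr_eq0; apply: contraNneq (qn (isT : 0 < 4)%N) => e.
  have : (th ^+ 2) ^+ 2 = 1 by rewrite e sqrrN expr1n.
  rewrite -exprM /th /theta; case: ifP => _; first by move=> ->.
  by rewrite (exprM (- q^-1) 2 2) sqrrN -exprM exprVn => /eqP; rewrite invr_eq1.
apply: contraNneq => e; have -> : th ^+ 2 + 1 = th * (th + th^-1).
  by field.
by rewrite e mulr0.
Qed.

Lemma arg_next z : z (next dir d) = z d -> arg z (next dir d) = th ^+ 2 * arg z d.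
Proof.
rewrite /arg => ->; rewrite mulrA; congr (_ * _).
rewrite /th /theta /next; case: ifP => _; case: d => i j; rewrite /cell_content /=.
  have -> : 2 * (j.+1%:Z - i%:Z) = 2 + 2 * (j%:Z - i%:Z) by lia.
  by rewrite expfzDr.
have -> : 2 * (j%:Z - i.+1%:Z) = - 2%:Z + 2 * (j%:Z - i%:Z) by lia.
by rewrite expfzDr // sqrrN exprVn -exprnN.
Qed.
End Theta.

(** The multiplier h stands for the product of the earlier factors.  It absorbs the
    projectors P of all pairs (d, next(d)); each P commutes with the factors of the
    entries before d and meets the factors of d and next(d), where [eigen_fused]
    applies.  A general h is needed because the lemma serves both for the product
    at z and for its value. *)
Lemma append_regular dir b r k : (0 < k)%N -> (k + size r <= N)%N -> paired dir b r ->
  exists g : (cell -> K) -> A, hreg all_one g /\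
  forall z h,
    (forall w, w \in r -> arg z w != 0 /\ arg z b != arg z w) ->
    (forall d, d \in r -> cell_content d = cell_content b -> next dir d \in r -> z (next dir d) = z d) ->
    (forall r1 d r2, r = r1 ++ next dir d :: d :: r2 -> cell_content d = cell_content b ->
      h * (T (k + size r1) + (theta dir d)^-1%:A) = (theta dir d + (theta dir d)^-1) *: h) ->
  h * append_prod q T k (args z r) (arg z b) = h * g z.
Proof.
move=> k0 kN pr; elim: pr k k0 kN => {r} [|w r cw _ IH|d r cd _ IH] k k0 /= kN.
- by exists (fun=> 1); split=> //; exact: hreg_const.
- have [|g [hg gE]] := IH k.+1 isT; first lia.
  exists (fun z => g z * factor q T k (arg z w) (arg z b)); split.
    apply: hreg_mul => //; apply: hreg_factor; try exact: ratfun_arg.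
      exact: arg1_neq0.
    by rewrite arg1_eq.
  move=> z h zr zt hm; rewrite mulrA gE ?mulrA //.
  + by move=> w' w'r; apply: zr; rewrite inE w'r orbT.
  + by move=> d dr cd nr; apply: zt => //; rewrite inE ?dr ?nr orbT.
  + move=> r1 d r2 e cd; have := hm (w :: r1) d r2; rewrite /= e => /(_ erefl cd).
    by rewrite addnS.
have [|g [hg gE]] := IH k.+2 isT; first lia.
pose th := theta dir d; pose P := T k + th^-1%:A.
have thD : th + th^-1 != 0 by exact: thetaD_neq0.
have [th0 thB th1] := And3 (theta_neq0 dir d) (thetaB dir d) (theta_sq dir d).
exists (fun z => g z * ((th + th^-1)^-1 *: (P * T k.+1 * factor q T k (arg z (next dir d)) (arg z b)
   + ((th - th^-1) * th * arg z d / (arg z b - arg z (next dir d))) *: P))).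
have ne : cell_content (next dir d) != cell_content b by rewrite -cd content_next.
split.
  apply: hreg_mul => //; apply: hreg_scale; first exact: rat_const.
  apply: hreg_add.
    apply: hreg_mul; first exact: hreg_const.
    apply: hreg_factor; try exact: ratfun_arg; first exact: arg1_neq0.
    by rewrite arg1_eq.
  apply: hreg_scale; last exact: hreg_const.
  apply: rat_mul.
    by apply: rat_mul; [exact: rat_const|exact: ratfun_arg].
  apply: rat_inv; last by rewrite subr_eq0 arg1_eq eq_sym.
  apply: rat_add; first exact: ratfun_arg.
  by rewrite -[X in ratfun _ X]/(fun z : cell -> K => - _); under eq_fun do rewrite -mulN1r;
    apply: rat_mul; [exact: rat_const|exact: ratfun_arg].
move=> z h zr zt hm.
have [d0 bd] : arg z d != 0 /\ arg z b != arg z d by apply: zr; rewrite !inE eqxx orbT.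
have [n0 bn] : arg z (next dir d) != 0 /\ arg z b != arg z (next dir d).
  by apply: zr; rewrite mem_head.
have aE : arg z (next dir d) = th ^+ 2 * arg z d.
  by apply: arg_next; apply: zt => //; rewrite !inE eqxx ?orbT.
have kN' : (0 < k < N)%N by lia.
have hP : h * P = (th + th^-1) *: h.
  by have := hm [::] d r erefl cd; rewrite addn0.
have hY : h * append_prod q T k.+2 (args z r) (arg z b) = h * g z.
  apply: gE.
  - by move=> w' w'r; apply: zr; rewrite !inE w'r !orbT.
  - by move=> d' dr cd' nr; apply: zt => //; rewrite !inE ?dr ?nr !orbT.
  - move=> r1 d' r2 e cd'; have := hm (next dir d :: d :: r1) d' r2; rewrite /= e => /(_ erefl cd').
    by rewrite !addnS.
have PY : P * append_prod q T k.+2 (args z r) (arg z b) = append_prod q T k.+2 (args z r) (arg z b) * P.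
  rewrite /P -(factor_adjacent _ _ thB th1 _ d0) //.
  by apply: (factor_append_below (N := N)) => //; rewrite size_map; lia.
rewrite -[LHS]scale1r -(mulVf thD) -[LHS]scalerA.
have step X : (th + th^-1) *: (h * (append_prod q T k.+2 (args z r) (arg z b) * X))
   = h * g z * (P * X).
  transitivity (h * (P * append_prod q T k.+2 (args z r) (arg z b)) * X).
    by rewrite scalerAl -hP !mulrA.
  by rewrite PY !mulrA hY.
rewrite -mulrA step aE (eigen_fused HT q0 th0 thB kN' d0 bd).
  by rewrite -!scalerAr mulrA.
by rewrite -aE.
Qed.

End Fusion.

Section ValueOnSubspace.
Variables (K : fieldType) (q : K) (A : algType K) (T : nat -> A) (N : nat).
Hypotheses (HT : hecke_family q T N) (q0 : q != 0)
  (qn : forall m, (0 < m)%N -> q ^+ m != 1).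
Implicit Types (r : seq cell) (b x y : cell) (z : cell -> K) (v : A).
Local Notation all_one := (@all_one K).
Local Notation arg := (arg q).
Local Notation args := (args q).
Local Notation F := (factor q T).

Definition dom (lab : cell -> nat) r z : Prop :=
  [/\ forall x y, x \in r -> y \in r -> lab x = lab y -> z x = z y,
      uniq (args z r) & 0 \notin args z r].

Definition fusion_at r z : A := fusion_prod q T (args z r).

Lemma dom_perm lab r r' z : perm_eq r r' -> dom lab r z -> dom lab r' z.
Proof.
move=> p [h u n]; have pa : perm_eq (args z r) (args z r') by apply: perm_map.
split; first by move=> x y xr yr; apply: h; rewrite (perm_mem p).
  by rewrite -(perm_uniq pa).
by rewrite -(perm_mem pa).
Qed.

Lemma dom_cons lab b r z : dom lab (b :: r) z -> dom lab r z.
Proof.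
move=> [h /= /andP[_ u]]; rewrite inE negb_or => /andP[_ n]; split=> //.
by move=> x y xr yr; apply: h; rewrite inE ?xr ?yr orbT.
Qed.

(** Distinct labels have distinct slopes, since q is not a root of unity. *)
Definition line (lab : cell -> nat) (t : K) : cell -> K := fun b => 1 + t * q ^+ lab b.

(** For t = 0 boxes with different contents have different parameters, and boxes
    with equal contents are separated by the slopes. *)
Lemma polyline_dom lab dir r : labelling lab dir -> uniq r ->
  polyline (line lab) all_one 0 (dom lab r).
Proof.
move=> [_ lab_inj] ur; split.
- by move=> b; exists (1 + (q ^+ lab b)%:P * 'X) => t; rewrite !hornerE mulrC.
- by apply: funext => b; rewrite /line mul0r addr0.
pose a b : {poly K} := (q ^ (2 * cell_content b))%:P * (1 + (q ^+ lab b)%:P * 'X).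
have aE b t : (a b).[t] = arg (line lab t) b.
  by rewrite /a /arg /line !hornerE [t * _]mulrC.
have qz (i : int) : q ^ i != 0 by rewrite expfz_neq0.
have a0 b : a b != 0.
  apply: contraTneq isT => /(congr1 (fun p => p.[0])).
  by rewrite aE /arg /line mul0r addr0 mulr1 horner0 => /eqP; rewrite (negPf (qz _)).
have axy x y : x != y -> a x - a y != 0.
  move=> xy; apply: contraNneq xy => e.
  have e0 : cell_content x = cell_content y.
    apply/eqP; rewrite -(arg1_eq q0 qn) -subr_eq0.
    have := congr1 (fun p => p.[0]) e; rewrite hornerD hornerN !aE horner0.
    by rewrite /arg /line !mul0r !addr0 => ->.
  have := congr1 (fun p => p.[1]) e; rewrite hornerD hornerN !aE horner0 => /eqP.
  rewrite subr_eq0 /arg /line e0 !mul1r => /eqP/(mulfI (qz _))/addrI/(qexp_inj q0 qn) l.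
  by apply/eqP; exact: lab_inj.
exists (\prod_(b <- r) a b * \prod_(x <- r) \prod_(y <- r | x != y) (a x - a y)).
  rewrite mulf_neq0 //; first by rewrite prodf_seq_neq0; apply/allP => b _; rewrite a0.
  rewrite prodf_seq_neq0; apply/allP => x _ /=.
  by rewrite prodf_seq_neq0; apply/allP => y _; apply/implyP; exact: axy.
move=> t; rewrite hornerM mulf_eq0 negb_or !horner_prod => /andP[p1 p2]; split.
- by move=> x y _ _ l; rewrite /line l.
- rewrite map_inj_in_uniq // => x y xr yr e; apply/eqP; move: p2; apply: contraNT => xy.
  rewrite (big_rem _ xr) /= horner_prod big_mkcond (big_rem _ yr) /= xy.
  by rewrite hornerD hornerN !aE e subrr !mul0r.
- apply/mapP => -[x xr e]; move: p1; rewrite (big_rem _ xr) /= aE -e mul0r.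
  by rewrite eqxx.
Qed.

Lemma unitarity_neq0 x y : apart x y -> unitarity q (arg all_one x) (arg all_one y) != 0.
Proof.
move=> f; have cxy := apart_content f; have [c1 c2] := apart_content1 f.
have xy : arg all_one x != arg all_one y by rewrite (arg1_eq q0 qn); apply/eqP.
have x0 := arg1_neq0 q0 x; have y0 := arg1_neq0 q0 y.
have e1 : arg all_one y - q ^+ 2 * arg all_one x != 0.
  rewrite subr_eq0 !arg1E exprnP -expfzDr //; apply/eqP => /(qexpz_inj q0 qn).
  by move=> h; apply: c2; lia.
have e2 : q ^+ 2 * arg all_one y - arg all_one x != 0.
  rewrite subr_eq0 !arg1E exprnP -expfzDr //; apply/eqP => /(qexpz_inj q0 qn).
  by move=> h; apply: c1; lia.
have xy' : arg all_one x - arg all_one y != 0 by rewrite subr_eq0.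
have yx' : arg all_one y - arg all_one x != 0 by rewrite subr_eq0 eq_sym.
rewrite /unitarity !betaE //.
have -> : 1 + (q - q^-1) * arg all_one x / (arg all_one y - arg all_one x) *
   ((q - q^-1) * arg all_one y / (arg all_one x - arg all_one y))
  = (arg all_one y - q ^+ 2 * arg all_one x) * (q ^+ 2 * arg all_one y - arg all_one x)
   / (q ^+ 2 * (arg all_one y - arg all_one x) ^+ 2).
  by field; rewrite q0 xy' yx'.
by rewrite !mulf_neq0 // invr_neq0 // mulf_neq0 // expf_neq0.
Qed.

(** The interchange relation, solved for one of the products by unitarity; all
    factors involved are regular and invertible at the limit point. *)
Lemma regular_swap lab r1 x y r2 v : (size r1 + size r2 + 2 <= N)%N -> apart x y ->
  regular (dom lab (r1 ++ x :: y :: r2)) all_one (fusion_at (r1 ++ x :: y :: r2)) v ->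
  regular (dom lab (r1 ++ y :: x :: r2)) all_one (fusion_at (r1 ++ y :: x :: r2))
    (F (size r2).+1 (arg all_one x) (arg all_one y) * v *
     ((unitarity q (arg all_one x) (arg all_one y))^-1 *: F (size r1).+1 (arg all_one x) (arg all_one y))).
Proof.
move=> sN f rv; have g0 := unitarity_neq0 f.
have pN : ((size r1).+1 < N)%N by lia.
have xy : arg all_one x != arg all_one y by rewrite (arg1_eq q0 qn); apply/eqP/apart_content.
have x0 := arg1_neq0 q0 x; have y0 := arg1_neq0 q0 y.
have hg : ratfun all_one (fun z => unitarity q (arg z x) (arg z y)).
  by apply: ratfun_unitarity => //; exact: ratfun_arg.
have hF k : hreg all_one (fun z => F k (arg z x) (arg z y)).
  by apply: hreg_factor => //; exact: ratfun_arg.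
have rv' : regular (dom lab (r1 ++ y :: x :: r2)) all_one (fusion_at (r1 ++ x :: y :: r2)) v.
  by apply: regular_sub rv => z; apply: dom_perm; exact: perm_swap.
have h1 : hreg all_one (fun z => (unitarity q (arg z x) (arg z y))^-1 *:
    F (size r1).+1 (arg z x) (arg z y)).
  by apply: hreg_scale => //; exact: rat_inv.
have := regular_mul (regular_mul (regular_hreg _ (hF (size r2).+1)) rv') (regular_hreg _ h1).
apply: regular_near hg g0 _ => z dz g1.
have [_ u n] : dom lab (r1 ++ x :: y :: r2) z.
  by apply: dom_perm dz; exact: perm_swap.
have [axy ax0 ay0] : [/\ arg z x != arg z y, arg z x != 0 & arg z y != 0].
  move: u n; rewrite /args !map_cat /= cat_uniq mem_cat /= !inE !negb_or.
  by move=> /and4P[_ _ /andP[-> _] _] /and4P[_ h1' h2' _]; rewrite ![_ == 0]eq_sym.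
rewrite /fusion_at /args !map_cat /=.
have := @fusion_swap K q A T N HT q0 (map (arg z) r1) (arg z y) (arg z x) (map (arg z) r2).
rewrite !size_map -map_cons -map_cons -map_cat => -> //.
rewrite -mulrA -scalerAr.
rewrite (factor_unitarity HT q0) ?pN //; last by rewrite eq_sym.
by rewrite /unitarity [beta q (arg z y) _ * _]mulrC -/(unitarity q _ _) scalerA mulVf // scale1r mulr1.
Qed.

End ValueOnSubspace.

Section Step.
Variables (K : fieldType) (q : K) (A : algType K) (T : nat -> A) (N : nat).
Hypotheses (HT : hecke_family q T N) (q0 : q != 0)
  (qn : forall m, (0 < m)%N -> q ^+ m != 1).
Implicit Types (r : seq cell) (b x y : cell) (z : cell -> K) (v : A).
Local Notation all_one := (@all_one K).
Local Notation arg := (arg q).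
Local Notation args := (args q).
Local Notation F := (factor q T).
Local Notation fusion_at := (fusion_at q T).
Local Notation dom := (dom q).
Local Notation pt := ((fun=> 1) : unit -> K).

(** The conjugations on the two sides of an interchange cancel. *)
Lemma conj_cancel (g : K) (a a' v p p' Y Ys P : A) : g != 0 ->
    a * a' = g%:A -> p' * p = g%:A -> p * Y = Ys * P ->
  v * Y = a * (a' * v * (g^-1 *: p') * Ys) * (g^-1 *: P).
Proof.
move=> g0 aa pp sw.
have -> : a * (a' * v * (g^-1 *: p') * Ys) * (g^-1 *: P)
   = g^-1 *: (g^-1 *: (a * a' * v * (p' * (Ys * P)))).
  by rewrite -!(scalerAr, scalerAl) !mulrA.
rewrite -sw [p' * _]mulrA pp aa !mulr_algl -scalerAl -scalerAr !scalerA.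
by rewrite [_ * g^-1 * g]mulfVK // mulVf // scale1r.
Qed.

(** The value for the old boxes times the factors of the last box, whose parameter u
    is free while all other z equal 1. *)
Definition last_free r b v (u : unit -> K) : A :=
  v * append_prod q T 1 (args all_one r) (q ^ (2 * cell_content b) * u tt).

Definition last_dom r b (u : unit -> K) : Prop :=
  forall w, w \in r -> q ^ (2 * cell_content b) * u tt != arg all_one w.

Lemma polyline_last r b :
  polyline (fun (t : K) (_ : unit) => 1 + t) (fun=> 1) 0 (last_dom r b).
Proof.
split; first by move=> _; exists (1 + 'X) => t; rewrite !hornerE.
  by apply: funext => _; rewrite addr0.
have qz : q ^ (2 * cell_content b) != 0 by rewrite expfz_neq0.
exists (\prod_(w <- r) ((q ^ (2 * cell_content b))%:P * (1 + 'X) - (arg all_one w)%:P)).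
  rewrite prodf_seq_neq0; apply/allP => w _ /=; set p : {poly K} := _ - _.
  have pE : q ^ (2 * cell_content b) = p.[1] - p.[0] by rewrite /p !hornerE; ring.
  by apply: contraNneq qz => e; rewrite pE e !horner0 subrr.
move=> t; rewrite horner_prod => p w wr; move: p; apply: contraNneq => e.
by rewrite (big_rem _ wr) /= !hornerE e subrr mul0r.
Qed.

(** The second condition determines v from the previous value alone. *)
Definition step_spec lab b r : Prop := forall v',
  regular (dom lab r) all_one (fusion_at r) v' ->
  exists v, regular (dom lab (b :: r)) all_one (fusion_at (b :: r)) v /\
    regular (last_dom r b) pt (last_free r b v') v.

(** Divisibility by the factor of (d, next(d)), which is constant here. *)
Lemma eigen_right lab dir r1 d r2 z : labelling lab dir ->
    (size (r1 ++ next dir d :: d :: r2) <= N)%N ->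
    dom lab (r1 ++ next dir d :: d :: r2) z ->
  fusion_at (r1 ++ next dir d :: d :: r2) z * (T (size r1).+1 + (theta q dir d)^-1%:A) =
  (theta q dir d + (theta q dir d)^-1) *: fusion_at (r1 ++ next dir d :: d :: r2) z.
Proof.
move=> [hl _] sN [hz u n]; rewrite size_cat /= in sN.
have d0 : arg z d != 0.
  by apply: contraNneq n => <-; apply: map_f; rewrite mem_cat !inE eqxx !orbT.
have aE : arg z (next dir d) = theta q dir d ^+ 2 * arg z d.
  by apply: arg_next => //; apply: hz; rewrite // mem_cat !inE eqxx !orbT.
move: u n; rewrite /fusion_at /args map_cat /= => u n.
have [|G ->] := fusion_divr HT q0 _ u n; first by rewrite !size_map; lia.
rewrite size_map aE (factor_adjacent T (theta_neq0 q0 dir d) (thetaB q dir d) (theta_sq qn dir d) _ d0).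
rewrite -mulrA (eigen_sq HT) ?scalerAr //; [exact: theta_neq0|exact: thetaB|].
by lia.
Qed.

(** In a sorted list [append_regular] applies twice with the same regular function
    g: to the product at z, and to its value v with only the last parameter free.
    That v absorbs the projectors follows from [eigen_right] in the limit. *)
Lemma step_sorted lab dir b r : labelling lab dir -> std (b :: r) -> (size r < N)%N ->
  sorted (fun y x => key dir b x <= key dir b y)%N r -> step_spec lab b r.
Proof.
move=> hl sbr rN so v' rv; have sr : std r by case/andP: (sbr).
have pr : paired dir b r.
  by apply: sorted_paired (std_uniq sr) so _ => d; exact: next_std.
have [//||g [hg gE]] := append_regular HT q0 qn (k := 1) _ _ pr; first by lia.
have br : b \notin r by have := std_uniq sbr => /andP[].
have hv' r1 d r2 : r = r1 ++ next dir d :: d :: r2 ->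
    v' * (T (1 + size r1) + (theta q dir d)^-1%:A) =
    (theta q dir d + (theta q dir d)^-1) *: v'.
  move=> e; rewrite add1n; set P := T _ + _; set c := _ + _^-1.
  apply/eqP; rewrite -subr_eq0 -scaleNr; apply/eqP.
  apply: (regular_zero (qexp_inj q0 qn) (polyline_dom q0 qn hl (std_uniq sr)))
    (regular_lincomb (- c) (regular_mul rv (regular_hreg _ (hreg_const _ P))) rv).
  move=> z; rewrite e => dz; apply/eqP; rewrite scaleNr subr_eq0; apply/eqP.
  by apply: (eigen_right hl) => //; rewrite -e ltnW.
exists (v' * g all_one); split.
  apply: (@regular_near _ _ _ _ _ (fun z => fusion_at r z * g z) _ _ (fun=> 1)).
  - exact: rat_const.
  - exact: oner_neq0.
  - move=> z dz _; apply: gE => [w wr|d dr _ nr|r1 d r2 e _].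
    + case: dz => _ /= /andP[nb _]; rewrite inE negb_or => /andP[b0 n].
      split; first by apply: contraNneq n => <-; exact: map_f.
      by apply: contraNneq nb => ->; exact: map_f.
    + by case: dz => hz _ _; case: hl => hl1 _; apply: hz; rewrite ?inE ?dr ?nr ?orbT.
    + rewrite add1n {}e in dz rN *; apply: (eigen_right hl) => //; first exact: ltnW.
      exact: dom_cons dz.
  - apply: regular_mul (regular_hreg _ hg).
    by apply: regular_sub rv => z; exact: dom_cons.
(* The points at which all parameters but the last are fixed. *)
pose c (w : cell) (u : unit -> K) : K := if w == b then u tt else 1.
have cE u : args (c^~ u) r = args all_one r.
  apply/eq_in_map => w wr; rewrite /arg /c.
  by case: eqP => // e; move: br; rewrite -e wr.
have hgc : hreg pt (fun u => g (c^~ u)).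
  apply: hreg_comp hg => w; last by rewrite /c; case: ifP.
  by rewrite /c; case: (w == b); [exact: rat_coord|exact: rat_const].
have cone : c^~ pt = all_one by apply: funext => w; rewrite /c; case: ifP.
have := regular_hreg (last_dom r b) (hreg_mul (hreg_const _ v') hgc).
rewrite /= cone.
apply: (@regular_near _ _ _ _ _ _ _ _ (fun=> 1)).
- exact: rat_const.
- exact: oner_neq0.
- move=> u ud _; have cb : arg (c^~ u) b = q ^ (2 * cell_content b) * u tt by rewrite /arg /c eqxx.
  have cw w : w \in r -> arg (c^~ u) w = arg all_one w.
    by move=> wr; move: cE => /(_ u)/eq_in_map; apply.
  rewrite /last_free -(cE u) -cb; apply: gE => [w wr|d dr _ nr|r1 d r2 e _].
  + by rewrite cb cw //; split; [exact: arg1_neq0|exact: ud].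
  + rewrite /c; case: eqP => [e|_]; first by move: br; rewrite -e nr.
    by case: eqP => [e|//]; move: br; rewrite -e dr.
  + exact: hv' e.
Qed.

(** Both conditions of [step_spec] transform in the same way, by [fusion_swap] and
    by [append_swap]. *)
Lemma step_swap lab b r1 x y r2 : std (b :: r1 ++ y :: x :: r2) ->
    (size (r1 ++ y :: x :: r2) < N)%N -> apart x y ->
  step_spec lab b (r1 ++ x :: y :: r2) -> step_spec lab b (r1 ++ y :: x :: r2).
Proof.
move=> sb rN f hs v' rv'.
rewrite size_cat /= in rN.
have sN : (size r1 + size r2 + 2 <= N)%N by lia.
have sN' : (size (b :: r1) + size r2 + 2 <= N)%N by rewrite /=; lia.
have pN : ((size r1).+1 < N)%N by lia.
have kN : ((size r2).+1 < N)%N by lia.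
have sN1 : ((size r1).+1 + size r2 + 2 <= N)%N by lia.
have [v [rv lv]] := hs _ (regular_swap HT q0 qn sN (etrans (apart_sym y x) f) rv').
have g0 := unitarity_neq0 q0 qn f.
exists (F (size r2).+1 (arg all_one x) (arg all_one y) * v *
     ((unitarity q (arg all_one x) (arg all_one y))^-1 *: F (size r1).+2 (arg all_one x) (arg all_one y))).
split; first exact: (regular_swap HT q0 qn sN' f rv).
have := regular_mul (regular_mul
  (regular_hreg _ (hreg_const _ (F (size r2).+1 (arg all_one x) (arg all_one y)))) lv)
  (regular_hreg _ (hreg_const _ ((unitarity q (arg all_one x) (arg all_one y))^-1 *:
      F (size r1).+2 (arg all_one x) (arg all_one y)))).
have pe := perm_swap r1 r2 x y.
have hsub u : last_dom (r1 ++ y :: x :: r2) b u -> last_dom (r1 ++ x :: y :: r2) b u.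
  by move=> ud w wr; apply: ud; rewrite (perm_mem pe).
move/(regular_sub hsub).
apply: (@regular_near _ _ _ _ _ _ _ _ (fun=> 1)).
- exact: rat_const.
- exact: oner_neq0.
move=> u ud _; rewrite /last_free.
have x0 := arg1_neq0 q0 x; have y0 := arg1_neq0 q0 y.
have xy : arg all_one x != arg all_one y by rewrite (arg1_eq q0 qn); apply/eqP/apart_content.
have yx : arg all_one y != arg all_one x by rewrite eq_sym.
have inv1 : F (size r2).+1 (arg all_one x) (arg all_one y) * F (size r2).+1 (arg all_one y) (arg all_one x)
    = (unitarity q (arg all_one x) (arg all_one y))%:A by rewrite (factor_unitarity HT q0) ?kN.
have inv2 : F (size r1).+1 (arg all_one y) (arg all_one x) * F (size r1).+1 (arg all_one x) (arg all_one y)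
    = (unitarity q (arg all_one x) (arg all_one y))%:A.
  by rewrite (factor_unitarity HT q0) ?pN // /unitarity [beta q (arg all_one y) _ * _]mulrC.
have gyx : unitarity q (arg all_one y) (arg all_one x) = unitarity q (arg all_one x) (arg all_one y).
  by rewrite /unitarity mulrC.
have ux : q ^ (2 * cell_content b) * u tt != arg all_one x by apply: ud; rewrite mem_cat !inE eqxx !orbT.
have uy : q ^ (2 * cell_content b) * u tt != arg all_one y by apply: ud; rewrite mem_cat !inE eqxx !orbT.
have sw : F (size r1).+1 (arg all_one x) (arg all_one y) *
      append_prod q T 1 (args all_one (r1 ++ y :: x :: r2)) (q ^ (2 * cell_content b) * u tt) =
    append_prod q T 1 (args all_one (r1 ++ x :: y :: r2)) (q ^ (2 * cell_content b) * u tt) *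
      F (size r1).+2 (arg all_one x) (arg all_one y).
  have := append_swap HT q0 (k := 1) (r1 := args all_one r1) (r2 := args all_one r2)
    (u := q ^ (2 * cell_content b) * u tt) isT.
  rewrite !size_map add1n /args !map_cat /=; apply=> //; rewrite 1?eq_sym //.
by rewrite gyx; exact: conj_cancel g0 inv1 inv2 sw.
Qed.

Lemma regular_step lab dir b r : labelling lab dir -> std (b :: r) -> (size r < N)%N ->
  step_spec lab b r.
Proof.
move=> hl /= /andP[ab sr] rN.
have gen r' : std r' -> perm_eq r' r -> step_spec lab b r'.
  apply: (std_sort_ind (key := key dir b)) => {r'}.
  - by move=> x _ _; exact: key_right.
  - by move=> x _ _; exact: key_below.
  - move=> r' sr' pr' so; apply: (step_sorted hl _ _ so).
      by rewrite /= (eq_addable _ (perm_mem pr')) ab.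
    by rewrite (perm_size pr').
  - move=> r1 x y r2 sr' pr' f _; apply: step_swap => //.
      by rewrite /= (eq_addable _ (perm_mem pr')) ab.
    by rewrite (perm_size pr').
exact: gen.
Qed.

Definition common_value r v : Prop := forall lab dir, labelling lab dir ->
  regular (dom lab r) all_one (fusion_at r) v.

(** The value found for the row labelling is the limit of [last_free], and so is the
    value found for any other labelling. *)
Lemma common_value_exists r : std r -> (size r <= N)%N -> exists v, common_value r v.
Proof.
elim: r => [|b r IH] sr rN.
  exists 1 => lab dir _; exact: (regular_hreg _ (hreg_const _ 1)).
have [|//|v' rv'] := IH; [by case/andP: sr|exact: ltnW|].
have [v [_ lv]] := regular_step labelling_row sr rN (rv' _ _ labelling_row).
exists v => lab dir hl; have [w [rw lw]] := regular_step hl sr rN (rv' _ _ hl).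
by rewrite (regular_unique (qexp_inj q0 qn) (polyline_last r b) lv lw).
Qed.

End Step.

(** * Relations between the values *)

Section Relations.
Variables (K : fieldType) (q : K) (A : algType K) (T : nat -> A) (N : nat).
Hypotheses (HT : hecke_family q T N) (q0 : q != 0)
  (qn : forall m, (0 < m)%N -> q ^+ m != 1).
Implicit Types (r : seq cell) (b x y : cell) (z : cell -> K) (v : A).
Local Notation all_one := (@all_one K).
Local Notation arg := (arg q).
Local Notation args := (args q).
Local Notation F := (factor q T).

Definition fusion_value r : A := xget 0 [set v | common_value q T r v]%classic.

Lemma fusion_valueP r : std r -> (size r <= N)%N -> common_value q T r (fusion_value r).
Proof.
move=> sr rN; have [v rv] := common_value_exists HT q0 qn sr rN.
exact: (xgetPex 0 (ex_intro (fun v => [set v | common_value q T r v]%classic v) v rv)).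
Qed.

Lemma fusion_value_swap r1 x y r2 : std (r1 ++ y :: x :: r2) ->
    (size (r1 ++ y :: x :: r2) <= N)%N -> apart x y ->
  F (size r2).+1 (arg all_one y) (arg all_one x) * fusion_value (r1 ++ y :: x :: r2) =
  fusion_value (r1 ++ x :: y :: r2) * F (size r1).+1 (arg all_one x) (arg all_one y).
Proof.
move=> s sN f; have s' := std_swap s f.
have sN' : (size (r1 ++ x :: y :: r2) <= N)%N by rewrite (perm_size (perm_swap r1 r2 y x)).
have hr := labelling_row.
have rN : (size r1 + size r2 + 2 <= N)%N by move: sN; rewrite size_cat /=; lia.
have pN : ((size r1).+1 < N)%N by lia.
have kN : ((size r2).+1 < N)%N by lia.
have := regular_swap HT q0 qn rN f (fusion_valueP s' sN' hr).
move/(regular_unique (qexp_inj q0 qn) (polyline_dom q0 qn hr (std_uniq s)) (fusion_valueP s sN hr)) ->.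
have x0 := arg1_neq0 q0 x; have y0 := arg1_neq0 q0 y.
have xy : arg all_one x != arg all_one y by rewrite (arg1_eq q0 qn); apply/eqP/apart_content.
have g0 := unitarity_neq0 q0 qn f.
rewrite -mulrA mulrA (factor_unitarity HT q0) ?kN // 1?eq_sym // mulr_algl.
rewrite /unitarity [beta q (arg all_one y) _ * _]mulrC -/(unitarity q _ _).
by rewrite -!scalerAr scalerA mulfV // scale1r.
Qed.

(** Here k and k+1 are neighbours with equal parameters, so the left factor of the
    product is the constant T_k + th^-1. *)
Lemma fusion_value_eigen lab dir r1 x r2 : labelling lab dir ->
    std (r1 ++ next dir x :: x :: r2) -> (size (r1 ++ next dir x :: x :: r2) <= N)%N ->
  T (size r2).+1 * fusion_value (r1 ++ next dir x :: x :: r2) =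
  theta q dir x *: fusion_value (r1 ++ next dir x :: x :: r2).
Proof.
set r := _ ++ _ => hl s sN; set th := theta _ _ _.
apply/eqP; rewrite -subr_eq0 -scaleNr; apply/eqP.
have rv := fusion_valueP s sN hl.
apply: (regular_zero (qexp_inj q0 qn) (polyline_dom q0 qn hl (std_uniq s)))
  (regular_lincomb (- th) (regular_mul (regular_hreg _ (hreg_const _ (T (size r2).+1))) rv) rv).
move=> z [hz u n]; apply/eqP; rewrite scaleNr subr_eq0; apply/eqP.
have d0 : arg z x != 0.
  by apply: contraNneq n => <-; apply: map_f; rewrite mem_cat !inE eqxx !orbT.
have aE : arg z (next dir x) = th ^+ 2 * arg z x.
  by apply: arg_next => //; case: hl => h _; apply: hz; rewrite // mem_cat !inE eqxx !orbT.
move: u n sN; rewrite /fusion_at /r /args map_cat /= => u n; rewrite size_cat /= => sN.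
have kN : ((size r2).+1 < N)%N by lia.
have [|G ->] := fusion_divl HT q0 _ u n; first by rewrite !size_map; lia.
rewrite size_map aE (factor_adjacent T (theta_neq0 q0 dir x) (thetaB q dir x) (theta_sq qn dir x) _ d0).
by rewrite mulrA (T_eigenl HT q0 (theta_neq0 q0 dir x) (thetaB q dir x)) ?kN // scalerAl.
Qed.

Lemma fusion_value_right r1 x r2 : std (r1 ++ right_of x :: x :: r2) ->
    (size (r1 ++ right_of x :: x :: r2) <= N)%N ->
  T (size r2).+1 * fusion_value (r1 ++ right_of x :: x :: r2) =
  q *: fusion_value (r1 ++ right_of x :: x :: r2).
Proof. exact: (fusion_value_eigen labelling_row). Qed.

Lemma fusion_value_below r1 x r2 : std (r1 ++ below x :: x :: r2) ->
    (size (r1 ++ below x :: x :: r2) <= N)%N ->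
  T (size r2).+1 * fusion_value (r1 ++ below x :: x :: r2) =
  - q^-1 *: fusion_value (r1 ++ below x :: x :: r2).
Proof. exact: (fusion_value_eigen labelling_col). Qed.

End Relations.

(** * Transport between standard orderings *)

(** Products of factors that lead from a fixed ordering s to an ordering r.  A path
    of interchanges from s to r is far from unique; the definition below chooses
    one by recursion on s, and [transport_swap] shows that the choice is coherent
    up to nonzero scalars. *)
Section Transport.
Variables (K : fieldType) (q : K) (A : algType K) (T : nat -> A) (N : nat).
Hypotheses (HT : hecke_family q T N) (q0 : q != 0)
  (qn : forall m, (0 < m)%N -> q ^+ m != 1).
Implicit Types (r s : seq cell) (b x y u : cell) (k : nat).
Local Notation a := (arg q (@all_one K)).
Local Notation F k x y := (factor q T k (a x) (a y)).
Local Notation g x y := (unitarity q (a x) (a y)).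

Let a0 x : a x != 0. Proof. exact: arg1_neq0. Qed.

Let apart_arg x y : apart x y -> a x != a y.
Proof. by move=> f; rewrite (arg1_eq q0 qn); apply/eqP/apart_content. Qed.

Lemma factor_apart_unitarity k x y : (0 < k < N)%N -> apart x y -> F k x y * F k y x = (g x y)%:A.
Proof. by move=> kN f; rewrite (factor_unitarity HT q0 kN) // apart_arg. Qed.

Fixpoint pull_prod k r b : A :=
  if r is x :: r' then F (k + size r') x b * pull_prod k r' b else 1.

Lemma factor_pull_comm k l r x y b : (0 < k)%N -> (k + size r < l)%N -> (l < N)%N ->
  F l x y * pull_prod k r b = pull_prod k r b * F l x y.
Proof.
elim: r => [|w r IH] /= k0 kl lN; first by rewrite mulr1 mul1r.
have c : F (k + size r) w b * F l x y = F l x y * F (k + size r) w b.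
  by apply: (factor_comm HT); lia.
by rewrite mulrA -c -!mulrA IH //; lia.
Qed.

Lemma pull_swap k r1 x y r2 b : (0 < k)%N -> (k + size r1 + size r2 + 2 <= N)%N ->
    apart y x -> apart y b -> apart x b ->
  F (k + size r2) y x * pull_prod k (r1 ++ y :: x :: r2) b =
  pull_prod k (r1 ++ x :: y :: r2) b * F (k + size r2).+1 y x.
Proof.
move=> k0 + yx yb xb; elim: r1 => [|w r1 IH] /= kN.
  rewrite addn0 in kN; rewrite !addnS.
  have kN1 : ((k + size r2).+1 < N)%N by lia.
  have kp : (0 < k + size r2)%N by lia.
  rewrite -[RHS]mulrA -[in RHS]mulrA -factor_pull_comm //; rewrite !mulrA.
  by rewrite (yang_baxter HT) ?apart_arg // apart_sym.
have k1 : (0 < k + size r2)%N by lia.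
have k2 : ((k + size r2).+1 < k + size (r1 ++ y :: x :: r2) < N)%N.
  by rewrite size_cat /=; lia.
rewrite mulrA (factor_comm HT) //.
by rewrite -!mulrA IH ?size_cat //=; lia.
Qed.

(** In a reversed list the earlier entries are those after b. *)
Definition earlier b r := drop (index b r).+1 r.

(** The first box b of s is moved, past all boxes that precede it in r, after the
    other boxes have been arranged.  Here s is in chronological order and r is
    reversed. *)
Fixpoint transport k s r : A :=
  if s is b :: s' then pull_prod k (earlier b r) b * transport k.+1 s' (rem b r) else 1.

Lemma earlier_cat b r1 r2 : b \notin r1 -> earlier b (r1 ++ b :: r2) = r2.
Proof.
move=> br; rewrite /earlier index_cat (negPf br) /= eqxx addn0.
by rewrite -cat_rcons drop_size_cat // size_rcons.
Qed.

Lemma rem_cat_notin b r1 r2 : b \notin r1 -> rem b (r1 ++ b :: r2) = r1 ++ r2.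
Proof.
elim: r1 => [|c r1 IH] /=; first by rewrite eqxx.
by rewrite inE negb_or eq_sym => /andP[/negPf -> /IH ->].
Qed.

(** The form of standardness that survives the removal of boxes. *)
Definition later_not_below r := pairwise (fun u y => ~~ le_cell u y) r.

Lemma split_first b r : b \in r -> exists r1 r2, r = r1 ++ b :: r2 /\ b \notin r1.
Proof.
elim: r => //= c r IH; rewrite inE; have [-> _|bc /= /IH[r1 [r2 [-> h]]]] := eqVneq b c.
  by exists [::], r.
by exists (c :: r1), r2; rewrite inE negb_or bc.
Qed.

(** The cases of the proof are the position of the first box b of s relative to the
    interchanged boxes.  If b is one of the two, the interchange is the last or
    the next step of the chosen path; otherwise it is an interchange of the
    remaining boxes, passed through the factors of b by [pull_swap] or by
    commutation. *)
Lemma transport_swap k s r1 x y r2 : (0 < k)%N ->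
    (k + size r1 + size r2 + 2 <= N.+1)%N ->
    perm_eq s (r1 ++ y :: x :: r2) -> uniq s ->
    later_not_below (rev s) -> later_not_below (r1 ++ y :: x :: r2) -> apart x y ->
  exists2 c : K, c != 0 & F (k + size r2) y x * transport k s (r1 ++ y :: x :: r2) =
    c *: transport k s (r1 ++ x :: y :: r2).
Proof.
elim: s k r1 r2 => [|b s IH] k r1 r2 k0 kN ps us as_ ar f.
  by have := perm_size ps; rewrite size_cat /= addnS.
have kN0 : (0 < k + size r2 < N)%N by clear -k0 kN; lia.
have us' : uniq (r1 ++ y :: x :: r2) by rewrite -(perm_uniq ps).
have ast : later_not_below (rev s) /\ forall w, w \in s -> ~~ le_cell w b.
  move: as_; rewrite /later_not_below rev_cons pairwise_rcons => /andP[/allP h ->]; split=> //.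
  by move=> w ws; apply: h; rewrite mem_rev.
have ub : b \notin s by case/andP: us.
have us1 : uniq s by case/andP: us.
have bin : b \in r1 ++ y :: x :: r2 by rewrite -(perm_mem ps) mem_head.
have xy : x != y by apply: contraTneq f => ->; rewrite apart_irr.
have yx : y != x by rewrite eq_sym.
have fyx : apart y x by rewrite apart_sym.
have mem_s w : w \in r1 ++ y :: x :: r2 -> w != b -> w \in s.
  by rewrite -(perm_mem ps) inE => /orP[/eqP ->|//]; rewrite eqxx.
have prem r3 r4 : r1 ++ y :: x :: r2 = r3 ++ b :: r4 -> b \notin r3 ->
    perm_eq s (r3 ++ r4) /\ later_not_below (r3 ++ r4).
  move=> e br3; split.
    rewrite -(perm_cons b); apply: perm_trans ps _; rewrite e.
    by rewrite -cat1s perm_catCA.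
  apply: subseq_pairwise ar; rewrite e; apply: cat_subseq => //.
  exact: subseq_cons.
have fb r3 r4 w : r1 ++ y :: x :: r2 = r3 ++ b :: r4 -> w \in r4 -> apart w b.
  move=> e wr; have wb : w != b.
    apply: contraTneq wr => ->; move: us'; rewrite e cat_uniq => /and3P[_ _].
    by case/andP.
  rewrite apartE; apply/andP; split.
    by case: ast => _; apply; apply: mem_s => //; rewrite e mem_cat inE wr !orbT.
  move: ar; rewrite e /later_not_below pairwise_cat => /and3P[_ _] /= /andP[/allP h _].
  exact: h.
have us'0 := us'; move: us'; rewrite cat_uniq /= !inE !negb_or => /and4P[ur1 hr1 /andP[_ yr2] /andP[xr2 ur2]].
have [yr1 xr1 _] := and3P hr1.
have [bx|bx] := eqVneq b x.
  subst b; exists 1; first exact: oner_neq0.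
  have e1 : r1 ++ y :: x :: r2 = rcons r1 y ++ x :: r2 by rewrite cat_rcons.
  have xr1y : x \notin rcons r1 y by rewrite mem_rcons inE negb_or xy.
  rewrite /= e1 !earlier_cat // !rem_cat_notin // cat_rcons.
  by rewrite scale1r /= mulrA.
have [by_|by_] := eqVneq b y.
  subst b; exists (g y x); first exact: unitarity_neq0.
  have e1 : r1 ++ x :: y :: r2 = rcons r1 x ++ y :: r2 by rewrite cat_rcons.
  have yr1x : y \notin rcons r1 x by rewrite mem_rcons inE negb_or yx.
  rewrite /= e1 !earlier_cat // !rem_cat_notin // cat_rcons.
  by rewrite /= !mulrA factor_apart_unitarity // mulr_algl -!scalerAl.
move: bin; rewrite mem_cat !inE (negPf bx) (negPf by_) /= => /orP[br|br].
  have [r3 [r4 [re br3]]] := split_first br; subst r1.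
  have e1 z w : (r3 ++ b :: r4) ++ z :: w :: r2 = r3 ++ b :: (r4 ++ z :: w :: r2).
    by rewrite -catA.
  have [ps' ar'] := prem _ _ (e1 y x) br3.
  have fb' := fb _ _ _ (e1 y x).
  rewrite /= !e1 !earlier_cat // !rem_cat_notin //.
  rewrite !catA in ps' ar' *.
  rewrite size_cat /= in kN.
  have kN1 : (k.+1 + size (r3 ++ r4) + size r2 + 2 <= N.+1)%N.
    by rewrite size_cat; clear -kN; lia.
  have kN2 : (k + size r4 + size r2 + 2 <= N)%N by clear -kN; lia.
  have [//|c c0 e] := IH k.+1 (r3 ++ r4) r2 isT kN1 ps' us1 _ ar' f; first by case: ast.
  exists c => //; rewrite addSn in e.
  rewrite mulrA pull_swap //; last 2 first.
  - by apply: fb'; rewrite mem_cat mem_head orbT.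
  - by apply: fb'; rewrite mem_cat !inE eqxx !orbT.
  by rewrite -mulrA e scalerAr.
have [r3 [r4 [re br3]]] := split_first br; subst r2.
have br1 : b \notin r1 ++ y :: x :: r3.
  rewrite !(mem_cat, inE) !negb_or bx by_ br3 /= andbT.
  move: us'0; rewrite cat_uniq => /and3P[_ /hasPn/(_ b) h _].
  by apply: h; rewrite !inE mem_cat mem_head !orbT.
have e1 z w : r1 ++ z :: w :: (r3 ++ b :: r4) = (r1 ++ z :: w :: r3) ++ b :: r4.
  by rewrite -catA.
have br1' : b \notin r1 ++ x :: y :: r3 by rewrite -(mem_swap r1 r3 x y).
have [ps' ar'] := prem _ _ (e1 y x) br1.
rewrite /= !e1 !earlier_cat // !rem_cat_notin // -!catA /= in ps' ar' *.
rewrite size_cat /= addnS in kN kN0 *.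
have kN1 : (k.+1 + size r1 + size (r3 ++ r4) + 2 <= N.+1)%N.
  by rewrite size_cat; clear -kN; lia.
have kN2 : (k + size r4 < (k + (size r3 + size r4)).+1)%N by clear; lia.
have kN3 : ((k + (size r3 + size r4)).+1 < N)%N by clear -kN; lia.
have [//|c c0 e] := IH k.+1 r1 (r3 ++ r4) isT kN1 ps' us1 _ ar' f; first by case: ast.
exists c => //; rewrite size_cat addSn in e.
by rewrite !addnS mulrA factor_pull_comm // -mulrA e scalerAr.
Qed.

End Transport.

(** * The left ideal of a value *)

Lemma count_lt (I : eqType) (P Q : pred I) (s : seq I) x :
    (forall t, P t -> Q t) -> x \in s -> Q x -> ~~ P x -> (count P s < count Q s)%N.
Proof.
move=> PQ xs Qx nPx; have le : (count P (rem x s) <= count Q (rem x s))%N.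
  exact: sub_count.
by rewrite !(permP (perm_to_rem xs)) /= Qx (negPf nPx) add0n add1n ltnS.
Qed.

Section LeftIdealOfValue.
Variables (K : fieldType) (q : K) (A : algType K) (T : nat -> A) (N : nat).
Hypotheses (HT : hecke_family q T N) (q0 : q != 0)
  (qn : forall m, (0 < m)%N -> q ^+ m != 1).
Implicit Types (r s : seq cell) (b x y u : cell) (k : nat).
Local Notation a := (arg q (@all_one K)).
Local Notation F k x y := (factor q T k (a x) (a y)).
Local Notation g x y := (unitarity q (a x) (a y)).
Local Notation fusion_value := (fusion_value q T).

Variable r0 : seq cell.
Hypotheses (sr0 : std r0) (r0N : size r0 = N).

Definition tableau r := std r && perm_eq r r0.

(** The seminormal vectors in the left ideal of the value of r0. *)
Definition tableau_vec r : A := transport q T 1 (rev r0) r * fusion_value r0.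

Lemma transport_self k s : uniq s -> transport q T k s (rev s) = 1.
Proof.
elim: s k => //= b s IH k /andP[bs us]; rewrite rev_cons -cats1.
rewrite earlier_cat ?mem_rev // rem_cat_notin ?mem_rev //.
by rewrite cats0 IH // mulr1.
Qed.

Lemma tableau_vec_r0 : tableau_vec r0 = fusion_value r0.
Proof.
have := @transport_self 1 (rev r0); rewrite revK rev_uniq /tableau_vec => ->.
  by rewrite mul1r.
exact: std_uniq.
Qed.

Lemma tableau_size r : tableau r -> size r = N.
Proof. by case/andP => _ /perm_size ->. Qed.

Lemma tableau_vec_swap r1 x y r2 : tableau (r1 ++ y :: x :: r2) -> apart x y ->
  exists2 c : K, c != 0 &
    F (size r2).+1 y x * tableau_vec (r1 ++ y :: x :: r2) = c *: tableau_vec (r1 ++ x :: y :: r2).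
Proof.
move=> tr f; have sN := tableau_size tr; case/andP: tr => s p.
have sN' : (1 + size r1 + size r2 + 2 <= N.+1)%N.
  by move: sN; rewrite size_cat /= => <-; clear; lia.
have [|||||c c0] := @transport_swap K q A T N HT q0 qn 1 (rev r0) r1 x y r2 isT sN'.
- by rewrite perm_sym (perm_trans p) // perm_sym perm_rev.
- by rewrite rev_uniq std_uniq.
- by rewrite revK; exact: std_pairwise.
- exact: std_pairwise.
- exact: f.
by rewrite add1n => e; exists c; rewrite // /tableau_vec mulrA e scalerAl.
Qed.

Lemma tableau_swap r1 x y r2 : tableau (r1 ++ y :: x :: r2) -> apart x y ->
  tableau (r1 ++ x :: y :: r2).
Proof.
case/andP => s p f; rewrite /tableau (std_swap s f).
by rewrite (perm_trans _ p) //; exact: perm_swap.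
Qed.

(** Sorting with respect to the position in r0, which is itself standard. *)
Lemma tableau_ind (Q : seq cell -> Prop) : Q r0 ->
    (forall r1 x y r2, tableau (r1 ++ y :: x :: r2) -> apart x y ->
       Q (r1 ++ x :: y :: r2) -> Q (r1 ++ y :: x :: r2)) ->
  forall r, tableau r -> Q r.
Proof.
move=> Q0 Qs r /andP[sr pr]; pose k x := (size r0 - index x r0)%N.
have later x y : x \in r0 -> y \in r0 -> le_cell x y -> (k x <= k y)%N.
  move=> xr yr le; apply: leq_sub2l; rewrite leqNgt; apply/negP => lt.
  have [i1 i2] : (index x r0 < size r0)%N /\ (index y r0 < size r0)%N.
    by rewrite !index_mem.
  have /pairwiseP/(_ _ _ i1 i2 lt) := std_pairwise sr0.
  by move/(_ (0, 0)%N); rewrite !nth_index // le.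
have tr : transitive (fun y x => k x <= k y)%N.
  by move=> y x z xy yz; apply: leq_trans yz xy.
have so0 : sorted (fun y x => k x <= k y)%N r0.
  rewrite sorted_pairwise //; apply/(pairwiseP (0, 0)%N) => i j i1 j1 ij.
  by rewrite /k !index_uniq ?std_uniq //; apply: leq_sub2l; exact: ltnW.
apply: (std_sort_ind (key := k) (r0 := r0)) => //.
- by move=> x xr xr'; apply: later => //; rewrite /le_cell /= leqnn leqnSn.
- by move=> x xr xr'; apply: later => //; rewrite /le_cell /= leqnn leqnSn.
- move=> r' sr' pr' so; suff -> : r' = r0 by [].
  apply: (sorted_eq_in _ _ so so0 pr'); first by move=> ? ? ? _ _ _; exact: tr.
  move=> x y; rewrite !(perm_mem pr') => xr yr; rewrite -eqn_leq => /eqP e.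
  have i1 : (index x r0 < size r0)%N by rewrite index_mem.
  have i2 : (index y r0 < size r0)%N by rewrite index_mem.
  have ie : index x r0 = index y r0 by move: e i1 i2; rewrite /k; lia.
  by rewrite -(nth_index (0, 0)%N xr) ie nth_index.
- by move=> r1 x y r2 s p f s'; apply: Qs => //; rewrite /tableau s p.
Qed.

(** Right multiples of the value of r inherit its behaviour under T_k on the left. *)
Lemma tableau_vec_value r : tableau r -> exists X, tableau_vec r = fusion_value r * X.
Proof.
move: r; apply: tableau_ind; first by exists 1; rewrite tableau_vec_r0 mulr1.
move=> r1 x y r2 tr f [X e]; have tr' := tableau_swap tr f.
have [c c0] := tableau_vec_swap tr' (etrans (apart_sym y x) f); rewrite e mulrA.
have [s' _] := andP tr'.
rewrite (fusion_value_swap HT q0 qn s') ?(tableau_size tr') 1?apart_sym // => e'.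
exists (c^-1 *: (F (size r1).+1 y x * X)).
by rewrite -scalerAr mulrA e' scalerA mulVf // scale1r.
Qed.

Lemma tableau_vec_right r1 x r2 : tableau (r1 ++ right_of x :: x :: r2) ->
  T (size r2).+1 * tableau_vec (r1 ++ right_of x :: x :: r2) =
  q *: tableau_vec (r1 ++ right_of x :: x :: r2).
Proof.
move=> tr; have [X ->] := tableau_vec_value tr; case/andP: (tr) => s _.
by rewrite mulrA (fusion_value_right HT q0 qn) ?(tableau_size tr) // scalerAl.
Qed.

Lemma tableau_vec_below r1 x r2 : tableau (r1 ++ below x :: x :: r2) ->
  T (size r2).+1 * tableau_vec (r1 ++ below x :: x :: r2) =
  - q^-1 *: tableau_vec (r1 ++ below x :: x :: r2).
Proof.
move=> tr; have [X ->] := tableau_vec_value tr; case/andP: (tr) => s _.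
by rewrite mulrA (fusion_value_below HT q0 qn) ?(tableau_size tr) // scalerAl.
Qed.

Lemma tableau_step r1 y x r2 : tableau (r1 ++ y :: x :: r2) ->
  [\/ y = right_of x, y = below x | apart x y].
Proof.
case/andP => s _; have s2 := std_catr s.
have [|nr] := eqVneq y (right_of x); first by constructor 1.
have [|nb] := eqVneq y (below x); first by constructor 2.
by constructor 3; exact: std_apart s2 nr nb.
Qed.

(** Normalised so that the first element is 1, and indexed from 0. *)
Fixpoint jucys_murphy k : A := if k is k'.+1 then T k * jucys_murphy k' * T k else 1.

(** Induction on k over all orderings at once.  For neighbours the relation
    T_k m = th m multiplies the eigenvalue by th^2; otherwise the induction
    hypothesis for the interchanged ordering is used. *)
Lemma jucys_murphy_vec r1 x r2 : tableau (r1 ++ x :: r2) ->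
  jucys_murphy (size r2) * tableau_vec (r1 ++ x :: r2) = a x *: tableau_vec (r1 ++ x :: r2).
Proof.
elim: r2 r1 x => [|x r2 IH] r1 y tr.
  have -> : y = (0, 0)%N.
    by case/andP: tr => /std_catr + _; case: (y) => [[|i] [|j]].
  by rewrite mul1r arg1E /cell_content subrr mulr0 scale1r.
have sN := tableau_size tr; rewrite size_cat /= in sN.
have kN : (0 < (size r2).+1 < N)%N by rewrite -sN; clear; lia.
have IHr : jucys_murphy (size r2) * tableau_vec (r1 ++ y :: x :: r2) = a x *: tableau_vec (r1 ++ y :: x :: r2).
  by have := IH (rcons r1 y) x; rewrite cat_rcons; apply.
rewrite /= -!mulrA; case: (tableau_step tr) => [e|e|f].
- rewrite e in tr IHr *; rewrite tableau_vec_right // -scalerAr IHr scalerA -scalerAr tableau_vec_right //.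
  rewrite scalerA !arg1E; congr (_ *: _); rewrite mulrAC -expr2.
  case: (x) => i j; rewrite /right_of /cell_content /=.
  have -> : 2 * (j.+1%:Z - i%:Z) = 2 + 2 * (j%:Z - i%:Z) by lia.
  by rewrite expfzDr.
- rewrite e in tr IHr *; rewrite tableau_vec_below // -scalerAr IHr scalerA -scalerAr tableau_vec_below //.
  rewrite scalerA !arg1E; congr (_ *: _); rewrite mulrAC -expr2 sqrrN exprVn.
  case: (x) => i j; rewrite /below /cell_content /=.
  have -> : 2 * (j%:Z - i.+1%:Z) = - 2%:Z + 2 * (j%:Z - i%:Z) by lia.
  by rewrite expfzDr // exprnN.
have [c c0 e] := tableau_vec_swap tr f; have tr' := tableau_swap tr f.
have IHs : jucys_murphy (size r2) * tableau_vec (r1 ++ x :: y :: r2) = a y *: tableau_vec (r1 ++ x :: y :: r2).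
  by have := IH (rcons r1 x) y; rewrite cat_rcons; apply.
set m := tableau_vec _ in e IHr *; set m' := tableau_vec _ in e IHs.
set t := T _; set bt := beta q (a y) (a x).
have tm : t * m = c *: m' - bt *: m.
  by rewrite -e /factor mulrDl mulr_algl addrK.
have cm : c *: m' = t * m + bt *: m by rewrite tm subrK.
(* T_k J T_k m, where J is the previous Jucys-Murphy element, with m' eliminated
   in favour of T_k m after J has been applied. *)
rewrite tm mulrBr -!scalerAr IHs IHr scalerA [c * _]mulrC -scalerA cm.
rewrite mulrBr -!scalerAr mulrDr mulrA (T_quad HT q0) //.
rewrite mulrDl mul1r -!scalerAl -!scalerAr.
have xy : a x - a y != 0.
  by rewrite subr_eq0 (arg1_eq q0 qn); apply/eqP/apart_content.
have btE : bt = (q - q^-1) * a y / (a x - a y) by rewrite /bt betaE // arg1_neq0.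
rewrite !scalerDr !scalerA addrAC -!addrA [X in _ + X]addrC.
rewrite -scaleNr !addrA -!scalerDl.
have -> : a y * (q - q^-1) + - (bt * a x) + a y * bt = 0.
  by rewrite btE; move: (q - q^-1) => d; field.
by rewrite scale0r add0r.
Qed.

(** At the first difference two orderings add two distinct corners to the same
    diagram, and distinct addable corners have different contents. *)
Lemma weight_neq (s s' : seq cell) : std s -> std s' -> size s = size s' -> s != s' ->
  exists r1 x r1' x' r2, [/\ s = r1 ++ x :: r2, s' = r1' ++ x' :: r2 & a x != a x'].
Proof.
elim: s s' => [|b s IH] [|b' s'] //= /andP[ab ss] /andP[ab' ss'] [sz].
have [e ne|ne _] := eqVneq s s'; last first.
  have [r1 [x [r1' [x' [r2 [-> -> h]]]]]] := IH _ ss ss' sz ne.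
  by exists (b :: r1), x, (b' :: r1'), x', r2.
subst s'; have bb : b != b' by apply: contraNneq ne => ->.
exists [::], b, [::], b', s; split=> //.
by rewrite (arg1_eq q0 qn); apply/eqP/apart_content; exact: (addable_apart ss).
Qed.

Definition weight j r : K := a (nth (0, 0)%N (rev r) j).

Lemma weight_cat r1 x r2 : weight (size r2) (r1 ++ x :: r2) = a x.
Proof.
rewrite /weight rev_cat rev_cons cat_rcons nth_cat size_rev ltnn subnn.
by [].
Qed.

Lemma weight_sep r r' : std r -> std r' -> size r = size r' -> r != r' ->
  exists2 j, (j < size r)%N & weight j r != weight j r'.
Proof.
move=> sr sr' e ne; have [r1 [x [r1' [x' [r2 [-> -> h]]]]]] := weight_neq sr sr' e ne.
exists (size r2); last by rewrite !weight_cat.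
by rewrite size_cat /= addnS ltnS leq_addl.
Qed.

Lemma split_level r j : (j < size r)%N -> exists r1 x r2, r = r1 ++ x :: r2 /\ size r2 = j.
Proof.
move=> jr; exists (take (size r - j.+1) r), (nth (0, 0)%N r (size r - j.+1)),
  (drop (size r - j.+1).+1 r); split.
  by rewrite -drop_nth ?cat_take_drop //; lia.
by rewrite size_drop; lia.
Qed.

Lemma jucys_murphy_weight r j : tableau r -> (j < N)%N -> jucys_murphy j * tableau_vec r = weight j r *: tableau_vec r.
Proof.
move=> tr jN; have [|r1 [x [r2 [e <-]]]] := @split_level r j; first by rewrite tableau_size.
by rewrite e in tr *; rewrite weight_cat jucys_murphy_vec.
Qed.

Definition tableaux := [seq r <- permutations r0 | std r].

Lemma mem_tableaux r : (r \in tableaux) = tableau r.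
Proof. by rewrite mem_filter mem_permutations. Qed.

Lemma tableaux_uniq : uniq tableaux.
Proof. by apply: filter_uniq; exact: permutations_uniq. Qed.

Definition comb (al : seq cell -> K) : A := \sum_(r <- tableaux) al r *: tableau_vec r.

Lemma comb_mvec r : tableau r -> comb (fun s => (s == r)%:R) = tableau_vec r.
Proof.
rewrite -mem_tableaux => tr; rewrite /comb (bigD1_seq r) ?tableaux_uniq //= eqxx scale1r.
by rewrite big1 ?addr0 // => s /negPf ->; rewrite scale0r.
Qed.

Lemma jucys_murphy_comb al j : (j < N)%N -> jucys_murphy j * comb al = comb (fun r => al r * weight j r).
Proof.
move=> jN; rewrite /comb mulr_sumr; apply: eq_big_seq => r.
by rewrite mem_tableaux => tr; rewrite -scalerAr jucys_murphy_weight // scalerA.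
Qed.

Lemma combB al be c : comb al - c *: comb be = comb (fun r => al r - c * be r).
Proof.
rewrite /comb scaler_sumr -sumrB; apply: eq_bigr => r _.
by rewrite scalerBl scalerA.
Qed.

Definition generated : Prop := forall W : A -> Prop,
  (forall u v : A, W u -> W v -> W (u + v)) -> (forall (c : K) (u : A), W u -> W (c *: u)) ->
  (forall k (u : A), (0 < k < N)%N -> W u -> W (T k * u)) ->
  forall h u : A, W u -> W (h * u).

(** A generator takes the vector of an ordering to a combination of this vector and of
    the one for the interchanged ordering, or to a multiple if there is none. *)
Lemma comb_span h : generated -> exists al, h * fusion_value r0 = comb al.
Proof.
move=> gen; pose W (u : A) := exists al, u = comb al.
have WD (u v : A) : W u -> W v -> W (u + v).
  move=> [al ->] [be ->]; exists (fun r => al r + be r).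
  by rewrite /comb -big_split; apply: eq_bigr => r _; rewrite scalerDl.
have WZ (c : K) (u : A) : W u -> W (c *: u).
  move=> [al ->]; exists (fun r => c * al r).
  by rewrite /comb scaler_sumr; apply: eq_bigr => r _; rewrite scalerA.
have Wm r : tableau r -> W (tableau_vec r).
  by move=> tr; exists (fun s => (s == r)%:R); rewrite comb_mvec.
apply: (gen W WD WZ); last first.
  by rewrite -tableau_vec_r0; apply: Wm; rewrite /tableau sr0 perm_refl.
move=> k u kN [al ->]; rewrite /comb mulr_sumr big_seq.
apply: (big_ind W) => //.
  by exists (fun=> 0); rewrite /comb big1 // => r _; rewrite scale0r.
move=> r; rewrite mem_tableaux => tr; rewrite -scalerAr; apply: (WZ).
case: k kN => // k /= kN.
have [|r1 [x [r2 [e sz]]]] := @split_level r k; first by rewrite tableau_size // ltnW.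
have [r1' [y e1]] : exists r1' y, r1 = rcons r1' y.
  case/lastP: r1 e => [e|r1' y _]; last by exists r1', y.
  by have := tableau_size tr; rewrite e /= sz; move: kN => /[swap] -> ; rewrite ltnn.
rewrite {}e1 cat_rcons in e; rewrite {}e in tr *.
rewrite -sz; case: (tableau_step tr) => [e|e|f].
- by rewrite e in tr *; rewrite tableau_vec_right //; apply: WZ; exact: Wm.
- by rewrite e in tr *; rewrite tableau_vec_below //; apply: WZ; exact: Wm.
have [c c0] := tableau_vec_swap tr f; rewrite /factor mulrDl mulr_algl => e.
have -> : T (size r2).+1 * tableau_vec (r1' ++ y :: x :: r2) =
   c *: tableau_vec (r1' ++ x :: y :: r2) + - beta q (a y) (a x) *: tableau_vec (r1' ++ y :: x :: r2).
  by rewrite -e scaleNr addrK.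
by apply: WD; apply: WZ; apply: Wm => //; exact: tableau_swap tr f.
Qed.

Section Submodule.
Variable S : A -> Prop.
Hypotheses (SD : forall u v : A, S u -> S v -> S (u + v))
  (SM : forall h u : A, S u -> S (h * u)).

Lemma submodule_scale (c : K) (u : A) : S u -> S (c *: u).
Proof. by rewrite -mulr_algl; exact: SM. Qed.

(** As long as two coefficients are nonzero, a Jucys-Murphy element with different
    eigenvalues kills one of them and preserves the other. *)
Lemma submodule_isolate al r : S (comb al) -> tableau r -> al r != 0 ->
  exists2 r', tableau r' & S (tableau_vec r').
Proof.
have [n] := ubnP (count (fun s => al s != 0) tableaux).
elim: n al => // n IH al cn Sc tr ar.
have [/hasP[r' r't /andP[rr' ar']]|/hasPn no] :=
    boolP (has (fun s => (s != r) && (al s != 0)) tableaux); last first.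
  exists r => //; have := submodule_scale (al r)^-1 Sc.
  rewrite /comb (bigD1_seq r) ?mem_tableaux ?tableaux_uniq //= big1_seq ?addr0.
    by rewrite scalerA mulVf // scale1r.
  move=> s /andP[sr st]; have := no s st; rewrite sr /= negbK => /eqP ->.
  by rewrite scale0r.
rewrite mem_tableaux in r't; have [s _] := andP tr; have [s' _] := andP r't.
have sz : size r = size r' by rewrite !tableau_size.
have [j jN wj] : exists2 j, (j < size r)%N & weight j r != weight j r'.
  by apply: weight_sep => //; rewrite eq_sym.
rewrite tableau_size // in jN.
pose be s := al s * weight j s - weight j r' * al s.
have Sb : S (comb be).
  rewrite -combB -jucys_murphy_comb // -scaleNr; apply: SD; first exact: SM.
  exact: submodule_scale.
have beE t : be t = al t * (weight j t - weight j r') by rewrite /be; ring.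
apply: (IH be _ Sb tr); last by rewrite beE mulf_neq0 // subr_eq0.
rewrite -ltnS; apply: leq_trans cn; rewrite ltnS.
apply: (count_lt (x := r')) => [t|||].
- by rewrite beE mulf_eq0 negb_or => /andP[].
- by rewrite mem_tableaux.
- exact: ar'.
- by rewrite beE subrr mulr0 eqxx.
Qed.

Lemma submodule_connected r : tableau r -> S (tableau_vec r) -> S (tableau_vec r0).
Proof.
move: r; apply: tableau_ind => // r1 x y r2 tr f IH Sr; apply: IH.
have [c c0 e] := tableau_vec_swap tr f.
have := submodule_scale c^-1 (SM (F (size r2).+1 y x) Sr).
by rewrite e scalerA mulVf // scale1r.
Qed.

Lemma submodule_full h : generated -> S (h * fusion_value r0) -> h * fusion_value r0 != 0 -> S (fusion_value r0).
Proof.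
move=> gen; have [al ->] := comb_span h gen => Sc c0.
have /hasP[r] : has (fun r => al r != 0) tableaux.
  apply: contraNT c0 => /hasPn al0; apply/eqP/big1_seq => r /andP[_ /al0].
  by rewrite negbK => /eqP ->; rewrite scale0r.
rewrite mem_tableaux => tr ar; have [r' tr' Sr'] := submodule_isolate Sc tr ar.
by rewrite -tableau_vec_r0; exact: submodule_connected tr' Sr'.
Qed.

End Submodule.

(** The weight of a tableau s of another shape differs from all weights of the ideal,
    so the terms of a combination with that weight can be removed one by one. *)
Lemma weight_zero (s : seq cell) h : generated -> std s -> size s = N -> ~~ tableau s ->
  (forall j, (j < N)%N -> jucys_murphy j * (h * fusion_value r0) = weight j s *: (h * fusion_value r0)) ->
  h * fusion_value r0 = 0.
Proof.
move=> gen ss sN ns; have [al ->] := comb_span h gen.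
have [n] := ubnP (count (fun s => al s != 0) tableaux).
elim: n al => // n IH al cn w.
have [/hasP[r rt ar]|/hasPn no] := boolP (has (fun r => al r != 0) tableaux); last first.
  apply: big1_seq => r /andP[_ /no].
  by rewrite negbK => /eqP ->; rewrite scale0r.
have tr : tableau r by rewrite -mem_tableaux.
have [j jN wj] : exists2 j, (j < size s)%N & weight j s != weight j r.
  apply: weight_sep => //; first by case/andP: tr.
    by rewrite sN (tableau_size tr).
  by apply: contraNneq ns => ->.
rewrite sN in jN; pose be t := al t * weight j t - weight j r * al t.
have beE t : be t = al t * (weight j t - weight j r) by rewrite /be; ring.
have cE : comb be = (weight j s - weight j r) *: comb al.
  by rewrite -combB -jucys_murphy_comb // w // scalerBl.
have : comb be = 0.
  apply: IH.
    rewrite -ltnS; apply: leq_trans cn; rewrite ltnS.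
    apply: (count_lt (x := r)) => [t|||]; first by rewrite beE mulf_eq0 negb_or => /andP[].
    - exact: rt.
    - exact: ar.
    - by rewrite beE subrr mulr0 eqxx.
  move=> i iN; rewrite cE -scalerAr w // !scalerA; congr (_ *: _).
  by rewrite mulrC.
rewrite cE => /eqP; rewrite scaler_eq0 subr_eq0 (negPf wj) => /eqP //.
Qed.

End LeftIdealOfValue.

(** * A nonzero coefficient *)

(** H_n acts on functions of words w(0) w(1) ..., T_k by the R-matrix at the
    positions k-1 and k.  On increasing letters it is a plain interchange, so the
    longest permutation takes the identity word to the decreasing one, and no
    shorter product does. *)
Section Words.
Variables (K : fieldType) (q : K).
Hypothesis q0 : q != 0.
Notation word := (nat -> nat).
Implicit Types (w : word) (f : word -> K) (i j : nat).

Definition wswap i w : word :=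
  fun j => if j == i then w i.+1 else if j == i.+1 then w i else w j.

Definition wgen i f : word -> K := fun w =>
  if w i == w i.+1 then q * f w
  else if (w i < w i.+1)%N then f (wswap i w)
  else f (wswap i w) + (q - q^-1) * f w.

Lemma wswapK i w : wswap i (wswap i w) = w.
Proof.
have e : (i.+1 == i) = false by apply/eqP; lia.
apply: funext => j; rewrite /wswap !eqxx e.
by case: eqP => [->//|_]; case: eqP => [->|].
Qed.

Lemma wswap_l i w : wswap i w i = w i.+1.
Proof. by rewrite /wswap eqxx. Qed.

Lemma wswap_r i w : wswap i w i.+1 = w i.
Proof. by rewrite /wswap eqxx (_ : (i.+1 == i) = false) //; apply/eqP; lia. Qed.

Lemma wgen_quad i f w : wgen i (wgen i f) w = (q - q^-1) * wgen i f w + f w.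
Proof.
rewrite /wgen wswap_l wswap_r wswapK; case: (ltngtP (w i) (w i.+1)) => _ //.
- by rewrite addrC.
- ring.
- by field.
Qed.

(** A word with its three letters at i, i+1, i+2 made explicit reduces the braid
    relation to a case analysis on the order of three numbers. *)
Definition upd w i (a b c : nat) : word := fun j =>
  if j == i then a else if j == i.+1 then b else if j == i.+2 then c else w j.

Lemma upd_id w i : w = upd w i (w i) (w i.+1) (w i.+2).
Proof. by apply: funext => j; rewrite /upd; do ![case: eqP => [->//|_]]. Qed.

Section Braid.
Variables (w : word) (i : nat).

Lemma upd0 a b c : upd w i a b c i = a. Proof. by rewrite /upd eqxx. Qed.
Lemma upd1 a b c : upd w i a b c i.+1 = b.
Proof. by rewrite /upd eqxx ifF //; apply/eqP; lia. Qed.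
Lemma upd2 a b c : upd w i a b c i.+2 = c.
Proof. by rewrite /upd eqxx !ifF //; apply/eqP; lia. Qed.

Lemma wswap_upd0 a b c : wswap i (upd w i a b c) = upd w i b a c.
Proof.
by apply: funext => j; rewrite /wswap upd0 upd1 /upd; do ![case: eqP => // _].
Qed.
Lemma wswap_upd1 a b c : wswap i.+1 (upd w i a b c) = upd w i a c b.
Proof.
apply: funext => j; rewrite /wswap upd1 upd2 /upd.
by do ![case: eqP => //= ?]; lia.
Qed.

Lemma wgen_braid f : wgen i (wgen i.+1 (wgen i f)) w = wgen i.+1 (wgen i (wgen i.+1 f)) w.
Proof.
rewrite (upd_id w i); move: (w i) (w i.+1) (w i.+2) => a b c.
rewrite /wgen !(wswap_upd0, wswap_upd1, upd0, upd1, upd2).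
case: (ltngtP a b) => ab; case: (ltngtP b c) => bc; case: (ltngtP a c) => ac //;
  try (exfalso; lia); try subst b; try subst c; try subst a; rewrite ?eqxx ?ltnn;
  try (by []); try (by ring); by field.
Qed.
End Braid.

Lemma wswap_out i j w : j != i -> j != i.+1 -> wswap i w j = w j.
Proof. by rewrite /wswap => /negPf -> /negPf ->. Qed.

Lemma wgen_comm i j f w : (i.+1 < j)%N -> wgen i (wgen j f) w = wgen j (wgen i f) w.
Proof.
move=> ij.
have e1 : wswap i w j = w j by apply: wswap_out; lia.
have e2 : wswap i w j.+1 = w j.+1 by apply: wswap_out; lia.
have e3 : wswap j w i = w i by apply: wswap_out; lia.
have e4 : wswap j w i.+1 = w i.+1 by apply: wswap_out; lia.
have e5 : wswap j (wswap i w) = wswap i (wswap j w).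
  apply: funext => l; rewrite /wswap.
  by do ![case: eqP => //= ?]; lia.
rewrite /wgen e1 e2 e3 e4 e5.
by case: (ltngtP (w i)) => _; case: (ltngtP (w j)) => _; ring.
Qed.

Lemma wgen_lin i c f g : wgen i (fun w => c * f w + g w) = fun w => c * wgen i f w + wgen i g w.
Proof. by apply: funext => w; rewrite /wgen; case: ifP => _; [|case: ifP => _]; ring. Qed.

Variable n : nat.
Notation H := (hecke q n).

Fixpoint term_act (x : hterm K n) f : word -> K :=
  match x with
  | HGen i => wgen i f
  | HScal c => fun w => c * f w
  | HAdd x y => fun w => term_act x f w + term_act y f w
  | HMul x y => term_act x (term_act y f)
  end.

Lemma term_act_lin x c f g : term_act x (fun w => c * f w + g w) = fun w => c * term_act x f w + term_act x g w.
Proof.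
elim: x f g => [i|a|x IHx y IHy|x IHx y IHy] f g /=.
- exact: wgen_lin.
- by apply: funext => w; ring.
- by apply: funext => w; rewrite IHx IHy; ring.
- by rewrite IHy IHx.
Qed.

Lemma term_act_heq x y : heq q x y -> forall f, term_act x f = term_act y f.
Proof.
elim=> {x y} //=.
- by move=> x y z _ h _ h' f; rewrite h h'.
- by move=> x x' y y' _ hx _ hy f; rewrite hx hy.
- by move=> x x' y y' _ hx _ hy f; rewrite hy hx.
- by move=> x y z f; apply: funext => w; ring.
- by move=> x y f; apply: funext => w; ring.
- by move=> x f; apply: funext => w; ring.
- by move=> x f; apply: funext => w; ring.
- by move=> x f; apply: funext => w; ring.
- move=> x y z f; have := term_act_lin x 1 (term_act y f) (term_act z f).
  have -> : (fun w => 1 * term_act y f w + term_act z f w) = (fun w => term_act y f w + term_act z f w).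
    by apply: funext => w; rewrite mul1r.
  by move=> ->; apply: funext => w; rewrite mul1r.
- by move=> a b f; apply: funext => w; ring.
- by move=> a b f; apply: funext => w; ring.
- move=> a x f; have := term_act_lin x a f (fun=> 0).
  have h0 : term_act x (fun=> 0) = fun=> 0.
    have := term_act_lin x (-1) (fun=> 0) (fun=> 0).
    have -> : (fun _ : word => -1 * 0 + 0 : K) = (fun=> 0) by apply: funext => w; ring.
    by move=> e; apply: funext => w; rewrite e; ring.
  rewrite h0; have -> : (fun w => a * f w + 0) = (fun w => a * f w).
    by apply: funext => w; rewrite addr0.
  by move=> ->; apply: funext => w; rewrite addr0.
- move=> i f; apply: funext => w.
  have -> : (fun w0 => wgen i f w0 + q^-1 * f w0) = (fun w0 => q^-1 * f w0 + wgen i f w0).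
    by apply: funext => w0; rewrite addrC.
  by rewrite wgen_lin wgen_quad; field.
- by move=> i j -> f; apply: funext => w; rewrite wgen_braid.
- move=> i j ne1 ne2 ne3 f; apply: funext => w.
  have [lt|lt] : (i.+1 < j)%N \/ (j.+1 < i)%N by lia.
    exact: wgen_comm.
  by rewrite -wgen_comm.
Qed.

Definition act (h : H) f := term_act (repr h) f.

Lemma actE x f : act (hcl q x) f = term_act x f.
Proof. by apply: term_act_heq; exact: heq_repr. Qed.

Lemma actM h g f : act (h * g) f = act h (act g f).
Proof.
elim/hcl_ind: h => x; elim/hcl_ind: g => y.
by rewrite hclM !actE.
Qed.

Lemma actD h g f : act (h + g) f = fun w => act h f w + act g f w.
Proof.
elim/hcl_ind: h => x; elim/hcl_ind: g => y.
by rewrite hclD !actE.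
Qed.

Lemma act1 f : act 1 f = f.
Proof. by rewrite -hclE1 actE; apply: funext => w /=; rewrite mul1r. Qed.

Lemma actZ c h f : act (c *: h) f = fun w => c * act h f w.
Proof. by elim/hcl_ind: h => x; rewrite hclZ !actE. Qed.

Lemma act_lin h c f g : act h (fun w => c * f w + g w) = fun w => c * act h f w + act h g w.
Proof. exact: term_act_lin. Qed.

Lemma act_zero h : act h (fun=> 0) = fun=> 0.
Proof.
have := act_lin h (-1) (fun=> 0) (fun=> 0).
have -> : (fun _ : word => -1 * 0 + 0 : K) = (fun=> 0) by apply: funext => w; ring.
by move=> e; apply: funext => w; rewrite e; ring.
Qed.

Lemma act_T k f : (k.+1 < n)%N -> act (heckeT q n k.+1) f = wgen k f.
Proof.
move=> kn; rewrite /heckeT; have kn' : (k < n.-1)%N by lia.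
by rewrite insubT /= actE.
Qed.

Notation F := (factor q (heckeT q n)).

Lemma act_factor k x y f : (k.+1 < n)%N ->
  act (F k.+1 x y) f = fun w => wgen k f w + beta q x y * f w.
Proof.
move=> kn; rewrite actD act_T // actZ act1.
by [].
Qed.

Definition local (D : word -> Prop) (h : H) : Prop := forall f g,
  (forall w, D w -> f w = g w) -> forall w, D w -> act h f w = act h g w.

Lemma local1 D : local D 1.
Proof. by move=> f g fg w Dw; rewrite !act1 fg. Qed.

Lemma localM D h g : local D h -> local D g -> local D (h * g).
Proof.
move=> hh hg f f' ff w Dw; rewrite !actM; apply: hh Dw => w' Dw'.
exact: hg.
Qed.

Lemma local_factor (D : word -> Prop) k x y : (k.+1 < n)%N ->
  (forall w, D w -> D (wswap k w)) -> local D (F k.+1 x y).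
Proof.
move=> kn Dk f g fg w Dw; rewrite !act_factor // fg // /wgen !fg //; exact: Dk.
Qed.

Lemma local_append (D : word -> Prop) k r u : (k.+1 + size r <= n)%N ->
  (forall i w, (k <= i < k + size r)%N -> D w -> D (wswap i w)) ->
  local D (append_prod q (heckeT q n) k.+1 r u).
Proof.
elim: r k => [|x r IH] k /= kn Dk; first exact: local1.
apply: localM.
  by apply: IH => [|i w iN]; [lia|apply: Dk; lia].
by apply: local_factor => [|w]; [lia|apply: Dk; lia].
Qed.

Lemma local_fusion (D : word -> Prop) r : (size r <= n)%N ->
  (forall i w, (i.+1 < size r)%N -> D w -> D (wswap i w)) ->
  local D (fusion_prod q (heckeT q n) r).
Proof.
elim: r => [|u r IH] /= rn Dr; first exact: local1.
apply: localM.
  by apply: IH => [|i w iN]; [lia|apply: Dr; lia].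
by apply: local_append => [|i w iN]; [lia|apply: Dr; lia].
Qed.

Definition rotw j w : word := fun i => if i == 0%N then w j else if (i <= j)%N then w i.-1 else w i.

Lemma rotw_swap j w : rotw j (wswap j w) = rotw j.+1 w.
Proof.
apply: funext => -[|i]; first by rewrite /rotw /= wswap_l.
rewrite /rotw /=; case: (ltngtP i j) => ij.
- by rewrite ifT ?wswap_out //; lia.
- by rewrite ifF ?wswap_out //; lia.
- by rewrite ij wswap_r ?ltnS ?leqnn.
Qed.

(** The letter M is larger than those it meets, so every interchange moves it one
    step to the left.  If it stops anywhere before reaching position 0, then f
    vanishes, whatever the scalars beta are. *)
Lemma act_append M r u f w : (size r < n)%N ->
    (forall w i, (0 < i <= size r)%N -> w i = M -> f w = 0) ->
    (forall i, (i < size r)%N -> (w i < M)%N) -> w (size r) = M ->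
  act (append_prod q (heckeT q n) 1 r u) f w = f (rotw (size r) w).
Proof.
elim/last_ind: r w => [|r x IH] w /=.
  move=> _ _ _ _; rewrite act1; congr f; apply: funext => i.
  by rewrite /rotw; case: i.
rewrite size_rcons => rn f0 wM wj.
rewrite -cats1 append_cat /= mul1r add1n actM act_factor //.
set f' := act _ f.
have w1 : (w (size r) == w (size r).+1) = false by rewrite wj ltn_eqF // wM.
have w2 : (w (size r) < w (size r).+1)%N by rewrite wj wM.
(* The letter M is still at its old position, out of reach of the remaining
   factors. *)
have z : f' w = 0.
  pose D (w : word) := w (size r).+1 = M.
  have lD : local D (append_prod q (heckeT q n) 1 r u).
    apply: (@local_append D 0); first by lia.
    by move=> i v iN Dv; rewrite /D wswap_out //; lia.
  rewrite /f' (lD f (fun=> 0)) ?act_zero // => v Dv.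
  by apply: f0 Dv; lia.
rewrite z mulr0 addr0 /wgen w1 w2 /f' IH //.
- by rewrite rotw_swap.
- by lia.
- by move=> v i iN; apply: f0; lia.
- by move=> i iN; rewrite wswap_out; [apply: wM; lia|lia|lia].
- by rewrite wswap_l.
Qed.

Definition decreasing m : word -> K := fun w =>
  (all (fun i => w i == m - i.+1)%N (iota 0 m))%:R.

Lemma decreasing0 m w i : (0 < i <= m)%N -> w i = m -> decreasing m.+1 w = 0.
Proof.
move=> im wi; rewrite /decreasing; case: allP => // h.
by have := h i; rewrite mem_iota wi => /(_ _)/eqP; lia.
Qed.

Lemma decreasing_rot m w : w m = m -> decreasing m.+1 (rotw m w) = decreasing m w.
Proof.
move=> wm; rewrite /decreasing; congr (_%:R); congr nat_of_bool.
apply/allP/allP => h i; rewrite mem_iota => im.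
  have := h i.+1; rewrite mem_iota /rotw /= => /(_ _)/eqP e; apply/eqP.
  by move: e; rewrite ifT; [move=> e; rewrite e; lia|lia].
case: i im => [|i] im; first by rewrite /rotw /= wm subn1.
have := h i; rewrite mem_iota => /(_ _)/eqP e; apply/eqP; rewrite /rotw /=.
by rewrite ifT; [rewrite e; lia|lia].
Qed.

(** By [act_append] the factors of the last entry turn the indicator function for
    m+1 letters into the one for m letters, on words whose letter m is in place;
    the other factors do not move that letter. *)
Lemma act_fusion r : (size r <= n)%N ->
  act (fusion_prod q (heckeT q n) r) (decreasing (size r)) id = 1.
Proof.
elim: r => [|u r IH] /= rn; first by rewrite act1.
pose D (w : word) := (forall i, (i < size r)%N -> (w i < size r)%N) /\ w (size r) = size r.
rewrite actM.
have lD : local D (fusion_prod q (heckeT q n) r).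
  apply: local_fusion; first by lia.
  move=> i w iN [wD wr]; split; last by rewrite wswap_out //; lia.
  by move=> j jr; rewrite /wswap; case: ifP => _; [|case: ifP => _]; apply: wD; lia.
rewrite (lD _ (decreasing (size r))) ?IH //; first lia.
move=> w [wD wr]; rewrite (@act_append (size r)) ?decreasing_rot //.
by move=> v i; exact: decreasing0.
Qed.

End Words.

(** * The Hecke algebra, polynomials and tableaux *)

Section Hecke.
Variables (K : fieldType) (q : K) (n : nat).
Notation T := (heckeT q n).

Lemma heckeT_gen k (kn : (k < n.-1)%N) : T k.+1 = hgen q (Ordinal kn).
Proof. by rewrite /heckeT insubT. Qed.

Lemma hecke_familyT : hecke_family q T n.
Proof.
have [hq hb hc] := hecke_gen_relations q n.
have lt k : (k.+1 < n)%N -> (k < n.-1)%N by lia.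
split=> [[//|k] /andP[_ /lt kn]|[//|k] _ kn|[//|k] [|l] // _ /andP[kl /lt ln]].
- by rewrite heckeT_gen; exact: hq.
- have k1 := lt _ kn; have k0 : (k < n.-1)%N by lia.
  by rewrite !heckeT_gen; exact: hb.
- have k0 : (k < n.-1)%N by lia.
  by rewrite !heckeT_gen; apply: hc => /=; lia.
Qed.

Lemma hecke_generated : generated T n.
Proof.
move=> W WD WZ WT; elim/hcl_ind => x; elim: x => [i|c|x IHx y IHy|x IHx y IHy] u Wu.
- have -> : hcl q (HGen K i) = T i.+1.
    by rewrite heckeT_gen; congr (hgen _ _); apply: val_inj.
  by apply: WT => //; have := ltn_ord i; lia.
- suff -> : hcl q (HScal n c) = c%:A by rewrite mulr_algl; exact: WZ.
  by rewrite -hclE1 hclZ; apply/hclP; rewrite -{1}[c]mulr1; exact: heq_scalM.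
- by rewrite -hclD mulrDl; apply: WD; [exact: IHx|exact: IHy].
- by rewrite -hclM -mulrA; apply: IHx; exact: IHy.
Qed.

End Hecke.

Section Polynomials.
Variables (K : fieldType) (n : nat).
Implicit Types (D V : set ('I_n -> K)) (p z : 'I_n -> K).

(** The identity has to hold also where a denominator vanishes; the factor M makes
    both sides 0 there. *)
Lemma regular_to_value (A : algType K) D V p (f : ('I_n -> K) -> A) v :
    (exists z, V z /\ D z) -> regular (fun z => V z /\ D z) p f v ->
  regular_value D f V p v.
Proof.
move=> ne [g [e [hg he e0 fg vE]]]; split=> //.
pose ev z (P : mpoly.mpoly n K) := mpoly.meval z P.
have evD z P Q : ev z (P + Q) = ev z P + ev z Q by exact: mpoly.mevalD.
have evM z P Q : ev z (P * Q) = ev z P * ev z Q by exact: mpoly.mevalM.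
have evC (k : K) : exists P, forall z, ev z P = k.
  by exists (mpoly.mpolyC n k) => z; exact: mpoly.mevalC.
have evX (i : 'I_n) : exists P, forall z, ev z P = z i.
  by exists (mpoly.mpolyX K (mpoly.mnm1 i)) => z; exact: mpoly.mevalXU.
have [Pe [Qe [Qe0 eE]]] := @ratfun_frac K _ _ ev _ (fun z => z) p evD evM evC evX _ he.
have [P [Q [Q0 gE]]] := @hreg_frac K _ _ ev _ (fun z => z) p evD evM evC evX _ _ hg.
have Pe0 : ev p Pe != 0 by apply: contraNneq e0 => P0; rewrite eE // P0 mul0r.
pose M := Pe * Qe * Q.
have ME z : ev z M != 0 -> [/\ ev z Pe != 0, ev z Qe != 0 & ev z Q != 0].
  by rewrite !evM !mulf_eq0 !negb_or => /andP[/andP[]].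
have M0 : ev p M != 0 by rewrite !evM !mulf_neq0.
have sE z : vmeval z [seq (t.1 * M, t.2) | t <- P] =
    ev z M *: \sum_(t <- P) ev z t.1 *: t.2.
  rewrite /vmeval big_map scaler_sumr; apply: eq_bigr => t _ /=.
  by rewrite -/(ev _ _) evM mulrC scalerA.
exists [seq (t.1 * M, t.2) | t <- P], (M * Q); rewrite -!/(ev _ _).
split; first by rewrite evM mulf_neq0.
- move=> z Vz Dz; rewrite -/(ev _ _) evM sE.
  have [->|Mz] := eqVneq (ev z M) 0; first by rewrite mul0r !scale0r.
  have [Pz Qz Q1] := ME z Mz; rewrite -gE // fg ?scalerA //.
  by rewrite eE // mulf_neq0 ?invr_eq0.
- by rewrite sE -gE // [ev p M *: _]scalerA -evM scalerA mulVf ?scale1r // evM mulf_neq0.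
Qed.

Lemma ratfun_sum (I : Type) (o : I -> K) (J : Type) (r : seq J) (f : J -> (I -> K) -> K) :
  (forall j, ratfun o (f j)) -> ratfun o (fun w => \sum_(j <- r) f j w).
Proof.
move=> hf; elim: r => [|j r IH].
  under eq_fun do rewrite big_nil; exact: rat_const.
under eq_fun do rewrite big_cons; exact: rat_add.
Qed.

Lemma ratfun_prod (I : Type) (o : I -> K) (J : Type) (r : seq J) (f : J -> (I -> K) -> K) :
  (forall j, ratfun o (f j)) -> ratfun o (fun w => \prod_(j <- r) f j w).
Proof.
move=> hf; elim: r => [|j r IH].
  under eq_fun do rewrite big_nil; exact: rat_const.
under eq_fun do rewrite big_cons; exact: rat_mul.
Qed.

Lemma ratfun_exp (I : Type) (o : I -> K) (f : (I -> K) -> K) m :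
  ratfun o f -> ratfun o (fun w => f w ^+ m).
Proof.
move=> hf; elim: m => [|m IH]; first exact: rat_const.
under eq_fun do rewrite exprS; exact: rat_mul.
Qed.

(** Fractions of polynomials are thereby regular functions in the sense above. *)
Lemma ratfun_meval p (P : mpoly.mpoly n K) : ratfun p (fun z => mpoly.meval z P).
Proof.
under eq_fun do rewrite mpoly.mevalE.
apply: ratfun_sum => m; apply: rat_mul; first exact: rat_const.
by apply: ratfun_prod => i; apply: ratfun_exp; exact: rat_coord.
Qed.

Lemma value_to_regular (A : algType K) D V p (f : ('I_n -> K) -> A) v :
  regular_value D f V p v -> regular (fun z => V z /\ D z) p f v.
Proof.
move=> [_ [P [Q [Q0 fE vE]]]].
have hQ := ratfun_meval p Q.
exists (fun z => (mpoly.meval z Q)^-1 *: vmeval z P), (fun z => mpoly.meval z Q).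
split=> //.
- apply: hreg_scale; first exact: rat_inv.
  rewrite /vmeval; elim: P {fE vE} => [|t P IH].
    under eq_fun do rewrite big_nil; exact: hreg_const.
  under eq_fun do rewrite big_cons; apply: hreg_add => //.
  by apply: hreg_scale; [exact: ratfun_meval|exact: hreg_const].
- by move=> z [Vz Dz] Qz; rewrite -fE // scalerA mulVf // scale1r.
Qed.

End Polynomials.

Section Partitions.

Lemma partition_nth lam i j : sorted geq lam -> (i <= j)%N ->
  (nth 0 lam j <= nth 0 lam i)%N.
Proof.
move=> s ij; have [js|js] := ltnP j (size lam); last by rewrite nth_default.
have tr : transitive geq by move=> y x z /= xy yz; exact: leq_trans yz xy.
have := sorted_leq_nth tr leqnn 0%N s; apply=> //.
by rewrite inE; apply: leq_ltn_trans js.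
Qed.

Lemma diagram_closed lam b c : sorted geq lam -> diagram lam b -> le_cell c b -> diagram lam c.
Proof.
rewrite /diagram => s db /andP[h1 h2].
by apply: leq_ltn_trans h2 _; apply: leq_trans db _; exact: partition_nth.
Qed.

Lemma diagram_inj n m lam mu : is_partition n lam -> is_partition m mu ->
  diagram lam =1 diagram mu -> lam = mu.
Proof.
move=> /and3P[_ l0 _] /and3P[_ m0 _] e.
have en i : nth 0%N lam i = nth 0%N mu i.
  apply/eqP; rewrite eqn_leq; apply/andP; split; rewrite leqNgt; apply/negP => h.
    by have := e (i, nth 0%N mu i); rewrite /diagram /= h ltnn.
  by have := e (i, nth 0%N lam i); rewrite /diagram /= h ltnn.
apply: (@eq_from_nth _ 0%N) => // ; apply/eqP; rewrite eqn_leq; apply/andP; split;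
  rewrite leqNgt; apply/negP => h.
  have : nth 0%N lam (size mu) \in lam by exact: mem_nth.
  by rewrite en nth_default // (negPf l0).
have : nth 0%N mu (size lam) \in mu by exact: mem_nth.
by rewrite -en nth_default // (negPf m0).
Qed.

Lemma std_rev (s : seq cell) :
  (forall s1 b s2, s = s1 ++ b :: s2 -> addable b s1) -> std (rev s).
Proof.
elim/last_ind: s => // s x IH h; rewrite rev_rcons /= IH; last first.
  by move=> s1 b s2 e; apply: (h s1 b (rcons s2 x)); rewrite e rcons_cat.
by rewrite andbT (eq_addable _ (mem_rev s)); apply: (h s x [::]); rewrite cats1.
Qed.

Variables (n : nat) (lam : seq nat) (L : std_tableau n lam).
Hypothesis hlam : is_partition n lam.

Definition reading : seq cell := codom L.
Definition reading_rev : seq cell := rev reading.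

Lemma size_reading_rev : size reading_rev = n.
Proof. by rewrite size_rev size_codom card_ord. Qed.

Lemma mem_reading_rev b : (b \in reading_rev) = diagram lam b.
Proof.
rewrite mem_rev; apply/codomP/idP => [[a ->]|/(box_diagram L)[a <-]]; last by exists a.
by apply/(box_diagram L); exists a.
Qed.

Lemma box_lt a b : le_cell (L a) (L b) -> L a != L b ->
  (L a).1 = (L b).1 \/ (L a).2 = (L b).2 -> (a < b)%N.
Proof.
move=> /andP[h1 h2] ne [e|e].
  apply: (box_row e); rewrite ltn_neqAle h2 andbT; apply: contraNneq ne => e2.
  by apply/eqP; move: e e2; case: (L a) (L b) => [? ?] [? ?] /= -> ->.
apply: (box_col e); rewrite ltn_neqAle h1 andbT; apply: contraNneq ne => e2.
by apply/eqP; move: e e2; case: (L a) (L b) => [? ?] [? ?] /= -> ->.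
Qed.

Lemma std_reading_rev : std reading_rev.
Proof.
apply: std_rev => s1 b s2 e.
have us : uniq reading by apply/injectiveP; exact: box_inj.
have sz : size reading = n by rewrite size_codom card_ord.
have s1n : (size s1 < n)%N by rewrite -sz e size_cat /= addnS ltnS leq_addr.
pose i := Ordinal s1n.
have nthE (a : 'I_n) : nth (0, 0)%N reading a = L a.
  by rewrite /reading /codom /image_mem (nth_map a) ?size_enum_ord // nth_ord_enum.
have bi : b = L i.
  by rewrite -nthE e nth_cat ltnn subnn.
have mem1 c : le_cell c b -> c != b -> c.1 = b.1 \/ c.2 = b.2 -> c \in s1.
  move=> cb ne al.
  have : diagram lam c.
    apply: (diagram_closed _ _ cb); first by case/and3P: hlam.
    by apply/(box_diagram L); exists i.
  case/(box_diagram L) => a ac; subst c; rewrite bi in cb ne al.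
  have ai := box_lt cb ne al.
  by rewrite -nthE e nth_cat /= ai; apply: mem_nth.
rewrite /addable; apply/and3P; split.
- by move: us; rewrite e cat_uniq /= => /and3P[_ /norP[]].
- apply/implyP => b0; apply: mem1; rewrite /le_cell /= ?leq_pred ?leqnn //; last by right.
  by apply/eqP => /(congr1 fst) /=; lia.
- apply/implyP => b0; apply: mem1; rewrite /le_cell /= ?leq_pred ?leqnn //; last by left.
  by apply/eqP => /(congr1 snd) /=; lia.
Qed.

End Partitions.

Section Products.
Variables (K : fieldType) (q : K) (A : algType K) (T : nat -> A).

Lemma append_rev k (t : seq K) u :
  append_prod q T k.+1 (rev t) u = \prod_(i < size t) factor q T (k + (size t - i)) t`_i u.
Proof.
elim: t => [|x t IH] /=; first by rewrite big_ord0.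
rewrite rev_cons -cats1 append_cat /= mul1r size_rev big_ord_recl /= subn0 addSnnS IH.
by congr (_ * _); apply: eq_bigr => i _; rewrite subSS.
Qed.

Lemma fusion_rev (t : seq K) :
  fusion_prod q T (rev t) = \prod_(j < size t) \prod_(i < j) factor q T (j - i) t`_i t`_j.
Proof.
elim/last_ind: t => [|t u IH]; first by rewrite big_ord0.
rewrite rev_rcons /= size_rcons big_ord_recr /= IH append_rev; congr (_ * _).
  apply: eq_bigr => j _; apply: eq_bigr => i _; rewrite !nth_rcons.
  by rewrite ltn_ord (ltn_trans (ltn_ord i) (ltn_ord j)).
by apply: eq_bigr => i _; rewrite !nth_rcons ltn_ord ltnn eqxx.
Qed.

Lemma factor_scale (c : K) k x y : c != 0 -> factor q T k (c * x) (c * y) = factor q T k x y.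
Proof.
move=> c0; rewrite /factor /beta; congr (_ + (_ / (_ - _))%:A).
by rewrite invfM mulrACA mulVf // mul1r.
Qed.

End Products.

(** * The fusion element *)

Lemma uniq_map_inj (I J : eqType) (f : I -> J) s : uniq (map f s) -> {in s &, injective f}.
Proof.
elim: s => //= a s IH /andP[fa /IH{}IH] x y; rewrite !inE.
move=> /orP[/eqP ->|xs] /orP[/eqP ->|ys] // e; last exact: IH.
  by move: fa; rewrite e map_f.
by move: fa; rewrite -e map_f.
Qed.

Section Main.
Variables (K : fieldType) (q : K) (n : nat).
Hypotheses (q0 : q != 0) (qn : forall m, (0 < m)%N -> q ^+ m != 1).
Notation H := (hecke q n).
Notation T := (heckeT q n).
Let HT := hecke_familyT q n.

Section SubspaceValue.
Variables (lam : seq nat) (L : std_tableau n lam).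
Hypothesis hlam : is_partition n lam.
Local Notation r := (reading_rev L).
Let sr : std r. Proof. exact: std_reading_rev. Qed.
Let szr : (size r <= n)%N. Proof. by rewrite size_reading_rev. Qed.

(** Parameters of the entries of L as parameters of boxes, divided by the common
    value c, which moves the limit point (c, ..., c) to (1, ..., 1).  The boxes
    outside of the diagram get the dummy value 1. *)
Definition cell_coord (c : K) (b : cell) (z : 'I_n -> K) : K :=
  if [pick i | L i == b] is Some i then c^-1 * z i else 1.

Lemma cell_coordE c z i : cell_coord c (L i) z = c^-1 * z i.
Proof.
rewrite /cell_coord; case: pickP => [j /eqP/(@box_inj _ _ L) -> //|/(_ i)].
by rewrite eqxx.
Qed.

Lemma ratfun_cell_coord p c b : ratfun p (cell_coord c b).
Proof.
rewrite /cell_coord; case: pickP => [i _|_]; last exact: rat_const.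
by apply: rat_mul; [exact: rat_const|exact: rat_coord].
Qed.

Lemma arg_coord c z i : arg q (cell_coord c ^~ z) (L i) = c^-1 * fusion_arg q L z i.
Proof. by rewrite /arg cell_coordE /fusion_arg mulrCA. Qed.

Lemma mem_box i : L i \in r.
Proof. by rewrite mem_rev; exact: codom_f. Qed.

Lemma boxP b : b \in r -> exists i, b = L i.
Proof. by rewrite mem_rev => /codomP. Qed.

(** The factors depend only on quotients of parameters, so the division by c does
    not change them. *)
Lemma fusion_funE c z : c != 0 ->
  fusion_fun q L z = fusion_at q T r (cell_coord c ^~ z).
Proof.
move=> c0; rewrite /fusion_at /args /reading_rev map_rev fusion_rev.
have sz : size [seq arg q (cell_coord c ^~ z) b | b <- reading L] = n.
  by rewrite size_map size_codom card_ord.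
have nthE (i : 'I_n) : [seq arg q (cell_coord c ^~ z) b | b <- reading L]`_i
    = c^-1 * fusion_arg q L z i.
  rewrite /reading /codom /image_mem -map_comp (nth_map i) ?size_enum_ord //.
  by rewrite nth_ord_enum /= arg_coord.
rewrite sz; apply: eq_bigr => j _.
rewrite [RHS](big_ord_widen n (fun i : nat => factor q T (j - i) _`_i _`_j)) 1?ltnW //.
by apply: eq_bigr => i _; rewrite !nthE factor_scale // invr_eq0.
Qed.

Variables (lab : cell -> nat) (dir : cell -> bool) (V : set ('I_n -> K)).
Hypotheses (hl : labelling lab dir)
  (V_lab : forall z, V z -> forall i j, lab (L i) = lab (L j) -> z i = z j)
  (V_line : forall t, V (fun i => line q lab t (L i))).

Lemma polyline_space : polyline (fun t i => line q lab t (L i)) (fun=> 1) 0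
  (fun z => V z /\ fusion_dom q L z).
Proof.
have [lp l0 [E E0 EV]] := polyline_dom q0 qn hl (std_uniq sr).
split; first by move=> i; exact: lp.
  by apply: funext => i; rewrite l0.
exists E => // t /EV[_ u n0]; split; first exact: V_line.
have argE i : fusion_arg q L (fun i => line q lab t (L i)) i = arg q (line q lab t) (L i) by [].
move=> i j ij; rewrite !argE; split.
  by apply: contraNneq n0 => <-; apply: map_f; exact: mem_box.
apply/eqP => e; have /(@box_inj _ _ L) eij := uniq_map_inj u (mem_box i) (mem_box j) e.
by move: ij; rewrite eij ltnn.
Qed.

(** The set [fusion_dom] allows the last parameter to be 0, unlike [dom];
    the product of the z_i removes this case near the limit point. *)
Lemma space_regular c : c != 0 ->
  regular_value (fusion_dom q L) (fusion_fun q L) V (fun=> c) (fusion_value q T r).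
Proof.
move=> c0; apply: regular_to_value.
  have [_ _ [E E0 EV]] := polyline_space.
  have [ts [_ ts1 tsE]] := many_nonroots (qexp_inj q0 qn) 1 E0.
  by case: ts ts1 tsE => // t ts _ /(_ t (mem_head _ _))/EV h; exists (fun i => line q lab t (L i)).
have he : ratfun (fun=> c) (fun z : 'I_n -> K => \prod_(i <- enum 'I_n) z i).
  by apply: ratfun_prod => i; exact: rat_coord.
apply: (regular_open he); first by rewrite prodf_seq_neq0; apply/allP.
have := fusion_valueP HT q0 qn sr szr hl.
have cp b : cell_coord c b (fun=> c) = all_one K b.
  by rewrite /cell_coord; case: pickP => // i _; rewrite mulVf.
move/(regular_comp (c := cell_coord c) (ratfun_cell_coord _ c) cp).
pose W (z : 'I_n -> K) := (V z /\ fusion_dom q L z) /\ \prod_(i <- enum 'I_n) z i != 0.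
move=> /(_ W) h; have {h}: regular W (fun=> c) (fun z => fusion_at q T r (cell_coord c ^~ z)) (fusion_value q T r).
  apply: h => z [[Vz Dz] ez].
  have z0 i : z i != 0.
    by apply: contraNneq ez => zi; rewrite (big_rem i) ?mem_enum //= zi mul0r.
  split.
  - move=> _ _ /boxP[i ->] /boxP[j ->] lij; rewrite !cell_coordE; congr (_ * _).
    exact: V_lab.
  - rewrite map_inj_in_uniq ?(std_uniq sr) // => _ _ /boxP[i ->] /boxP[j ->].
    rewrite !arg_coord => /(mulfI _) e; congr (L _).
    have {}e := e (invr_neq0 c0).
    case: (ltngtP i j) => [ij|ji|/val_inj //].
      by have [_] := Dz _ _ ij; rewrite e eqxx.
    by have [_] := Dz _ _ ji; rewrite e eqxx.
  - apply/mapP => -[_ /boxP[i ->]] /esym/eqP; rewrite /arg cell_coordE !mulf_eq0.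
    by rewrite invr_eq0 (negPf c0) (negPf (z0 i)) orbF expfz_eq0 (negPf q0) andbF.
apply: (regular_near (e := fun=> 1)); [exact: rat_const|exact: oner_neq0|].
by move=> z _ _; exact: fusion_funE.
Qed.

Lemma value_unique v : 
  regular_value (fusion_dom q L) (fusion_fun q L) V (fun=> 1) v -> v = fusion_value q T r.
Proof.
move=> rv; apply: (regular_unique (qexp_inj q0 qn) polyline_space (value_to_regular rv)).
by apply: value_to_regular; apply: space_regular; exact: oner_neq0.
Qed.
End SubspaceValue.

Section FusionElement.
Variables (lam : seq nat) (L : std_tableau n lam).
Hypothesis hlam : is_partition n lam.

Lemma row_regular c : c != 0 ->
  regular_value (fusion_dom q L) (fusion_fun q L) (row_space L) (fun=> c)
    (fusion_value q T (reading_rev L)).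
Proof.
apply: (space_regular hlam labelling_row) => [z Vz i j|t i j e]; first exact: Vz.
by rewrite /line e.
Qed.

Lemma hook_regular c : c != 0 ->
  regular_value (fusion_dom q L) (fusion_fun q L) (hook_space L) (fun=> c)
    (fusion_value q T (reading_rev L)).
Proof.
apply: (space_regular hlam labelling_hook) => [z Vz i j e|t i j [k [h1 h2]]].
  apply: Vz; exists (minn (L i).1 (L i).2).
  have dg a : diagram lam (L a) by apply/(box_diagram L); exists a.
  by rewrite /principal_hook !dg; move: e; clear; case: (L i) (L j) => [? ?] [? ?] /=; lia.
rewrite /line; congr (1 + t * q ^+ _); move: h1 h2; rewrite /principal_hook.
by move=> /andP[_ h1] /andP[_ h2]; move: h1 h2; case: (L i) (L j) => [? ?] [? ?] /=; lia.
Qed.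

(** The chosen element is determined by its property, because the row subspace
    contains a line through the limit point. *)
Lemma fusion_eltE : fusion_elt q L = fusion_value q T (reading_rev L).
Proof.
apply: (value_unique (V := row_space L) hlam labelling_row) => [z Vz i j|t i j e|].
- exact: Vz.
- by rewrite /line e.
pose P := fun v => forall c : K, c != 0 ->
  regular_value (fusion_dom q L) (fusion_fun q L) (row_space L) (fun=> c) v.
have Pv : P (fusion_value q T (reading_rev L)) by exact: row_regular.
have PF : P (fusion_elt q L) by exact: (xgetPex 0 (ex_intro P _ Pv)).
exact: PF (oner_neq0 K).
Qed.

Local Notation r := (reading_rev L).
Local Notation F := (fusion_elt q L).

Let sr : std r. Proof. exact: std_reading_rev. Qed.

(** The linear form of [act_fusion] takes the value 1 on the product and hence on its
    limit. *)
Lemma fusion_elt_neq0 : F != 0.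
Proof.
rewrite fusion_eltE; have szr := size_reading_rev L.
have rv := fusion_valueP HT q0 qn sr (eq_leq szr) labelling_row.
pose f (h : H) : K^o := act h (decreasing K n) id.
have fL : linear f.
  move=> c g h; rewrite /f (actD q0); congr (_ + _).
  exact: (congr1 (fun f => f id) (actZ q0 c g (decreasing K n))).
pose fl := GRing.isLinear.Build K H K^o _ f fL.
pose G : {linear H -> K^o} := HB.pack f fl.
have e : G (fusion_value q T r) = 1.
  apply: (regular_limit (qexp_inj q0 qn) (polyline_dom q0 qn labelling_row (std_uniq sr)) _ rv).
  move=> z _; rewrite /G /= /f /fusion_at.
  by have := @act_fusion K q q0 n (args q z r); rewrite size_map szr; exact.
by apply: contraTneq isT => v0; move: e; rewrite v0 raddf0 => /eqP; rewrite eq_sym oner_eq0.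
Qed.

Lemma lideal_gen_mem : F \in in_lideal F.
Proof. by apply/asboolP; exists 1; rewrite mul1r. Qed.

Definition lideal_gen : lideal F := Sub (F : H^o) lideal_gen_mem.

Lemma lidealP (x : lideal F) : exists h : H, \val x = h * F :> H^o.
Proof. by have /asboolP := valP x. Qed.

Lemma fusion_irreducible : irreducible_module (lideal F).
Proof.
split.
  exists lideal_gen; apply/eqP => /(congr1 val) /= e.
  by have := fusion_elt_neq0; rewrite e eqxx.
move=> S [S0 Slin].
pose S' (u : H) := exists2 y : lideal F, y \in S & \val y = u.
have S'D u v : S' u -> S' v -> S' (u + v).
  move=> [y yS <-] [y' yS' <-]; exists (1 *: y + y'); first exact: Slin.
  by rewrite scale1r raddfD.
have S'M h u : S' u -> S' (h * u).
  move=> [y yS <-]; exists (h *: y + 0); first exact: Slin.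
  by rewrite addr0 linearZ.
have [[x xS x0]|no] := pselect (exists2 x : lideal F, x \in S & x != 0).
  right=> y; have [h xE] := lidealP x; have [h' yE] := lidealP y.
  have gen := @hecke_generated K q n.
  have sz := size_reading_rev L.
  have [g gS gE] : S' F.
    rewrite fusion_eltE; apply: (submodule_full HT q0 qn sr sz S'D S'M (h := h) gen).
      by exists x => //; rewrite xE fusion_eltE.
    rewrite -fusion_eltE -xE; apply: contraNneq x0 => e.
    by apply/eqP/val_inj.
  have -> : y = h' *: g + 0.
    by apply: val_inj; rewrite addr0 linearZ /= gE yE.
  by rewrite Slin.
left=> y; rewrite inE; apply/idP/eqP => [yS|->//].
by apply/eqP; apply: contrapT => /negP y0; apply: no; exists y.
Qed.

End FusionElement.

(** An isomorphism takes the generator to an element with the same Jucys-Murphy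
    weight, which does not occur for another shape. *)
Lemma fusion_inequivalent lam mu (L : std_tableau n lam) (M : std_tableau n mu) :
    is_partition n lam -> is_partition n mu -> mu <> lam ->
  ~ equivalent_modules (lideal (fusion_elt q L)) (lideal (fusion_elt q M)).
Proof.
move=> hlam hmu ne [f fbij].
set FL := fusion_elt q L; set FM := fusion_elt q M.
have sL := std_reading_rev L hlam; have sM := std_reading_rev M hmu.
have szL := size_reading_rev L; have szM := size_reading_rev M.
have nt : ~~ tableau (reading_rev M) (reading_rev L).
  rewrite /tableau sL /=; apply/negP => /perm_mem e; apply: ne.
  by apply: (diagram_inj hmu hlam) => b; rewrite -(mem_reading_rev M) -(mem_reading_rev L) e.
pose x := lideal_gen L; have [h hE] := lidealP (f x).
have weightE j : (j < n)%N -> jucys_murphy T j *: x = (weight q j (reading_rev L))%:A *: x.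
  move=> jn; apply: val_inj; rewrite !linearZ /=.
  rewrite (fusion_eltE L hlam) -[LHS]/(jucys_murphy T j * fusion_value q T (reading_rev L)).
  rewrite -[RHS]/((weight q j (reading_rev L))%:A * fusion_value q T (reading_rev L)).
  rewrite -(tableau_vec_r0 q T sL) mulr_algl.
  apply: (jucys_murphy_weight HT q0 qn sL szL) => //.
  by rewrite /tableau sL perm_refl.
have z : h * fusion_value q T (reading_rev M) = 0.
  apply: (weight_zero HT q0 qn sM szM (@hecke_generated K q n) sL szL nt) => j jn.
  have := congr1 (fun y => \val (f y)) (weightE j jn).
  rewrite !linearZ /= hE (fusion_eltE M hmu) => e.
  by rewrite [LHS]e -[RHS]mulr_algl.
have : x = 0.
  apply: (bij_inj fbij); rewrite raddf0; apply: val_inj.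
  by rewrite hE (fusion_eltE M hmu) z.
by move=> /(congr1 val) /= e; have := fusion_elt_neq0 L hlam; rewrite e eqxx.
Qed.

End Main.

Section Indeterminate.
Variable R : realType.

Lemma qvar_neq0 : qvar R != 0.
Proof. by rewrite tofrac_eq0 polyX_eq0. Qed.

Lemma qvar_root m : (0 < m)%N -> qvar R ^+ m != 1.
Proof.
move=> m0; rewrite -rmorphXn -[X in _ != X](rmorph1 (@tofrac _)) tofrac_eq.
by apply: contraTneq m0 => /(congr1 (size : {poly R[i]} -> nat)); rewrite size_polyXn size_poly1; lia.
Qed.
End Indeterminate.

Theorem theorem1p2 (R : realType) (n : nat) (hn : (0 < n)%N)
    (lam : seq nat) (hlam : is_partition n lam) (L : std_tableau n lam) :
  let q := qvar R in
  [/\ forall c : Cq R, c != 0 ->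
        regular_value (fusion_dom q L) (fusion_fun q L) (row_space L)
          (fun=> c) (fusion_elt q L),
      forall c : Cq R, c != 0 ->
        regular_value (fusion_dom q L) (fusion_fun q L) (hook_space L)
          (fun=> c) (fusion_elt q L),
      irreducible_module (lideal (fusion_elt q L))
    & forall (mu : seq nat) (hmu : is_partition n mu) (M : std_tableau n mu),
        mu <> lam ->
        ~ equivalent_modules (lideal (fusion_elt q L))
                             (lideal (fusion_elt q M))].
Proof.
move=> q; have q0 := qvar_neq0 R; have qn := @qvar_root R.
split.
- by move=> c; rewrite (fusion_eltE q0 qn L hlam); exact: row_regular.
- by move=> c; rewrite (fusion_eltE q0 qn L hlam); exact: hook_regular.
- exact: fusion_irreducible.
- by move=> mu hmu M; exact: fusion_inequivalent.
Qed.
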